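(* Assume the parameters of the stochastic prox-sliding procedure are $p_t=\frac t2$ and $\theta_t=\frac{2(t+1)}{t(t+3)}$ for all $t\ge1$, and that there exists $\mathcal{D}_X>0$ such that $V(x,y)\le\mathcal{D}_X$ for all $x,y\in X$. Assume the stochastic oracle satisfies $\mathbb{E}[H(u,\xi)]=h'(u)\in\partial h(u)$ and $\mathbb{E}[\|H(u,\xi)-h'(u)\|_*^2]\le\sigma^2$. a) If $\beta_k=\frac{2L}{\nu k}$, $\gamma_k=\frac{2}{k+1}$ and $T_k=\left\lceil\frac{N(M^2+\sigma^2)k^2}{\tilde DL^2}\right\rceil$ with $\tilde D=\frac{3\mathcal{D}_X}{4\nu}$ for a suitable iteration limit $N$, then the numbers of evaluations of $\nabla f$ and of stochastic subgradients of $h$ required by the SGS algorithm to find a stochastic $\epsilon$-solution can be bounded, respectively, by $$\mathcal{O}\left(\sqrt{\frac{L\mathcal{D}_X}{\nu\epsilon}}\right)\quad\text{and}\quad\mathcal{O}\left\{\frac{(M^2+\sigma^2)\mathcal{D}_X}{\nu\epsilon^2}+\sqrt{\frac{L\mathcal{D}_X}{\nu\epsilon}}\right\}.$$ b) If in addition $\mathbb{E}[\exp(\|H(u,\xi)-h'(u)\|_*^2/\sigma^2)]\le\exp(1)$, then the numbers of evaluations of $\nabla f$ and of stochastic subgradients of $h$ required by the SGS algorithm to find a stochastic $(\epsilon,\Lambda)$-solution can be bounded, respectively, by $$\mathcal{O}\left\{\sqrt{\frac{L\mathcal{D}_X}{\nu\epsilon}\max\left(1,\log\frac1\Lambda\right)}\right\}$$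 and $$\mathcal{O}\left\{\frac{(M^2+\sigma^2)\mathcal{D}_X}{\nu\epsilon^2}\max\left(1,\log^2\frac1\Lambda\right)+\sqrt{\frac{L\mathcal{D}_X}{\nu\epsilon}\max\left(1,\log\frac1\Lambda\right)}\right\}.$$ c) The bounds in parts a) and b) still hold if $X$ is bounded and the parameters are set instead to $\beta_k=\frac{9L(1-P_{T_k})}{2\nu(k+1)}$, $\gamma_k=\frac{3}{k+2}$ and $T_k=\left\lceil\frac{(M^2+\sigma^2)(k+1)^3}{\tilde DL^2}\right\rceil$ with $\tilde D=\frac{81\mathcal{D}_X}{32\nu}$.
   Context: Problem. $\|\cdot\|$ is an arbitrary norm on $\mathbb{R}^n$ with dual norm $\|\cdot\|_*$. $X\subseteq\mathbb{R}^n$ is closed and convex, and $\Psi^*=\min_{x\in X}\{\Psi(x):=f(x)+h(x)+\mathcal{X}(x)\}$, where $f,h,\mathcal{X}:X\to\mathbb{R}$ are convex, $\mathcal X$ is simple, $f$ is differentiable, and for constants $L,M>0$, for all $x,y\in X$: $f(x)\le f(y)+\langle\nabla f(y),x-y\rangle+\frac L2\|x-y\|^2$ and $h(x)\le h(y)+\langle h'(y),x-y\rangle+M\|x-y\|$, with $h'(y)\in\partial h(y)$. An optimal solution is assumed to exist. A stochastic $\epsilon$-solution is a (random) point $\bar x\in X$ with $\mathbb{E}[\Psi(\bar x)-\Psi^*]\le\epsilon$; a stochastic $(\epsilon,\Lambda)$-solution ($\epsilon>0$, $\Lambda\in(0,1)$) is a point $\bar x\in X$ with $\mathrm{Prob}\{\Psi(\bar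 x)-\Psi^*\le\epsilon\}>1-\Lambda$. Prox-function. $\omega:X\to\mathbb{R}$ is continuously differentiable with $\langle x-z,\nabla\omega(x)-\nabla\omega(z)\rangle\ge\nu\|x-z\|^2$ for all $x,z\in X$ ($\nu>0$), and $V(x,z)=\omega(z)-[\omega(x)+\langle\nabla\omega(x),z-x\rangle]$. Minimization subproblems below are assumed solvable. Stochastic oracle. At each call with search point $u\in X$ it returns $H(u,\xi)$, where $\xi$ is a fresh random vector, independent of the current and earlier search points and earlier samples; the moment assumptions hold for every $u\in X$. Notation. $l_f(x,y)=f(x)+\langle\nabla f(x),y-x\rangle$; $P_0=1$, $P_t=\frac{p_t}{1+p_t}P_{t-1}$ for $t\ge1$. SGS algorithm. Input $x_0\in X$ and $N$; $\bar x_0=x_0$. For $k=1,\dots,N$: set $\underline x_k=(1-\gamma_k)\bar x_{k-1}+\gamma_kx_{k-1}$ and $g_k(\cdot)=l_f(\underline x_k,\cdot)$; compute $(x_k,\tilde x_k)=\mathrm{SPS}(g_k,x_{k-1},\beta_k,T_k)$; set $\bar x_k=(1-\gamma_k)\bar x_{k-1}+\gamma_k\tilde x_k$. Output $\bar x_N$. Stochastic prox-sliding procedure $\mathrm{SPS}(g,x,\beta,T)$: set $u_0=\tilde u_0=x$; for $t=1,\dots,T$ set $u_t=\arg\min_{u\in X}\{g(u)+\langle H(u_{t-1},\xi_{t-1}),u\rangle+\beta V(x,u)+\beta p_tV(u_{t-1},u)+\mathcal{X}(u)\}$ and $\tilde u_t=(1-\theta_t)\tilde u_{t-1}+\theta_tu_t$;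 return $(u_T,\tilde u_T)$. A run with limit $N$ uses $N$ evaluations of $\nabla f$ and $\sum_{k=1}^NT_k$ stochastic subgradient evaluations. The $\mathcal{O}(\cdot)$ bounds mean: there are absolute constants such that, for all sufficiently small $\epsilon>0$ (the threshold may depend on the problem data), one can choose $N$ so that $\bar x_N$ is a solution of the stated type and the numbers of evaluations are at most the constants times the displayed expressions. *)

(* Defs.v *)
From mathcomp Require Import all_boot all_order all_algebra.
From mathcomp Require Import all_classical all_reals all_analysis.

Set Implicit Arguments.
Unset Strict Implicit.
Unset Printing Implicit Defensive.

Import Order.TTheory GRing.Theory Num.Theory.
Import numFieldNormedType.Exports.

Local Open Scope classical_set_scope.
Local Open Scope ring_scope.

(* R^n is ['rV[R]_n] with its canonical topology, which is the topology of
   every norm on R^n; [borel_rV R n] is R^n with the Borel sigma-algebra. *)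
Notation borel_rV R n := (g_sigma_algebraType (@open 'rV[R]_n)).

Definition dotp (R : realType) (n : nat) (u v : 'rV[R]_n) : R :=
  \sum_(i < n) u 0 i * v 0 i.

Definition is_norm (R : realType) (n : nat) (nrm : 'rV[R]_n -> R) : Prop :=
  [/\ forall x y, nrm (x + y) <= nrm x + nrm y,
      forall (a : R) x, nrm (a *: x) = `|a| * nrm x
    & forall x, nrm x = 0 -> x = 0].

Definition dual_norm (R : realType) (n : nat) (nrm : 'rV[R]_n -> R)
    (v : 'rV[R]_n) : R :=
  sup [set dotp v x | x in [set x | nrm x <= 1]].

(* Functions on X are total functions whose values outside X are never used,
   so differentiability at a point of X is relative to X. *)
Definition has_gradient_within (R : realType) (n : nat)
    (nrm : 'rV[R]_n -> R) (X : set 'rV[R]_n) (f : 'rV[R]_n -> R)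
    (x g : 'rV[R]_n) : Prop :=
  (f y - f x - dotp g (y - x)) / nrm (y - x) @[y --> within X x^'] --> (0 : R).

Definition subdifferential (R : realType) (n : nat) (X : set 'rV[R]_n)
    (h : 'rV[R]_n -> R) (y : 'rV[R]_n) : set 'rV[R]_n :=
  [set g | forall x, X x -> h y + dotp g (x - y) <= h x].

Definition is_argmin (R : realType) (n : nat) (X : set 'rV[R]_n)
    (F : 'rV[R]_n -> R) (u : 'rV[R]_n) : Prop :=
  X u /\ forall v, X v -> F u <= F v.

Record problem (R : realType) (n : nat) := Problem {
  nrm : 'rV[R]_n -> R;
  nrmP : is_norm nrm;
  dom : set 'rV[R]_n;
  dom_closed : closed dom;
  dom_convex : convex_set dom;
  ff : 'rV[R]_n -> R;
  hh : 'rV[R]_n -> R;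
  chi : 'rV[R]_n -> R;
  f_convex : convex_function dom ff;
  h_convex : convex_function dom hh;
  chi_convex : convex_function dom chi;
  (* makes the objective value at a random point a random variable; ff and
     hh are continuous on dom by the conditions below *)
  chi_measurable : measurable_fun (dom : set (borel_rV R n)) chi;
  grad_f : 'rV[R]_n -> 'rV[R]_n;
  grad_fP : forall x, dom x -> has_gradient_within nrm dom ff x (grad_f x);
  (* the selection h' of subgradients *)
  sub_h : 'rV[R]_n -> 'rV[R]_n;
  sub_hP : forall x, dom x -> subdifferential dom hh x (sub_h x);
  Lf : R;
  Lf_gt0 : 0 < Lf;
  f_smooth : forall x y, dom x -> dom y ->
    ff x <= ff y + dotp (grad_f y) (x - y) + Lf / 2 * nrm (x - y) ^+ 2;
  Mh : R;
  Mh_gt0 : 0 < Mh;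
  h_lipschitz : forall x y, dom x -> dom y ->
    hh x <= hh y + dotp (sub_h y) (x - y) + Mh * nrm (x - y);
  optimum_exists : exists xs, is_argmin dom (fun x => ff x + hh x + chi x) xs
}.

Definition Psi (R : realType) (n : nat) (pb : problem R n) (x : 'rV[R]_n) : R :=
  ff pb x + hh pb x + chi pb x.

Definition Psi_opt (R : realType) (n : nat) (pb : problem R n) : R :=
  inf [set Psi pb x | x in dom pb].

(* the linearization l_f(x, y) *)
Definition lin_f (R : realType) (n : nat) (pb : problem R n)
    (x y : 'rV[R]_n) : R :=
  ff pb x + dotp (grad_f pb x) (y - x).

Record prox_function (R : realType) (n : nat) (pb : problem R n) :=
  ProxFunction {
  omega : 'rV[R]_n -> R;
  grad_omega : 'rV[R]_n -> 'rV[R]_n;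
  grad_omegaP : forall x, dom pb x ->
    has_gradient_within (nrm pb) (dom pb) omega x (grad_omega x);
  grad_omega_continuous : {within dom pb, continuous grad_omega};
  nu : R;
  nu_gt0 : 0 < nu;
  omega_strongly_convex : forall x z, dom pb x -> dom pb z ->
    nu * nrm pb (x - z) ^+ 2 <= dotp (x - z) (grad_omega x - grad_omega z)
}.

Definition bregman (R : realType) (n : nat) (pb : problem R n)
    (prx : prox_function pb) (x z : 'rV[R]_n) : R :=
  omega prx z - (omega prx x + dotp (grad_omega prx x) (z - x)).

Definition step_p (R : realType) (t : nat) : R := t%:R / 2.

Definition step_theta (R : realType) (t : nat) : R :=
  2 * (t.+1)%:R / (t%:R * (t + 3)%:R).

Fixpoint prod_p (R : realType) (t : nat) : R :=
  if t is t'.+1 then step_p R t / (1 + step_p R t) * prod_p R t' else 1.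

(* beta_k, gamma_k and T_k, indexed by k >= 1 *)
Record schedule (R : realType) := Schedule {
  beta_ : nat -> R;
  gamma_ : nat -> R;
  T_ : nat -> nat
}.

(* One call SPS(g, x, beta, T) with samples z_0, ..., z_{T-1} produces the
   search points u_0, ..., u_T.  Solvability of the subproblems is part of
   being a run; minimizers are unique by strong convexity. *)
Definition sps_run (R : realType) (n : nat) (pb : problem R n)
    (prx : prox_function pb) (Xi : Type) (H : 'rV[R]_n -> Xi -> 'rV[R]_n)
    (g : 'rV[R]_n -> R) (x : 'rV[R]_n) (beta : R) (T : nat)
    (z : nat -> Xi) (u : nat -> 'rV[R]_n) : Prop :=
  u 0%N = x /\
  forall t, (t < T)%N ->
    is_argmin (dom pb)
      (fun v => g v + dotp (H (u t) (z t)) v + beta * bregman prx x v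
                + beta * step_p R t.+1 * bregman prx (u t) v + chi pb v)
      (u t.+1).

(* the averaged point \tilde u_t *)
Fixpoint sps_avg (R : realType) (n : nat) (x : 'rV[R]_n)
    (u : nat -> 'rV[R]_n) (t : nat) : 'rV[R]_n :=
  if t is t'.+1 then
    (1 - step_theta R t) *: sps_avg x u t' + step_theta R t *: u t
  else x.

(* x_k; [u k t] is the search point u_t of the k-th call of SPS *)
Definition sgs_center (R : realType) (n : nat) (S : schedule R)
    (x0 : 'rV[R]_n) (u : nat -> nat -> 'rV[R]_n) (k : nat) : 'rV[R]_n :=
  if k is _.+1 then u k (T_ S k) else x0.

(* \bar x_k *)
Fixpoint sgs_bar (R : realType) (n : nat) (S : schedule R)
    (x0 : 'rV[R]_n) (u : nat -> nat -> 'rV[R]_n) (k : nat) : 'rV[R]_n :=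
  if k is k'.+1 then
    (1 - gamma_ S k) *: sgs_bar S x0 u k'
    + gamma_ S k *: sps_avg (sgs_center S x0 u k') (u k) (T_ S k)
  else x0.

(* \underline x_{k+1} *)
Definition sgs_md (R : realType) (n : nat) (S : schedule R)
    (x0 : 'rV[R]_n) (u : nat -> nat -> 'rV[R]_n) (k : nat) : 'rV[R]_n :=
  (1 - gamma_ S k.+1) *: sgs_bar S x0 u k
  + gamma_ S k.+1 *: sgs_center S x0 u k.

Definition sgs_run (R : realType) (n : nat) (pb : problem R n)
    (prx : prox_function pb) (Xi : Type) (H : 'rV[R]_n -> Xi -> 'rV[R]_n)
    (S : schedule R) (N : nat) (x0 : 'rV[R]_n)
    (z : nat -> nat -> Xi) (u : nat -> nat -> 'rV[R]_n) : Prop :=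
  forall k, (k < N)%N ->
    sps_run prx H (lin_f pb (sgs_md S x0 u k)) (sgs_center S x0 u k)
      (beta_ S k.+1) (T_ S k.+1) (z k.+1) (u k.+1).

(* The oracle calls of a run with limit N are indexed by pairs (k, t) with
   1 <= k <= N and 0 <= t < T_k: call (k, t) is made at [u k t] with sample
   [xi k t].  Calls are made in lexicographic order. *)
Definition is_call (R : realType) (S : schedule R) (N k t : nat) : bool :=
  [&& (0 < k)%N, (k <= N)%N & (t < T_ S k)%N].

Definition before (k' t' k t : nat) : bool :=
  (k' < k)%N || (k' == k) && (t' < t)%N.

(* sigma-algebra generated by the search points up to call (k, t), included,
   and by the samples of the calls before (k, t) *)
Definition history (R : realType) (n : nat) (d d' : measure_display)
    (Omega : measurableType d) (Xi : measurableType d')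
    (S : schedule R) (N : nat) (xi : nat -> nat -> Omega -> Xi)
    (u : nat -> nat -> Omega -> borel_rV R n) (k t : nat) : set (set Omega) :=
  <<s [set A | exists k' t', is_call S N k' t' /\
        (((before k' t' k t \/ (k', t') = (k, t)) /\
          preimage_set_system setT (u k' t') measurable A)
         \/ (before k' t' k t /\
             preimage_set_system setT (xi k' t') measurable A))] >>.

Definition fresh_samples (R : realType) (n : nat) (d d' : measure_display)
    (Omega : measurableType d) (P : probability Omega R)
    (Xi : measurableType d') (S : schedule R) (N : nat)
    (xi : nat -> nat -> Omega -> Xi)
    (u : nat -> nat -> Omega -> borel_rV R n) : Prop :=
  forall k t, is_call S N k t ->
  forall (A : set Omega) (B : set Xi), history S N xi u k t A -> measurable B ->
    (P (A `&` xi k t @^-1` B) = P A * P (xi k t @^-1` B))%E.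

Definition stochastic_sgs_run (R : realType) (n : nat) (pb : problem R n)
    (prx : prox_function pb) (d d' : measure_display)
    (Omega : measurableType d) (P : probability Omega R)
    (Xi : measurableType d') (H : 'rV[R]_n -> Xi -> 'rV[R]_n)
    (S : schedule R) (N : nat) (x0 : 'rV[R]_n)
    (xi : nat -> nat -> {RV P >-> Xi})
    (u : nat -> nat -> {RV P >-> borel_rV R n}) : Prop :=
  (forall w, sgs_run prx H S N x0 (fun k t => xi k t w) (fun k t => u k t w))
  /\ fresh_samples P S N (fun k t => xi k t : Omega -> Xi)
       (fun k t => u k t : Omega -> borel_rV R n).

Definition oracle_measurable (R : realType) (n : nat) (pb : problem R n)
    (d' : measure_display) (Xi : measurableType d')
    (H : 'rV[R]_n -> Xi -> 'rV[R]_n) : Prop :=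
  measurable_fun (dom pb `*` setT : set (borel_rV R n * Xi))
    (fun q : borel_rV R n * Xi => H q.1 q.2 : borel_rV R n).

(* An expectation equal to a real number is that of an integrable function. *)
Definition oracle_unbiased (R : realType) (n : nat) (pb : problem R n)
    (d d' : measure_display) (Omega : measurableType d)
    (P : probability Omega R) (Xi : measurableType d')
    (H : 'rV[R]_n -> Xi -> 'rV[R]_n) (xi : Omega -> Xi) : Prop :=
  forall u, dom pb u -> forall i,
    ('E_P[fun w => H u (xi w) ord0 i] = (sub_h pb u ord0 i)%:E)%E.

Definition oracle_variance (R : realType) (n : nat) (pb : problem R n)
    (d d' : measure_display) (Omega : measurableType d)
    (P : probability Omega R) (Xi : measurableType d')
    (H : 'rV[R]_n -> Xi -> 'rV[R]_n) (sigma : R) (xi : Omega -> Xi) : Prop :=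
  forall u, dom pb u ->
    ('E_P[fun w => (dual_norm (nrm pb) (H u (xi w) - sub_h pb u) ^+ 2)%R]
     <= (sigma ^+ 2)%:E)%E.

Definition oracle_light_tail (R : realType) (n : nat) (pb : problem R n)
    (d d' : measure_display) (Omega : measurableType d)
    (P : probability Omega R) (Xi : measurableType d')
    (H : 'rV[R]_n -> Xi -> 'rV[R]_n) (sigma : R) (xi : Omega -> Xi) : Prop :=
  forall u, dom pb u ->
    ('E_P[fun w => (expR (dual_norm (nrm pb) (H u (xi w) - sub_h pb u) ^+ 2
                          / sigma ^+ 2))%R]
     <= (expR 1)%:E)%E.

Definition random_feasible_point (R : realType) (n : nat) (pb : problem R n)
    (d : measure_display) (Omega : measurableType d)
    (xbar : Omega -> borel_rV R n) : Prop :=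
  measurable_fun setT xbar /\ forall w, dom pb (xbar w).

Definition stochastic_solution (R : realType) (n : nat) (pb : problem R n)
    (d : measure_display) (Omega : measurableType d)
    (P : probability Omega R) (eps : R)
    (xbar : Omega -> borel_rV R n) : Prop :=
  random_feasible_point pb xbar /\
  ('E_P[fun w => (Psi pb (xbar w) - Psi_opt pb)%R] <= eps%:E)%E.

Definition stochastic_prob_solution (R : realType) (n : nat)
    (pb : problem R n) (d : measure_display) (Omega : measurableType d)
    (P : probability Omega R) (eps Lam : R)
    (xbar : Omega -> borel_rV R n) : Prop :=
  random_feasible_point pb xbar /\
  ((1 - Lam)%:E < P [set w | (Psi pb (xbar w) - Psi_opt pb <= eps)%R])%E.

Definition finds_stochastic_solution (R : realType) (n : nat)
    (pb : problem R n) (prx : prox_function pb) (sigma : R)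
    (S : schedule R) (N : nat) (eps : R) : Prop :=
  forall (d d' : measure_display) (Omega : measurableType d)
    (P : probability Omega R) (Xi : measurableType d')
    (H : 'rV[R]_n -> Xi -> 'rV[R]_n) (x0 : 'rV[R]_n)
    (xi : nat -> nat -> {RV P >-> Xi})
    (u : nat -> nat -> {RV P >-> borel_rV R n}),
  dom pb x0 ->
  oracle_measurable pb H ->
  (forall k t, is_call S N k t -> oracle_unbiased pb P H (xi k t)) ->
  (forall k t, is_call S N k t -> oracle_variance pb P H sigma (xi k t)) ->
  stochastic_sgs_run prx H S N x0 xi u ->
  stochastic_solution pb P eps (fun w => sgs_bar S x0 (fun k t => u k t w) N).

Definition finds_stochastic_prob_solution (R : realType) (n : nat)
    (pb : problem R n) (prx : prox_function pb) (sigma : R)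
    (S : schedule R) (N : nat) (eps Lam : R) : Prop :=
  forall (d d' : measure_display) (Omega : measurableType d)
    (P : probability Omega R) (Xi : measurableType d')
    (H : 'rV[R]_n -> Xi -> 'rV[R]_n) (x0 : 'rV[R]_n)
    (xi : nat -> nat -> {RV P >-> Xi})
    (u : nat -> nat -> {RV P >-> borel_rV R n}),
  dom pb x0 ->
  oracle_measurable pb H ->
  (forall k t, is_call S N k t -> oracle_unbiased pb P H (xi k t)) ->
  (forall k t, is_call S N k t -> oracle_variance pb P H sigma (xi k t)) ->
  (forall k t, is_call S N k t -> oracle_light_tail pb P H sigma (xi k t)) ->
  stochastic_sgs_run prx H S N x0 xi u ->
  stochastic_prob_solution pb P eps Lam
    (fun w => sgs_bar S x0 (fun k t => u k t w) N).

(* one evaluation of the gradient of f per outer iteration *)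
Definition grad_evals (N : nat) : nat := N.

Definition subgrad_evals (R : realType) (S : schedule R) (N : nat) : nat :=
  (\sum_(1 <= k < N.+1) T_ S k)%N.

(* The iteration limit is chosen before the starting point, the oracle and
   the run; in the second definition the threshold on eps is also uniform
   in Lam. *)
Definition expectation_complexity (R : realType) (C : R) (n : nat)
    (pb : problem R n) (prx : prox_function pb) (DX sigma : R)
    (S : nat -> schedule R) : Prop :=
  exists2 eps0 : R, 0 < eps0 & forall eps : R, 0 < eps -> eps <= eps0 ->
  exists N : nat,
  [/\ (0 < N)%N,
      (grad_evals N)%:R <= C * Num.sqrt (Lf pb * DX / (nu prx * eps)),
      (subgrad_evals (S N) N)%:R <=
        C * ((Mh pb ^+ 2 + sigma ^+ 2) * DX / (nu prx * eps ^+ 2)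
             + Num.sqrt (Lf pb * DX / (nu prx * eps)))
    & finds_stochastic_solution prx sigma (S N) N eps].

Definition probability_complexity (R : realType) (C : R) (n : nat)
    (pb : problem R n) (prx : prox_function pb) (DX sigma : R)
    (S : nat -> schedule R) : Prop :=
  exists2 eps0 : R, 0 < eps0 & forall eps : R, 0 < eps -> eps <= eps0 ->
  forall Lam : R, 0 < Lam -> Lam < 1 ->
  exists N : nat,
  [/\ (0 < N)%N,
      (grad_evals N)%:R <=
        C * Num.sqrt (Lf pb * DX / (nu prx * eps) * Num.max 1 (ln (1 / Lam))),
      (subgrad_evals (S N) N)%:R <=
        C * ((Mh pb ^+ 2 + sigma ^+ 2) * DX / (nu prx * eps ^+ 2)
               * Num.max 1 (ln (1 / Lam) ^+ 2)
             + Num.sqrt (Lf pb * DX / (nu prx * eps)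
                         * Num.max 1 (ln (1 / Lam))))
    & finds_stochastic_prob_solution prx sigma (S N) N eps Lam].

Definition ceil_nat (R : realType) (x : R) : nat := absz (Num.ceil x).

(* N is the iteration limit *)
Definition schedule_N (R : realType) (L M nu DX sigma : R) (N : nat) :
    schedule R :=
  let Dt := 3 * DX / (4 * nu) in
  {| beta_ := fun k => 2 * L / (nu * k%:R);
     gamma_ := fun k => 2 / (k.+1)%:R;
     T_ := fun k => ceil_nat (N%:R * (M ^+ 2 + sigma ^+ 2) * k%:R ^+ 2
                              / (Dt * L ^+ 2)) |}.

Definition schedule_bounded (R : realType) (L M nu DX sigma : R) : schedule R :=
  let Dt := 81 * DX / (32 * nu) in
  let T := fun k : nat => ceil_nat ((M ^+ 2 + sigma ^+ 2) * (k.+1)%:R ^+ 3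
                                    / (Dt * L ^+ 2)) in
  {| beta_ := fun k => 9 * L * (1 - prod_p R (T k)) / (2 * nu * (k.+1)%:R);
     gamma_ := fun k => 3 / (k + 2)%:R;
     T_ := T |}.

(* Main.v *)
(* Optimality of u_t in the prox step gives a three-point inequality for the
   inner objective; since 1 / (p_t P_(t-1)) = t + 1, weighting it by t + 1
   telescopes the inner loop, and dividing the outer recursion by
   Gamma_k = prod_(2 <= i <= k) (1 - gamma_i) telescopes the outer one.  With
   delta_j the error of the oracle call j made at u_j, what is left is a
   deterministic term plus
     sum_j c_j <delta_j, x* - u_j> + sum_j b_j |delta_j|_*^2.
   The inner products have mean zero because a sample is independent of its
   search point.  Under the light tail assumption they are the increments of a
   martingale and conditionally sub-Gaussian, while the exponential moment of
   the second sum is bounded by Jensen; as the bounds may depend linearly on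
   log (1 / Lambda), Markov's inequality applied once, to the exponential of
   half the sum of the two normalized terms, is enough. *)

From HB Require Import structures.
Require Import Defs.
From mathcomp Require Import all_boot all_order all_algebra.
From mathcomp Require Import all_classical all_reals all_analysis.
From mathcomp Require Import measurable_realfun ring lra.
Import Order.TTheory GRing.Theory Num.Theory.
Import numFieldNormedType.Exports.
Local Open Scope classical_set_scope.
Local Open Scope ring_scope.

Set Implicit Arguments.
Unset Strict Implicit.
Unset Printing Implicit Defensive.

(** * Norms, convexity and gradients *)

(** Up to rounding the batch sizes [T_k] are proportional to [M ^ 2 + sigma ^ 2]. The noise then
    contributes to the gap a multiple of [L * DX / nu] over [N ^ 2], just as the deterministic part
    does, so the number of gradient evaluations is bounded without reference to the noise. Both
    parameter choices strike this balance up to a common factor, [1] or [N]. The record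
    [certificate] isolates what the probabilistic argument needs, and each choice is only checked
    against it. Two obstacles shape the rest. Gradients are relative to [dom], which may have empty
    interior, so differentiability enters through one-sided expansions along segments of [dom].
    Search points depend on earlier samples while freshness speaks of events, so conditional
    expectations are replaced by freezing the search point and integrating over a product law.
    Tonelli allows this for nonnegative integrands; those of varying sign are made nonnegative
    first, by adding a constant or by taking exponentials. *)

Section dot_product.
Variables (R : realType) (n : nat).
Implicit Types u v w : 'rV[R]_n.

Lemma dotpC u v : dotp u v = dotp v u.
Proof. by apply: eq_bigr => i _; rewrite mulrC. Qed.

Lemma dotpDr u v w : dotp u (v + w) = dotp u v + dotp u w.
Proof. by rewrite -big_split; apply: eq_bigr => i _; rewrite !mxE mulrDr. Qed.

Lemma dotpZr (a : R) u v : dotp u (a *: v) = a * dotp u v.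
Proof. by rewrite mulr_sumr; apply: eq_bigr => i _; rewrite !mxE mulrCA. Qed.

Lemma dotpNr u v : dotp u (- v) = - dotp u v.
Proof. by rewrite -scaleN1r dotpZr mulN1r. Qed.

Lemma dotpBr u v w : dotp u (v - w) = dotp u v - dotp u w.
Proof. by rewrite dotpDr dotpNr. Qed.

Lemma dotpDl u v w : dotp (v + w) u = dotp v u + dotp w u.
Proof. by rewrite dotpC dotpDr !(dotpC u). Qed.

Lemma dotpZl (a : R) u v : dotp (a *: v) u = a * dotp v u.
Proof. by rewrite dotpC dotpZr dotpC. Qed.

Lemma dotpNl u v : dotp (- v) u = - dotp v u.
Proof. by rewrite dotpC dotpNr dotpC. Qed.

Lemma dotpBl u v w : dotp (v - w) u = dotp v u - dotp w u.
Proof. by rewrite dotpDl dotpNl. Qed.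

Lemma dotp0r u : dotp u 0 = 0.
Proof. by rewrite -(subrr 0) dotpBr subrr. Qed.

Definition dotpE := (dotpDl, dotpDr, dotpZl, dotpZr, dotpNl, dotpNr).

End dot_product.

Section norm.
Variables (R : realType) (n : nat) (nrm : 'rV[R]_n -> R).
Hypothesis nrmP : is_norm nrm.
Implicit Types u v w : 'rV[R]_n.

Lemma nrmD v w : nrm (v + w) <= nrm v + nrm w.
Proof. by case: nrmP. Qed.

Lemma nrmZ (a : R) v : nrm (a *: v) = `|a| * nrm v.
Proof. by case: nrmP. Qed.

Lemma nrm0 : nrm 0 = 0.
Proof. by rewrite -(scale0r 0) nrmZ normr0 mul0r. Qed.

Lemma nrmN v : nrm (- v) = nrm v.
Proof. by rewrite -scaleN1r nrmZ normrN1 mul1r. Qed.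

Lemma nrm_ge0 v : 0 <= nrm v.
Proof. by have := nrmD v (- v); rewrite subrr nrm0 nrmN; lra. Qed.

Lemma nrm_gt0 v : v != 0 -> 0 < nrm v.
Proof.
move=> v0; rewrite lt_neqAle nrm_ge0 andbT eq_sym; apply: contra_neq v0.
by case: nrmP => _ _; apply.
Qed.

Lemma nrm_sqr_conv (s : R) v w : 0 <= s -> s <= 1 ->
  nrm ((1 - s) *: v + s *: w) ^+ 2 <= (1 - s) * nrm v ^+ 2 + s * nrm w ^+ 2.
Proof.
move=> s0 s1; have h := nrmD ((1 - s) *: v) (s *: w).
rewrite !nrmZ !ger0_norm ?subr_ge0// in h.
apply: (@le_trans _ _ (((1 - s) * nrm v + s * nrm w) ^+ 2)).
  by rewrite ler_sqr ?nnegrE ?nrm_ge0// (le_trans (nrm_ge0 _) h).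
have := mulr_ge0 (mulr_ge0 (_ : 0 <= 1 - s) s0) (sqr_ge0 (nrm v - nrm w)).
by rewrite subr_ge0 s1 => /(_ isT); nra.
Qed.

Lemma nrm_le_sup : exists2 C : R, 0 < C & forall v, nrm v <= C * `|v|.
Proof.
pose C := \sum_(i < n) nrm (delta_mx 0 i).
have C0 : 0 <= C by apply: sumr_ge0 => i _; exact: nrm_ge0.
have coordle v (i : 'I_n) : `|v 0 i| <= `|v|.
  rewrite [leRHS]/Num.norm /= mx_normrE.
  by exact: (le_bigmax _ (fun x : 'I_1 * 'I_n => `|v x.1 x.2|) (0, i)).
exists (C + 1) => [|v]; first lra.
apply: (@le_trans _ _ (C * `|v|)); last by rewrite mulrDl lerDl mul1r.
rewrite {1}(row_sum_delta v) /C mulr_suml.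
elim/big_ind2: _ => [|x1 x2 y1 y2 h1 h2|i _].
- by rewrite nrm0.
- exact: le_trans (nrmD _ _) (lerD h1 h2).
- by rewrite nrmZ mulrC ler_wpM2l// nrm_ge0.
Qed.

End norm.

Section convexity.
Variables (R : realType) (n : nat).
Implicit Types (X : set 'rV[R]_n) (F : 'rV[R]_n -> R) (x y : 'rV[R]_n).

Definition convex_on X F := forall x y (s : R), X x -> X y -> 0 <= s -> s <= 1 ->
  F ((1 - s) *: x + s *: y) <= (1 - s) * F x + s * F y.

Lemma convex_setP X x y (s : R) : convex_set X -> X x -> X y -> 0 <= s -> s <= 1 ->
  X ((1 - s) *: x + s *: y).
Proof.
move=> cX Xx Xy s0 s1.
have := cX y x (Itv01 s0 s1); rewrite !inE => /(_ Xy Xx).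
by rewrite (addrC ((1 - s) *: x)).
Qed.

Lemma convex_functionP X F : convex_function X F -> convex_on X F.
Proof.
move=> cF x y s Xx Xy s0 s1.
have := cF (Itv01 s0 s1) y x; rewrite !inE => /(_ Xy Xx).
by rewrite (addrC ((1 - s) *: x)) (addrC ((1 - s) * F x)).
Qed.

Lemma convex_onD X F G : convex_on X F -> convex_on X G ->
  convex_on X (fun x => F x + G x).
Proof.
move=> cF cG x y s Xx Xy s0 s1.
by have := lerD (cF x y s Xx Xy s0 s1) (cG x y s Xx Xy s0 s1); lra.
Qed.

Lemma convex_on_dotp X (c : R) (v : 'rV[R]_n) : convex_on X (fun x => c + dotp v x).
Proof. by move=> x y s _ _ _ _; rewrite !dotpE; lra. Qed.

Lemma convB x y (s : R) : (1 - s) *: x + s *: y = x + s *: (y - x).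
Proof. by rewrite scalerBl scale1r scalerBr addrAC addrA. Qed.

Variables (nrm : 'rV[R]_n -> R).
Hypothesis nrmP : is_norm nrm.

(** A segment towards a point of [X] stays in [X] even where [X] has empty interior, so a relative
    gradient gives at least a one-sided expansion along it. *)
Lemma has_gradient_within_line X F x g y :
  convex_set X -> X x -> X y -> has_gradient_within nrm X F x g ->
  forall e : R, 0 < e -> exists2 s0 : R, 0 < s0 & forall s : R, 0 < s -> s < s0 -> s <= 1 ->
    `|F (x + s *: (y - x)) - F x - s * dotp g (y - x)| <= e * s.
Proof.
move=> cX Xx Xy hg e e0.
have [->|xy] := eqVneq y x.
  exists 1 => // s s0 _ _; rewrite subrr scaler0 addr0 dotp0r mulr0 !subrr normr0.
  by rewrite mulr_ge0// ltW.
have d0 : y - x != 0 by rewrite subr_eq0.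
have nd0 : 0 < nrm (y - x) by exact: nrm_gt0.
have e'0 : 0 < e / nrm (y - x) by rewrite divr_gt0.
move/cvgrPdist_le: hg => /(_ _ e'0).
rewrite near_withinE => /nbhs_ballP[r /= r0 hr].
have nd : 0 < `|y - x| by rewrite normr_gt0.
exists (r / `|y - x|) => [|s s0 sr s1]; first by rewrite divr_gt0.
have sd : nrm (s *: (y - x)) = s * nrm (y - x) by rewrite nrmZ// gtr0_norm.
set z := x + s *: (y - x).
have zx : z - x = s *: (y - x) by rewrite /z addrAC subrr add0r.
have bx : ball x r z.
  rewrite -ball_normE /= -normrN opprB zx normrZ gtr0_norm//.
  by rewrite -ltr_pdivlMr.
have Xz : X z by rewrite /z -convB; apply: convex_setP => //; exact: ltW.
have ne : z != x by rewrite -subr_eq0 zx scaler_eq0 negb_or gt_eqF.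
have := hr z bx ne Xz.
rewrite zx sd dotpZr sub0r normrN normrM normfV (gtr0_norm (mulr_gt0 s0 nd0)).
rewrite ler_pdivrMr ?mulr_gt0//.
by rewrite (mulrCA (e / _)) divfK ?gt_eqF// (mulrC e).
Qed.

Lemma convex_gradient_le X F x g y :
  convex_set X -> convex_on X F -> X x -> X y -> has_gradient_within nrm X F x g ->
  F x + dotp g (y - x) <= F y.
Proof.
move=> cX cF Xx Xy hg; apply/ler_addgt0Pr => e e0.
have [s0 s00 hs] := has_gradient_within_line cX Xx Xy hg e0.
pose s := Num.min (s0 / 2) 1.
have sp : 0 < s by rewrite lt_min ltr01 andbT divr_gt0.
have s1 : s <= 1 by rewrite ge_min lexx orbT.
have ss0 : s < s0 by rewrite gt_min; apply/orP; left; lra.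
have := hs s sp ss0 s1; have := cF x y s Xx Xy (ltW sp) s1.
rewrite convB ler_norml => h1 /andP[h2 _].
rewrite -(ler_pM2l sp); lra.
Qed.
End convexity.

(** * The prox step *)

(** A substitute for the mean value theorem under one-sided conditions. With [c] the supremum of the
    [s] such that [psi 0 - e * s <= psi s], the left condition shows that [c] itself qualifies, and
    the right condition that [c] cannot be less than 1. *)
Lemma dini_nondecreasing (R : realType) (psi : R -> R) :
  (forall s, 0 <= s -> s < 1 -> forall e, 0 < e -> exists2 r, 0 < r &
     forall t, 0 < t -> t < r -> s + t <= 1 -> psi s - e * t <= psi (s + t)) ->
  (forall s, 0 < s -> s <= 1 -> forall e, 0 < e -> exists2 r, 0 < r &
     forall t, 0 < t -> t < r -> t <= s -> psi (s - t) - e * t <= psi s) ->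
  psi 0 <= psi 1.
Proof.
move=> hr hl; apply/ler_addgt0Pr => e e0.
pose S := [set s | [/\ 0 <= s, s <= 1 & psi 0 - e * s <= psi s]].
have S0 : S 0 by split; rewrite ?mulr0 ?subr0.
have hS : has_sup S by split; [exists 0|exists 1 => s []].
set c := sup S.
have c0 : 0 <= c by apply: sup_upper_bound.
have c1 : c <= 1 by apply: ge_sup; [exists 0|move=> s []].
have Sc : S c.
  have [->//|cn0] := eqVneq c 0.
  have cp : 0 < c by rewrite lt_neqAle eq_sym cn0.
  have [r r0 h] := hl c cp c1 e e0.
  have [s Ss sc] := sup_adherent r0 hS.
  have [s0 s1 hs] := Ss.
  have sc' : s <= c by apply: sup_upper_bound.
  have [<-//|sn] := eqVneq s c.
  have slt : s < c by rewrite lt_neqAle sn.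
  split=> //; have := h (c - s); rewrite subr_gt0 => /(_ slt).
  rewrite subKr; rewrite -/c in sc.
  have -> : c - s < r by lra.
  have -> : c - s <= c by lra.
  by move=> /(_ isT isT); lra.
have [_ _ hc] := Sc.
suff ceq : c = 1 by move: hc; rewrite ceq; lra.
apply/eqP; rewrite eq_le c1 /= leNgt; apply/negP => clt.
have [r r0 h] := hr c c0 clt e e0.
pose t := Num.min (r / 2) (1 - c).
have t0 : 0 < t by rewrite lt_min subr_gt0 clt andbT divr_gt0.
have tr : t < r by rewrite gt_min; apply/orP; left; lra.
have tc : c + t <= 1 by rewrite addrC -lerBrDr ge_min lexx orbT.
have : c + t <= c.
  apply: sup_upper_bound => //; split=> //; first lra.
  by have := h t t0 tr tc; lra.
lra.
Qed.

Section prox.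
Variables (R : realType) (n : nat) (pb : problem R n) (prx : prox_function pb).
Let X := dom pb.
Let nrm := nrm pb.
Let V := bregman prx.

Lemma bregman_ge x z : X x -> X z -> nu prx / 2 * nrm (z - x) ^+ 2 <= V x z.
Proof.
move=> Xx Xz; set d := z - x.
pose b := nu prx / 2 * nrm d ^+ 2; pose a := dotp (grad_omega prx x) d.
have b0 : 0 <= b by rewrite mulr_ge0 ?sqr_ge0// ltW// divr_gt0// nu_gt0.
pose p s := x + s *: d.
have Xp s : 0 <= s -> s <= 1 -> X (p s).
  by move=> s0 s1; rewrite /p -convB; apply: convex_setP => //; exact: dom_convex.
have hmono s : 0 <= s -> s <= 1 -> 2 * s * b <= dotp (grad_omega prx (p s)) d - a.
  move=> s0 s1; have [s_0|sn] := eqVneq s 0.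
    by rewrite s_0 mulr0 mul0r /p scale0r addr0 /a subrr.
  have sp : 0 < s by rewrite lt_neqAle eq_sym sn.
  have := omega_strongly_convex prx (Xp s s0 s1) Xx.
  rewrite /p addrAC subrr add0r (nrmZ (nrmP pb)) ger0_norm// dotpZl dotpC dotpBl -/a.
  rewrite -/nrm -/(p s) exprMn /b => h.
  by rewrite -(ler_pM2l sp); move: h; lra.
pose psi s := omega prx (p s) - s * a - s ^+ 2 * b.
have p0 : p 0 = x by rewrite /p scale0r addr0.
have p1 : p 1 = z by rewrite /p scale1r /d addrCA subrr addr0.
suff : psi 0 <= psi 1.
  rewrite /psi p0 p1 /V /bregman -/d -/a -/b; lra.
apply: dini_nondecreasing => s s0 s1 e e0.
- have q0 : 0 < 1 - s by lra.
  have e'0 : 0 < e * (1 - s) / 2 by rewrite divr_gt0// mulr_gt0.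
  have [r r0 h] := has_gradient_within_line (nrmP pb) (@dom_convex _ _ pb) (Xp s s0 (ltW s1)) Xz
     (grad_omegaP prx (Xp s s0 (ltW s1))) e'0.
  (* Half of [e * t] pays for the expansion of [omega], the other half for the term [t ^+ 2 * b].
     For left increments this term has the favourable sign. *)
  have r'0 : 0 < e / (2 * (b + 1)) by rewrite divr_gt0//; lra.
  exists (Num.min (r * (1 - s)) (e / (2 * (b + 1)))) => [|t t0]; first by rewrite lt_min mulr_gt0.
  rewrite lt_min => /andP[tr te] st.
  have := h (t / (1 - s)) (divr_gt0 t0 q0); rewrite ltr_pdivrMr// => /(_ tr).
  rewrite ler_pdivrMr// mul1r ; rewrite lerBrDl => /(_ st).
  have zd : z - p s = (1 - s) *: d by rewrite /p opprD addrA scalerBl scale1r.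
  rewrite zd dotpZr scalerA mulrA divfK ?gt_eqF//.
  have -> : p s + t *: d = p (s + t) by rewrite /p scalerDl addrA.
  have -> : e * (1 - s) / 2 * (t / (1 - s)) = e / 2 * t by field; rewrite gt_eqF.
  rewrite ler_norml => /andP[h1 _].
  have h2 := ler_wpM2l (ltW t0) (hmono s s0 (ltW s1)).
  have h3 : t * b <= e / 2.
    move: te; rewrite ltr_pdivlMr; last lra.
    by move=> te; nra.
  have h4 := ler_wpM2l (ltW t0) h3.
  rewrite /psi; nra.
- have e'0 : 0 < e * s by rewrite mulr_gt0.
  have [r r0 h] := has_gradient_within_line (nrmP pb) (@dom_convex _ _ pb) (Xp s (ltW s0) s1) Xx
     (grad_omegaP prx (Xp s (ltW s0) s1)) e'0.
  exists (r * s) => [|t t0 tr ts]; first by rewrite mulr_gt0.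
  have := h (t / s) (divr_gt0 t0 s0); rewrite ltr_pdivrMr// => /(_ tr).
  rewrite ler_pdivrMr// mul1r => /(_ ts).
  have zd : x - p s = - s *: d by rewrite /p opprD addrA subrr add0r scaleNr.
  rewrite zd dotpZr scalerA mulrN mulNr mulrN mulrA divfK ?gt_eqF// opprK.
  have -> : p s + - t *: d = p (s - t) by rewrite /p scalerDl addrA.
  have -> : e * s * (t / s) = e * t by field; rewrite gt_eqF.
  rewrite ler_norml => /andP[_ h1].
  have h2 := ler_wpM2l (ltW t0) (hmono s (ltW s0) s1).
  have h3 : 0 <= t ^+ 2 * b by rewrite mulr_ge0 ?sqr_ge0.
  rewrite /psi; nra.
Qed.

Lemma bregman_ge0 x z : X x -> X z -> 0 <= V x z.
Proof.
move=> Xx Xz; apply: le_trans (bregman_ge Xx Xz).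
by rewrite mulr_ge0 ?sqr_ge0// ltW// divr_gt0// nu_gt0.
Qed.

(** Compare [u] with [u + s *: (v - u)], divide by [s] and let [s] tend to 0. Convexity suffices for
    [phi]; only [omega] is expanded, and its expansion at [u] produces [V u v]. *)
Lemma prox_three_point (phi : 'rV[R]_n -> R) (a b : R) x y u v :
  convex_on X phi -> 0 <= a -> 0 <= b -> X x -> X y -> X v ->
  is_argmin X (fun w => phi w + a * V x w + b * V y w) u ->
  phi u + a * V x u + b * V y u + (a + b) * V u v <= phi v + a * V x v + b * V y v.
Proof.
move=> cphi a0 b0 Xx Xy Xv [Xu umin]; apply/ler_addgt0Pr => e e0.
set d := v - u.
have ab1 : 0 < a + b + 1 by lra.
have e'0 : 0 < e / (a + b + 1) by rewrite divr_gt0.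
have [s0 s00 hs] := has_gradient_within_line (nrmP pb) (@dom_convex _ _ pb) Xu Xv (grad_omegaP
  prx Xu) e'0.
pose s := Num.min (s0 / 2) 1.
have sp : 0 < s by rewrite lt_min ltr01 andbT divr_gt0.
have s1 : s <= 1 by rewrite ge_min lexx orbT.
have ss0 : s < s0 by rewrite gt_min; apply/orP; left; lra.
have := hs s sp ss0 s1; have := cphi u v s Xu Xv (ltW sp) s1.
rewrite convB -/d ler_norml => h1 /andP[_ h2].
have := umin (u + s *: d).
rewrite -convB => /(_ (convex_setP (@dom_convex _ _ pb) Xu Xv (ltW sp) s1)).
rewrite convB -/d.
set w := u + s *: d.
(* As functions of the second argument, [V x], [V y] and [V u] differ by affine functions, so one
   expansion of [omega] serves all three. *)
have wE z : V z w = V z u + (omega prx w - omega prx u) - s * dotp (grad_omega prx z) d.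
  by rewrite /V /bregman /w !dotpE; lra.
have vE z : V z v = V z u + (omega prx v - omega prx u) - dotp (grad_omega prx z) d.
  by rewrite /V /bregman /d !dotpE; lra.
have uE : V u v = omega prx v - omega prx u - dotp (grad_omega prx u) d.
  by rewrite /V /bregman; lra.
rewrite !wE (vE x) (vE y) uE => h3.
have h4 : (a + b) * (omega prx w - omega prx u) <= (a + b) * (s * dotp (grad_omega prx u) d + e /
  (a + b + 1) * s).
  by apply: ler_wpM2l; [lra|move: h2; rewrite -/w; lra].
have h5 : (a + b) * (e / (a + b + 1)) <= e.
  by rewrite mulrCA ler_piMr ?(ltW e0)// ler_pdivrMr//; lra.
have h6 := ler_wpM2l (ltW sp) h5.
rewrite -/w in h1.
rewrite -(ler_pM2l sp); nra.
Qed.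

End prox.

(** * The dual norm *)

Section dual_norm.
Variables (R : realType) (n : nat) (nrm : 'rV[R]_n -> R).
Hypothesis nrmP : is_norm nrm.
Implicit Types u v w x : 'rV[R]_n.

Lemma continuous_lipschitz (F : 'rV[R]_n -> R) (C : R) :
  (forall v w, F v - F w <= C * `|v - w|) -> continuous F.
Proof.
move=> hF v; apply/(@cvgrPdist_le _ R^o _ _ (nbhs_filter (v : 'rV[R]_n))) => e e0.
have C1 : 0 < `|C| + 1 by rewrite ltr_wpDl.
apply/nbhs_ballP; exists (e / (`|C| + 1)) => /= [|w]; first by rewrite divr_gt0.
rewrite -ball_normE /= => /ltW h.
rewrite ler_pdivlMr// mulrC in h.
have Cle : C * `|v - w| <= e.
  apply: le_trans h; rewrite ler_wpM2r//; have := ler_norm C; lra.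
have := hF v w; have := hF w v; rewrite (distrC w).
rewrite ler_norml; lra.
Qed.

Lemma nrm_continuous : continuous nrm.
Proof.
have [C C0 hC] := nrm_le_sup nrmP.
apply: (@continuous_lipschitz _ C) => v w; apply: le_trans (hC _).
by have := nrmD nrmP (v - w) w; rewrite subrK; lra.
Qed.

Lemma sup_le_nrm : exists2 c : R, 0 < c & forall v, c * `|v| <= nrm v.
Proof.
pose A := [set v : 'rV[R]_n | `|v| = 1].
have normalized v : v != 0 -> `|(`|v|^-1 *: v)| = 1.
  by move=> v0; rewrite normrZ normfV normr_id mulVf// normr_eq0.
have cA : compact A.
  apply: bounded_closed_compact.
    exists 1; split; first exact: num_real.
    by move=> M M1 v /= ->; exact: ltW.
  by apply: (@closed_comp _ _ (fun v : 'rV[R]_n => `|v|) [set 1]) => [v _|];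
    [exact: norm_continuous|exact: closed_eq].
(* The unit sphere is empty when [n = 0]. *)
have [[v0 Av0]|A0] := pselect (A !=set0); last first.
  exists 1 => // v; have [->|vn] := eqVneq v 0; first by rewrite normr0 mulr0 nrm_ge0.
  by case: A0; exists (`|v|^-1 *: v); rewrite /A; exact: normalized.
have [v /set_mem Av hv] := @EVT_min_rV _ _ nrm A (ex_intro _ v0 Av0) cA
  (continuous_subspaceT nrm_continuous).
have nv : 0 < nrm v.
  apply: nrm_gt0 => //; apply/eqP => v_0.
  by move: Av; rewrite /A /= v_0 normr0 => /esym/eqP; rewrite oner_eq0.
exists (nrm v) => // w; have [->|wn] := eqVneq w 0; first by rewrite normr0 mulr0 nrm_ge0.
have w0 : 0 < `|w| by rewrite normr_gt0.
have := hv (`|w|^-1 *: w); rewrite inE => /(_ (normalized _ wn)).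
 rewrite nrmZ// normfV normr_id => h.
by rewrite -ler_pdivlMr// mulrC.
Qed.

Lemma coord_le_norm v i : `|v 0 i| <= `|v|.
Proof.
rewrite [leRHS]/Num.norm /= mx_normrE.
exact: (le_bigmax _ (fun x : 'I_1 * 'I_n => `|v x.1 x.2|) (0, i)).
Qed.

Lemma dotp_le_sup v x : dotp v x <= (\sum_i `|v 0 i|) * `|x|.
Proof.
rewrite mulr_suml; apply: ler_sum => i _.
by rewrite (le_trans (ler_norm _))// normrM ler_wpM2l// coord_le_norm.
Qed.

Lemma dual_norm_has_sup v : has_sup [set dotp v x | x in [set x | nrm x <= 1]].
Proof.
split; first by exists (dotp v 0), 0 => //=; rewrite nrm0.
have [c c0 hc] := sup_le_nrm.
exists ((\sum_i `|v 0 i|) / c) => _ [x /= x1 <-].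
apply: le_trans (dotp_le_sup _ _) _; apply: ler_wpM2l; first exact: sumr_ge0.
by rewrite -div1r ler_pdivlMr// mulrC (le_trans (hc x)).
Qed.

Lemma dotp_le_dual v x : dotp v x <= dual_norm nrm v * nrm x.
Proof.
have [->|x0] := eqVneq x 0; first by rewrite dotp0r nrm0// mulr0.
have nx := nrm_gt0 nrmP x0.
rewrite -ler_pdivrMr//; apply: sup_upper_bound; first exact: dual_norm_has_sup.
exists ((nrm x)^-1 *: x) => /=; last by rewrite dotpZr mulrC.
by rewrite nrmZ// normfV gtr0_norm// mulVf// gt_eqF.
Qed.

Lemma dual_norm_ge0 v : 0 <= dual_norm nrm v.
Proof.
apply: sup_upper_bound; first exact: dual_norm_has_sup.
by exists 0; [rewrite /= nrm0|rewrite dotp0r].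
Qed.

Lemma dual_norm_continuous : continuous (dual_norm nrm).
Proof.
have [c c0 hc] := sup_le_nrm.
apply: (@continuous_lipschitz _ (n%:R / c)) => v w.
rewrite lerBlDl; apply: ge_sup; first by case: (dual_norm_has_sup v).
move=> _ [x /= x1 <-]; rewrite -{1}(subrK w v) dotpDl addrC lerD//.
  apply: le_trans (dotp_le_dual w x) _.
  by rewrite ler_piMr// dual_norm_ge0.
have xc : `|x| <= c^-1 by rewrite -div1r ler_pdivlMr// mulrC (le_trans (hc x)).
apply: le_trans (dotp_le_sup _ _) _.
apply: (@le_trans _ _ ((\sum_(i < n) `|v - w|) * `|x|)).
  by rewrite ler_wpM2r//; apply: ler_sum => i _; exact: coord_le_norm.
by rewrite sumr_const card_ord -(mulr_natl `|v - w|) -!mulrA ler_wpM2l// mulrC ler_wpM2r.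
Qed.

Lemma dual_norm_bound v x (rho : R) : nrm x <= rho -> `|dotp v x| <= dual_norm nrm v * rho.
Proof.
move=> xr; rewrite ler_norml; apply/andP; split.
  rewrite lerNl -dotpNr; apply: le_trans (dotp_le_dual _ _) _.
  by rewrite nrmN// ler_wpM2l// dual_norm_ge0.
by apply: le_trans (dotp_le_dual _ _) _; rewrite ler_wpM2l// dual_norm_ge0.
Qed.

(* Covers both f (smoothness) and h (Lipschitz subgradients). *)
Lemma within_continuous_gradient (X : set 'rV[R]_n) (F : 'rV[R]_n -> R)
    (C : R) (g : 'rV[R]_n -> 'rV[R]_n) : 0 <= C ->
  (forall x y, X x -> X y -> 
     F x + dotp (g x) (y - x) <= F y <= F x + dotp (g x) (y - x) + C * (nrm (y - x) + nrm (y - x)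
       ^+ 2)) ->
  {within X, continuous F}.
Proof.
move=> C0 hF; apply/subspace_continuousP => x Xx; apply/cvgrPdist_le => e e0.
have [K K0 hK] := nrm_le_sup nrmP.
pose s := \sum_i `|g x 0 i|; have s0 : 0 <= s by exact: sumr_ge0.
pose D := s + C * (K + K ^+ 2) + 1.
have D0 : 0 < D by rewrite ltr_wpDl// addr_ge0// mulr_ge0// addr_ge0 ?sqr_ge0// ltW.
rewrite near_withinE; apply/nbhs_ballP; exists (Num.min 1 (e / D)) => /= [|y].
  by rewrite lt_min ltr01 divr_gt0.
rewrite -ball_normE /= distrC => /ltW h Xy.
move: h; rewrite le_min => /andP[h1 h2]; rewrite ler_pdivlMr// in h2.
have h3 : `|dotp (g x) (y - x)| <= s * `|y - x|.
  rewrite ler_norml dotp_le_sup andbT lerNl -dotpNr.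
  by apply: le_trans (dotp_le_sup _ _) _; rewrite normrN.
have r0 : 0 <= `|y - x| by [].
have h4 : nrm (y - x) + nrm (y - x) ^+ 2 <= (K + K ^+ 2) * `|y - x|.
  rewrite mulrDl; apply: lerD; first exact: hK.
  apply: (@le_trans _ _ ((K * `|y - x|) ^+ 2)).
    by rewrite ler_sqr ?nnegrE ?nrm_ge0// ?hK// mulr_ge0// ltW.
  by rewrite exprMn ler_wpM2l ?sqr_ge0// expr2 ler_piMr.
have h5 := ler_wpM2l C0 h4.
have /andP[h6 h7] := hF x y Xx Xy.
have h8 : 0 <= nrm (y - x) + nrm (y - x) ^+ 2 by rewrite addr_ge0 ?sqr_ge0 ?nrm_ge0.
have h9 : `|y - x| * D = s * `|y - x| + C * ((K + K ^+ 2) * `|y - x|) + `|y - x|.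
  by rewrite /D; ring.
have h10 := mulr_ge0 C0 h8.
suff : `|F x - F y| <= e by [].
move: h3; rewrite !ler_norml => /andP[h31 h32]; lra.
Qed.

End dual_norm.

(** * Deterministic analysis of the sliding algorithm *)

Section sliding.
Variables (R : realType) (n : nat) (pb : problem R n) (prx : prox_function pb).
Variables (Xi : Type) (H : 'rV[R]_n -> Xi -> 'rV[R]_n).
Local Notation X := (dom pb).
Local Notation nrm := (nrm pb).
Local Notation V := (bregman prx).
Local Notation nd := (dual_norm nrm).

Definition oracle_error (w : 'rV[R]_n) (xi : Xi) : 'rV[R]_n := H w xi - sub_h pb w.

(** With [r] the length of the step from [u t] to [u t.+1], the Lipschitz bound and the noise cost
    [(M + nd e) * r]. Strong convexity gives back [k * r ^ 2 / 4] with [k = nu * beta * (t + 1)],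
    since the prox parameter of this step is [(t + 1) / 2]. By [young] the quotient here is what
    remains. *)
Definition step_error (beta : R) (v : 'rV[R]_n) (z : nat -> Xi) (u : nat -> 'rV[R]_n) (t : nat) :
  R :=
  dotp (oracle_error (u t) (z t)) (v - u t)
  + (Mh pb + nd (oracle_error (u t) (z t))) ^+ 2 / (nu prx * beta * t.+1%:R).

Lemma young (a k r : R) : 0 < k -> a * r <= k * r ^+ 2 / 4 + a ^+ 2 / k.
Proof.
move=> k0; rewrite -subr_ge0.
have -> : k * r ^+ 2 / 4 + a ^+ 2 / k - a * r = (k * r / 2 - a) ^+ 2 / k.
  by field; rewrite gt_eqF.
by rewrite divr_ge0 ?sqr_ge0// ltW.
Qed.

Section inner.
Variables (g : 'rV[R]_n -> R) (x : 'rV[R]_n) (beta : R) (T : nat).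
Variables (z : nat -> Xi) (u : nat -> 'rV[R]_n) (v : 'rV[R]_n).
Hypotheses (cg : convex_on X g) (Xx : X x) (beta0 : 0 < beta) (Xv : X v).
Hypothesis run : sps_run prx H g x beta T z u.

Let phi w := g w + hh pb w + chi pb w.

Lemma sps_run_dom t : (t <= T)%N -> X (u t).
Proof.
case: run => u0 hu; case: t => [|t] tT; first by rewrite u0.
by case: (hu t tT).
Qed.

(** Step [t] computes [u t.+1], so its parameter is [p = t.+1 / 2] and [t.+3 / 2] is [1 + p].
    Multiplied by [t.+2], the coefficients of [V (u t) v] and [V (u t.+1) v] become consecutive
    values of one sequence. *)
Lemma sps_step t : (t < T)%N ->
  phi (u t.+1) + beta * V x (u t.+1) + beta * (t.+3%:R / 2) * V (u t.+1) v
  <= phi v + beta * V x v + beta * (t.+1%:R / 2) * V (u t) v + step_error beta v z u t.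
Proof.
move=> tT; have Xt := sps_run_dom (ltnW tT); have Xt1 := sps_run_dom tT.
pose p := step_p R t.+1.
have p0 : 0 <= beta * p by rewrite mulr_ge0 ?divr_ge0// ltW.
pose w := H (u t) (z t).
have cphi : convex_on X (fun y => g y + (0 + dotp w y) + chi pb y).
  apply: convex_onD; last exact/convex_functionP/chi_convex.
  by apply: convex_onD => //; exact: convex_on_dotp.
have /(prox_three_point cphi (ltW beta0) p0 Xx Xt Xv) :
    is_argmin X (fun y => (g y + (0 + dotp w y) + chi pb y) + beta * V x y + beta * p * V (u t)
      y) (u t.+1).
  case: run => _ /(_ t tT)[_ umin]; split=> // y Xy; have := umin y Xy.
  by rewrite -/V -/w -/p; lra.
set r := nrm (u t.+1 - u t).
have hb := ler_wpM2l p0 (bregman_ge prx Xt Xt1).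
have hx := sub_hP Xt Xv.
have hl := h_lipschitz Xt1 Xt.
have hd := dotp_le_dual (nrmP pb) (- (oracle_error (u t) (z t))) (u t.+1 - u t).
have := dual_norm_bound (nrmP pb) (oracle_error (u t) (z t)) (lexx r).
rewrite ler_norml => /andP[hd1 _].
set e := oracle_error (u t) (z t) in hd1 hd *.
have wE : w = e + sub_h pb (u t) by rewrite /e /oracle_error subrK.
have k0 : 0 < nu prx * beta * t.+1%:R by rewrite !mulr_gt0 ?nu_gt0.
have hy := young (Mh pb + nd e) r k0.
rewrite /step_error -/e.
have t3 : t.+3%:R = t.+1%:R + 2 :> R by rewrite -!natr1; lra.
rewrite t3 /phi.
rewrite /p /step_p in hb *.
rewrite wE !dotpE in hx hl hd1 *.
rewrite -/r in hb hl *.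
move: hb hx hl hd1 hy; set K := _ / (nu prx * _ * _).
lra.
Qed.

(** The coefficient of [V x v] collects the weights [t.+2], whose sum is [S * (S + 3) / 2], and 1
    more from the start [u 0 = x]. *)
Lemma sps_sum S : (S <= T)%N ->
  \sum_(t < S) t.+2%:R * (phi (u t.+1) + beta * V x (u t.+1) - phi v)
  + beta * V (u S) v * (S.+1%:R * S.+2%:R / 2)
  <= beta * V x v * (S.+1%:R * S.+2%:R / 2)
     + \sum_(t < S) t.+2%:R * step_error beta v z u t.
Proof.
elim: S => [_|S IH ST].
  by rewrite !big_ord0; case: run => -> _; lra.
have := IH (ltnW ST); rewrite !big_ord_recr /=.
have := ler_wpM2l (ler0n R S.+2) (sps_step ST).
set E := step_error _ _ _ _ _; set s1 := \sum_(_ < S) _; set s2 := \sum_(_ < S) _.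
have -> : S.+3%:R = S%:R + 3 :> R by rewrite -!natr1; lra.
have -> : S.+2%:R = S%:R + 2 :> R by rewrite -!natr1; lra.
have -> : S.+1%:R = S%:R + 1 :> R by rewrite -natr1; lra.
lra.
Qed.

(** The [theta_t] are the ratios of the newest weight to the partial sums [S * (S + 3) / 2], so
    [sps_avg] is the mean of the search points with the telescoping weights. As [theta_1 = 1], the
    starting point drops out. *)
Lemma sps_avg_convex (Q : 'rV[R]_n -> R) S : convex_on X Q -> (S <= T)%N ->
  X (sps_avg x u S) /\
  S%:R * (S + 3)%:R / 2 * Q (sps_avg x u S) <= \sum_(t < S) t.+2%:R * Q (u t.+1).
Proof.
move=> cQ; elim: S => [_|S IH ST]; first by rewrite big_ord0 !mul0r.
have [Xa ha] := IH (ltnW ST); rewrite big_ord_recr /=.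
set th := step_theta R S.+1.
have e3 : (S.+1 + 3)%:R = S%:R + 4 :> R by rewrite natrD -natr1; lra.
have e2 : S.+2%:R = S%:R + 2 :> R by rewrite -!natr1; lra.
have e1 : S.+1%:R = S%:R + 1 :> R by rewrite -natr1; lra.
have S0 : 0 <= S%:R :> R by [].
have den : 0 < (S%:R + 1) * (S%:R + 4) :> R by rewrite mulr_gt0//; lra.
have thE : th * ((S%:R + 1) * (S%:R + 4)) = 2 * (S%:R + 2).
  by rewrite /th /step_theta e1 e2 e3 divfK// gt_eqF.
have th0 : 0 <= th by rewrite /th /step_theta divr_ge0// mulr_ge0.
have th1 : th <= 1 by rewrite -(ler_pM2r den) thE mul1r; nra.
have Xu := sps_run_dom ST.
split; first by apply: convex_setP => //; exact: dom_convex.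
have h := ler_wpM2l (ltW den) (cQ _ _ th Xa Xu th0 th1).
move: ha h; rewrite e1 e2 e3 natrD.
set q := Q (sps_avg _ _ _); set q' := Q (u _); set q'' := Q _; set s := \sum_(_ < _) _.
have -> : (S%:R + 1) * (S%:R + 4) * ((1 - th) * q + th * q') =
  (S%:R + 1) * (S%:R + 4) * q + th * ((S%:R + 1) * (S%:R + 4)) * (q' - q) by ring.
rewrite thE; lra.
Qed.

(** The quadratic term is kept because it later pays for the curvature of [f]. Replacing [V x] by
    its quadratic lower bound, a convex function, carries it over to the averaged point. *)
Lemma sps_bound : (0 < T)%N ->
  T%:R * (T + 3)%:R / 2 *
    (phi (sps_avg x u T) + beta * nu prx / 2 * nrm (sps_avg x u T - x) ^+ 2 - phi v)
  <= beta * (T.+1%:R * T.+2%:R / 2) * (V x v - V (u T) v)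
     + \sum_(t < T) t.+2%:R * step_error beta v z u t.
Proof.
move=> T0.
pose q y := beta * nu prx / 2 * nrm (y - x) ^+ 2.
have cst : 0 <= beta * nu prx / 2 by rewrite divr_ge0// mulr_ge0 ?ltW// nu_gt0.
have cq : convex_on X q.
  move=> a b s Xa Xb s0 s1; rewrite /q.
  have -> : (1 - s) *: a + s *: b - x = (1 - s) *: (a - x) + s *: (b - x).
    rewrite !scalerBr addrACA -opprD -scalerDl subrK scale1r//.
  have := ler_wpM2l cst (nrm_sqr_conv (nrmP pb) (a - x) (b - x) s0 s1); lra.
have cphi : convex_on X phi.
  apply: convex_onD; last exact/convex_functionP/chi_convex.
  by apply: convex_onD => //; exact/convex_functionP/h_convex.
have [_ h1] := sps_avg_convex (convex_onD cphi cq) (leqnn T).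
have h2 := sps_sum (leqnn T).
have h3 : \sum_(t < T) t.+2%:R * (phi (u t.+1) + q (u t.+1)) - T%:R * (T + 3)%:R / 2 * phi v
   <= \sum_(t < T) t.+2%:R * (phi (u t.+1) + beta * V x (u t.+1) - phi v).
  have -> : T%:R * (T + 3)%:R / 2 = \sum_(t < T) t.+2%:R :> R.
    elim: (T) => [|S IH]; first by rewrite big_ord0 !mul0r.
    by rewrite big_ord_recr /= -IH !natrD -!natr1; field.
  rewrite mulr_suml -sumrB; apply: ler_sum => i _.
  rewrite -mulrBr ler_wpM2l// lerB// lerD2l /q.
  have := ler_wpM2l (ltW beta0) (bregman_ge prx Xx (sps_run_dom (ltn_ord i))); lra.
move: h1 h2 h3; rewrite /q; lra.
Qed.

End inner.
End sliding.

Section optimum.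
Variables (R : realType) (n : nat) (pb : problem R n).

Lemma Psi_opt_argmin xs : is_argmin (dom pb) (Psi pb) xs -> Psi_opt pb = Psi pb xs.
Proof.
move=> [Xxs hmin]; apply/eqP; rewrite eq_le; apply/andP; split.
  apply: ge_inf; last by exists xs.
  by exists (Psi pb xs) => _ [x Xx <-]; exact: hmin.
apply: lb_le_inf; first by exists (Psi pb xs), xs.
by move=> _ [x Xx <-]; exact: hmin.
Qed.

End optimum.

Section sliding.
Variables (R : realType) (n : nat) (pb : problem R n) (prx : prox_function pb).
Variables (Xi : Type) (H : 'rV[R]_n -> Xi -> 'rV[R]_n).
Variables (S : schedule R) (N : nat) (x0 xs : 'rV[R]_n).
Variables (z : nat -> nat -> Xi) (u : nat -> nat -> 'rV[R]_n).
Local Notation X := (dom pb).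
Local Notation nrm := (nrm pb).
Local Notation V := (bregman prx).
Local Notation center := (sgs_center S x0 u).
Local Notation bar := (sgs_bar S x0 u).
Local Notation gap := (fun k => Psi pb (bar k) - Psi pb xs).
Hypotheses (Xx0 : X x0) (Xxs : X xs).
Hypothesis gamma01 : forall k, (0 < k <= N)%N -> 0 <= gamma_ S k <= 1.
Hypothesis beta_gt0 : forall k, (0 < k <= N)%N -> 0 < beta_ S k.
Hypothesis T_gt0 : forall k, (0 < k <= N)%N -> (0 < T_ S k)%N.
Hypothesis Lgamma : forall k, (0 < k <= N)%N -> Lf pb * gamma_ S k <= nu prx * beta_ S k.
Hypothesis run : sgs_run prx H S N x0 z u.

Lemma lin_f_convex y : convex_on X (lin_f pb y).
Proof.
move=> a b s Xa Xb s0 s1; rewrite /lin_f !dotpE; lra.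
Qed.

Lemma sgs_dom k : (k <= N)%N -> X (center k) /\ X (bar k).
Proof.
elim: k => [//|k IH kN]; have [Xc Xb] := IH (ltnW kN).
have kk : (0 < k.+1 <= N)%N by [].
have hrun := run kN.
split; first exact: (sps_run_dom Xc hrun).
(* Only feasibility of the average is wanted; the convex function is a placeholder. *)
have [Xa _] := sps_avg_convex Xc hrun (@lin_f_convex x0) (leqnn _).
have /andP[g0 g1] := gamma01 kk.
by apply: convex_setP => //; exact: dom_convex.
Qed.

Lemma sgs_call_dom k t : is_call S N k t -> X (u k t).
Proof.
case: k => [//|k] /and3P[_ kN tT].
by apply: (sps_run_dom (sgs_dom (ltnW kN)).1 (run kN)); exact: ltnW.
Qed.

Definition inner_weight k : R := (T_ S k)%:R * (T_ S k + 3)%:R / 2.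

Lemma inner_weight_gt0 k : (0 < k <= N)%N -> 0 < inner_weight k.
Proof. by move=> kN; rewrite divr_gt0// mulr_gt0// ltr0n ?T_gt0// addn_gt0 orbT. Qed.

Definition outer_error k : R :=
  beta_ S k * ((T_ S k).+1%:R * (T_ S k).+2%:R / 2) * (V (center k.-1) xs - V (center k) xs)
     + \sum_(t < T_ S k) t.+2%:R * step_error prx H (beta_ S k) xs (z k) (u k) t.

(** [bar k.+1] and [md] differ by [gamma] times [at_ - center k], so smoothness of [f] costs
    [L * gamma ^ 2 / 2] times a squared norm. The inner loop bounds that norm with coefficient
    [gamma * nu * beta / 2], and [Lgamma] makes this enough. *)
Lemma sgs_step k : (k < N)%N ->
  gap k.+1 <= (1 - gamma_ S k.+1) * gap k
    + gamma_ S k.+1 / inner_weight k.+1 * outer_error k.+1.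
Proof.
move=> kN; have kk : (0 < k.+1 <= N)%N by [].
have [Xc Xb] := sgs_dom (ltnW kN).
have hrun := run kN.
have /andP[g0 g1] := gamma01 kk.
set md := sgs_md S x0 u k in hrun *.
have Xmd : X md by apply: convex_setP => //; exact: dom_convex.
have [Xa _] := sps_avg_convex Xc hrun (@lin_f_convex md) (leqnn _).
have h := sps_bound (@lin_f_convex md) Xc (beta_gt0 kk) Xxs hrun (T_gt0 kk).
have A0 := inner_weight_gt0 kk.
rewrite -/(inner_weight k.+1) in h.
set at_ := sps_avg _ _ _ in Xa h.
have Xb1 : X (bar k.+1) by case: (sgs_dom kN).
have fs := f_smooth Xb1 Xmd.
have barE : bar k.+1 = (1 - gamma_ S k.+1) *: bar k + gamma_ S k.+1 *: at_ by [].
have dE : bar k.+1 - md = gamma_ S k.+1 *: (at_ - center k).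
  by rewrite barE /md /sgs_md opprD addrACA subrr add0r scalerBr.
rewrite dE (nrmZ (nrmP pb)) ger0_norm// exprMn in fs.
have fb := convex_gradient_le (nrmP pb) (@dom_convex _ _ pb) (convex_functionP (@f_convex _ _
  pb)) Xmd Xb (grad_fP Xmd).
have fx := convex_gradient_le (nrmP pb) (@dom_convex _ _ pb) (convex_functionP (@f_convex _ _
  pb)) Xmd Xxs (grad_fP Xmd).
have hc := convex_functionP (@h_convex _ _ pb) Xb Xa g0 g1.
have cc := convex_functionP (@chi_convex _ _ pb) Xb Xa g0 g1.
rewrite -barE in hc cc.
have dlin : dotp (grad_f pb md) (gamma_ S k.+1 *: (at_ - center k)) =
  (1 - gamma_ S k.+1) * dotp (grad_f pb md) (bar k - md)
   + gamma_ S k.+1 * dotp (grad_f pb md) (at_ - md).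
  by rewrite -dE barE !dotpE; lra.
rewrite dlin in fs.
have Ln := ler_wpM2r (sqr_ge0 (nrm (at_ - center k))) (Lgamma kk).
have gLn := ler_wpM2l g0 Ln.
have ob := ler_wpM2l g0 fx.
have ofb : (1 - gamma_ S k.+1) * (ff pb md + dotp (grad_f pb md) (bar k - md)) <= (1 - gamma_ S
  k.+1) * ff pb (bar k).
  by apply: ler_wpM2l => //; rewrite subr_ge0.
have hh' : gamma_ S k.+1 * (lin_f pb md at_ + hh pb at_ + chi pb at_ +
       beta_ S k.+1 * nu prx / 2 * nrm (at_ - center k) ^+ 2 -
       (lin_f pb md xs + hh pb xs + chi pb xs)) <=
    gamma_ S k.+1 / inner_weight k.+1 * outer_error k.+1.
  rewrite -[leRHS]mulrA; apply: ler_wpM2l => //.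
  by rewrite [leRHS]mulrC ler_pdivlMr// mulrC; exact: h.
move: hh'; set E := gamma_ S k.+1 / _ * _.
rewrite /Psi /lin_f.
move: fs hc cc gLn ob ofb; lra.
Qed.

(** [G 0 = 0] encodes [gamma_1 = 1]: the gap at the starting point disappears. *)
Lemma sgs_sum (G : nat -> R) : G 0%N = 0 ->
  (forall k, (k < N)%N -> 0 <= G k.+1 /\ G k.+1 * (1 - gamma_ S k.+1) = G k) ->
  forall m, (m <= N)%N -> G m * gap m <=
    \sum_(k < m) G k.+1 * gamma_ S k.+1 / inner_weight k.+1 * outer_error k.+1.
Proof.
move=> G0 hG; elim=> [_|m IH mN]; first by rewrite big_ord0 G0 mul0r.
rewrite big_ord_recr /=; have [Gp GE] := hG m mN.
have := ler_wpM2l Gp (sgs_step mN); have := IH (ltnW mN).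
rewrite -GE; set s := \sum_(_ < _) _; lra.
Qed.

End sliding.

(** * Measurability and independence *)

Section borel_vectors.
Variables (R : realType) (n : nat).
Local Notation bV := (borel_rV R n).

Lemma borel_rV_open (U : set 'rV[R]_n) : open U -> measurable (U : set bV).
Proof. by move=> oU; apply: sub_sigma_algebra. Qed.

Lemma borel_rV_closed (A : set 'rV[R]_n) : closed A -> measurable (A : set bV).
Proof.
move=> /closed_openC /borel_rV_open /measurableC; rewrite setCK; exact.
Qed.

Lemma within_continuous_borel (X : set 'rV[R]_n) (F : 'rV[R]_n -> R) :
  closed X -> {within X, continuous F} -> measurable_fun (X : set bV) F.
Proof.
move=> cX /continuousP cf; apply: (measurability _ (RGenOpens.measurableE R)).
move=> _ [_ [a [b ->] <-]].
have /open_subspaceP[W oW WX] : open (from_subspace X F @^-1` `]a, b[%classic).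
  by apply: cf; exact: interval_open.
rewrite setIC -WX; apply: measurableI; first exact: borel_rV_open.
exact: borel_rV_closed.
Qed.

Lemma continuous_borel (F : 'rV[R]_n -> R) :
  continuous F -> measurable_fun setT (F : bV -> R).
Proof.
move=> cF; apply: within_continuous_borel; first exact: closedT.
exact: continuous_subspaceT.
Qed.

Lemma coord_borel i : measurable_fun setT (fun v : bV => v ord0 i).
Proof. by apply: continuous_borel; exact: coord_continuous. Qed.

(** Cubes with rational centre and radius [1 / (m + 1)] form a countable base of the topology. Hence
    measurability into the Borel sets can be checked coordinate by coordinate. *)
Let box (c : {ffun 'I_n -> rat} * nat) : set 'rV[R]_n :=
  [set v | forall i, `|v ord0 i - ratr (c.1 i)| < c.2.+1%:R^-1].

Let box_cover (U : set 'rV[R]_n) : open U ->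
  U = \bigcup_c (if pselect (box c `<=` U) then box c else set0).
Proof.
move=> oU; apply/seteqP; split=> v; last first.
  by move=> [c _]; case: pselect => // cU; exact: cU.
move=> Uv; have /nbhs_ballP[e /= e0 eU] := oU v Uv.
have e20 : 0 < e / 2 by rewrite divr_gt0.
have [k _ /(_ k (leqnn k)) /= hk] := near_infty_natSinv_lt (PosNum e20).
have k0 : 0 < k.+1%:R^-1 :> R by rewrite invr_gt0.
pose r : R := k.+1%:R^-1; rewrite -/r in k0; have {}hk : r < e / 2 by exact: hk.
have hq i : exists q : rat, `|v ord0 i - ratr q| < r.
  have /rat_in_itvoo[q] : v ord0 i - r < v ord0 i + r by lra.
  rewrite in_itv /= => /andP[h1 h2]; exists q; rewrite ltr_norml; lra.
have [q hq'] := choice hq.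
exists ([ffun i => q i], k) => //.
have bv : box ([ffun i => q i], k) v by move=> i /=; rewrite ffunE.
case: pselect => // -[] w bw; apply: eU; split=> // i j.
rewrite (ord1 i); have := bw j; have := bv j; rewrite /= /ball /= !ffunE -/r.
rewrite !ltr_norml; lra.
Qed.

Lemma measurable_fun_rV d (T : measurableType d) (Y : T -> bV) :
  (forall i, measurable_fun setT (fun w => Y w ord0 i)) -> measurable_fun setT Y.
Proof.
move=> mY; apply: (@measurability _ _ T bV setT Y (@open 'rV[R]_n) erefl).
move=> _ [U oU <-]; rewrite setTI (box_cover oU) preimage_bigcup.
apply: countable_bigcupT_measurable; first exact: countableP.
move=> c; case: (pselect (box c `<=` U)) => [?|?] /=; last by rewrite preimage_set0.
have -> : Y @^-1` box c = \bigcap_i (fun w => Y w ord0 i) @^-1` [set r | `|r - ratr (c.1 i)| <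
  c.2.+1%:R^-1].
  by apply/seteqP; split=> [w h i _|w h i]; [exact: (h i)|exact: (h i I)].
apply: fin_bigcap_measurable; first exact: finite_finset.
move=> i _; rewrite -[X in measurable X]setTI; apply: mY => //.
have -> : [set r : R | `|r - ratr (c.1 i)| < c.2.+1%:R^-1] = ball (ratr (c.1 i) : R) (c.2.+1%:R^-1).
  by apply/seteqP; split=> r; rewrite /ball /= distrC.
exact: measurable_ball.
Qed.

Lemma measurable_fun_rVP d (T : measurableType d) (Y : T -> bV) i :
  measurable_fun setT Y -> measurable_fun setT (fun w => Y w ord0 i).
Proof. by move=> mY; apply: (measurableT_comp (coord_borel i) mY). Qed.

Lemma measurable_fun_dotp d (T : measurableType d) (Y Z : T -> bV) :
  measurable_fun setT Y -> measurable_fun setT Z ->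
  measurable_fun setT (fun w => dotp (Y w) (Z w)).
Proof.
move=> mY mZ; apply: measurable_sum => i.
by apply: measurable_funM; exact: measurable_fun_rVP.
Qed.

Lemma measurable_fun_lincomb d (T : measurableType d) (a b : R) (Y Z : T -> bV) :
  measurable_fun setT Y -> measurable_fun setT Z ->
  measurable_fun setT (fun w => a *: Y w + b *: Z w : bV).
Proof.
move=> mY mZ; apply: measurable_fun_rV => i.
under eq_fun do rewrite !mxE.
by apply: measurable_funD; apply: measurable_funM => //; exact: measurable_fun_rVP.
Qed.

End borel_vectors.

Section independent_integral.
Local Open Scope ereal_scope.
Context d d1 d2 (Omega : measurableType d) (T1 : measurableType d1)
  (T2 : measurableType d2) (R : realType) (P : probability Omega R).
Variables (Y : {RV P >-> T1}) (Z : {RV P >-> T2}).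
Hypothesis indep : forall A B, measurable A -> measurable B ->
  P (Y @^-1` A `&` Z @^-1` B) = P (Y @^-1` A) * P (Z @^-1` B).

Let YZ w := (Y w, Z w).

Let mYZ : measurable_fun setT YZ.
Proof. exact: measurable_fun_pair. Qed.
HB.instance Definition _ := isMeasurableFun.Build _ _ _ _ YZ mYZ.

(** Independence makes the joint law agree with the product law on rectangles, hence everywhere.
    Tonelli then splits the integral, and both factors are pulled back to [P]. *)
Lemma integral_indep (F : T1 * T2 -> \bar R) : measurable_fun setT F -> (forall x, 0 <= F x) ->
  \int[P]_w F (Y w, Z w) = \int[P]_w \int[P]_w' F (Y w, Z w').
Proof.
move=> mF F0.
transitivity (\int[distribution P YZ]_x F x).
  by rewrite ge0_integral_distribution.
transitivity (\int[distribution P Y \x distribution P Z]_x F x).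
  apply: eq_measure_integral => A mA _; apply/esym.
  by apply: product_measure_unique => // B C mB mC; exact: (indep mB mC).
rewrite fubini_tonelli1// /fubini_F.
rewrite ge0_integral_distribution//=.
- apply: eq_integral => w _ /=.
  rewrite ge0_integral_distribution//. exact: measurableT_comp.
- exact: measurable_fun_fubini_tonelli_F.
- move=> y; exact: integral_ge0.
Qed.
End independent_integral.

Section mean.
Context d (T : measurableType d) (R : realType) (P : probability T R).
Implicit Types (f g : T -> R).

(* Integrability is part of the definition, so that means add up in R. *)
Definition has_mean f (m : R) :=
  P.-integrable setT (EFin \o f) /\ (\int[P]_w (f w)%:E = m%:E)%E.

Lemma has_mean_measurable f m : has_mean f m -> measurable_fun setT f.
Proof. by move=> [/integrableP[/measurable_EFinP]]. Qed.

Lemma has_mean_cst c : has_mean (cst c) c.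
Proof.
split; first exact: finite_measure_integrable_cst.
transitivity (c%:E * P setT)%E; last by rewrite probability_setT mule1.
exact: (integral_cst P measurableT c%:E).
Qed.

Lemma has_meanD f g a b : has_mean f a -> has_mean g b -> has_mean (fun w => f w + g w) (a + b).
Proof.
move=> [fi fa] [gi gb]; split.
  by apply: (@eq_integrable _ _ _ _ setT _ (fun w => (f w)%:E + (g w)%:E)%E) => //; exact:
    integrableD.
under eq_integral do rewrite EFinD.
by rewrite (integralD measurableT fi gi) fa gb.
Qed.

Lemma has_meanZ f a c : has_mean f a -> has_mean (fun w => c * f w) (c * a).
Proof.
move=> [fi fa]; split.
  by apply: (@eq_integrable _ _ _ _ setT _ (fun w => c%:E * (f w)%:E)%E) => //; exact: integrableZl.
under eq_integral do rewrite EFinM.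
by rewrite (integralZl measurableT fi) fa.
Qed.

Lemma has_mean_sum I (s : seq I) (F : I -> T -> R) (m : I -> R) :
  (forall i, has_mean (F i) (m i)) ->
  has_mean (fun w => \sum_(i <- s) F i w) (\sum_(i <- s) m i).
Proof.
move=> h; elim: s => [|i s IH].
  rewrite big_nil; under eq_fun do rewrite big_nil.
  exact: has_mean_cst.
rewrite big_cons; under eq_fun do rewrite big_cons.
exact: has_meanD.
Qed.

Lemma has_mean_le f g a b : has_mean f a -> has_mean g b ->
  (forall w, f w <= g w) -> a <= b.
Proof.
move=> [fi fa] [gi gb] fg; rewrite -lee_fin -fa -gb.
by apply: le_integral => // w _ /=; rewrite lee_fin.
Qed.

Lemma integrable_has_mean f : P.-integrable setT (EFin \o f) -> exists m, has_mean f m.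
Proof.
move=> fi; exists (fine (\int[P]_w (f w)%:E)); split=> //.
by rewrite fineK//; exact: integrable_fin_num.
Qed.

Lemma has_mean_dominated f g b : measurable_fun setT f ->
  (forall w, `|f w| <= g w) -> has_mean g b -> exists m, has_mean f m.
Proof.
move=> mf fg [gi _]; apply: integrable_has_mean.
apply: (le_integrable _ _ _ gi) => //; first exact/measurable_EFinP.
move=> w _ /=; rewrite lee_fin; apply: le_trans (fg w) _; exact: ler_norm.
Qed.

Lemma has_mean_dominated_le f g b : measurable_fun setT f -> (forall w, 0 <= f w) ->
  (forall w, f w <= g w) -> has_mean g b -> exists2 m, m <= b & has_mean f m.
Proof.
move=> mf f0 fg hg.
have [|m hm] := has_mean_dominated mf _ hg; first by move=> w; rewrite ger0_norm.
by exists m => //; exact: (has_mean_le hm hg).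
Qed.

Lemma has_mean_of_integral_le f c : measurable_fun setT f -> (forall w, 0 <= f w) ->
  (\int[P]_w (f w)%:E <= c%:E)%E -> exists2 m, m <= c & has_mean f m.
Proof.
move=> mf f0 fc.
have [|m hm] := @integrable_has_mean f.
  apply/integrableP; split; first exact/measurable_EFinP.
  apply: le_lt_trans (ltry c); under eq_integral do rewrite /= ger0_norm//.
  exact: fc.
by exists m => //; rewrite -lee_fin -hm.2.
Qed.

(** The integral is the difference of those of the positive and negative parts; a finite difference
    forces both to be finite. *)
Lemma has_mean_of_integral f m : measurable_fun setT f ->
  (\int[P]_w (f w)%:E = m%:E)%E -> has_mean f m.
Proof.
move=> mf fm; split=> //; apply/integrableP; split; first exact/measurable_EFinP.
have mE : measurable_fun setT (EFin \o f) by exact/measurable_EFinP.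
rewrite -[X in (\int[P]_(x in _) X x)%E]/(abse \o (EFin \o f)) fune_abse.
rewrite ge0_integralD//; [|exact: measurable_funepos|exact: measurable_funeneg].
have : (\int[P]_w ((EFin \o f)^\+ w) - \int[P]_w ((EFin \o f)^\- w))%E \is a fin_num.
  by rewrite -integralE fm.
rewrite fin_numB => /andP[h1 h2].
by rewrite lte_add_pinfty// -ge0_fin_numE// integral_ge0.
Qed.

Lemma markov_has_mean f m (a : R) (A : set T) : has_mean f m -> (forall w, 0 <= f w) ->
  measurable A -> (forall w, A w -> a <= f w) -> (a%:E * P A <= m%:E)%E.
Proof.
move=> fm f0 mA hA; have Pfin : P A \is a fin_num by exact: fin_num_measure.
have hI : has_mean (fun w => a * \1_A w) (a * fine (P A)).
  apply: has_meanZ; apply: has_mean_of_integral; first exact: measurable_indic.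
  by rewrite integral_indic// setIT fineK.
rewrite -(fineK Pfin) -EFinM lee_fin; apply: (has_mean_le hI fm) => w.
rewrite indicE; case: (boolP (w \in A)) => [/set_mem/hA|_]; first by rewrite mulr1.
by rewrite mulr0.
Qed.

End mean.

Section fresh_mean.
Context d d1 d2 (Omega : measurableType d) (T1 : measurableType d1)
  (T2 : measurableType d2) (R : realType) (P : probability Omega R).

(** This stands in for the tower property: conditioning on [Y] amounts to freezing its value, and
    [G] bounds the resulting conditional mean. *)
Lemma fresh_mean (Y : {RV P >-> T1}) (Z : {RV P >-> T2}) (F : T1 * T2 -> R) (G : T1 -> R) (b : R) :
  (forall A B, measurable A -> measurable B ->
    P (Y @^-1` A `&` Z @^-1` B) = (P (Y @^-1` A) * P (Z @^-1` B))%E) ->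
  measurable_fun setT F -> (forall x, 0 <= F x) ->
  (forall w, exists2 m, m <= G (Y w) & has_mean P (fun w' => F (Y w, Z w')) m) ->
  has_mean P (fun w => G (Y w)) b ->
  exists2 m, m <= b & has_mean P (fun w => F (Y w, Z w)) m.
Proof.
move=> indep mF F0 hF hG.
have mFE : measurable_fun setT (EFin \o F) by exact/measurable_EFinP.
apply: has_mean_of_integral_le => //.
  by apply: measurableT_comp => //; exact: measurable_fun_pair.
have FE0 x : (0 <= (EFin \o F) x)%E by rewrite lee_fin.
rewrite (@integral_indep _ _ _ _ _ _ _ P Y Z indep (EFin \o F) mFE FE0).
rewrite -hG.2; apply: ge0_le_integral => //.
- by move=> w _; apply: integral_ge0 => w' _; rewrite lee_fin.
- have mh : measurable_fun setT (fun q : Omega * Omega => (F (Y q.1, Z q.2))%:E).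
    apply/measurable_EFinP; apply: measurableT_comp => //.
    by apply: measurable_fun_pair; apply: measurableT_comp.
  apply: (measurable_fun_fubini_tonelli_F (m2 := P) _ mh) => x.
  by rewrite lee_fin.
- exact/measurable_EFinP/(has_mean_measurable hG).
- by move=> w _; have [m mG hm] := hF w; rewrite /= hm.2 lee_fin.
Qed.

End fresh_mean.

(** * Exponential inequalities and a sub-Gaussian bound *)

Section exponential_moments.
Variable R : realType.
Implicit Types x y q : R.

(** Raising [1 - 1/6 <= exp (- 1/6)] to the sixth power gives [(6/5) ^ 6], which is just below 3. *)
Lemma expR1_le3 : expR 1 <= 3 :> R.
Proof.
have h : (5 / 6 : R) <= expR (- 6^-1) by apply: le_trans (expR_ge1Dx _); lra.
have h6 : (5 / 6 : R) ^+ 6 <= expR (- 6^-1) ^+ 6.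
  by rewrite ler_pXn2r ?nnegrE// ?expR_ge0//; lra.
have e6 : expR (- 6^-1) ^+ 6 = (expR 1)^-1 :> R.
  by rewrite -expRM_natl -expRN; congr expR; field.
rewrite e6 in h6; have e0 : 0 < expR 1 :> R by exact: expR_gt0.
have := ler_wpM2l (ltW e0) h6; rewrite mulfV ?gt_eqF//; lra.
Qed.

(** The linear term is kept apart because it will have mean zero. For [y >= 1/2] the square
    dominates [y]; below, [exp y <= 1 / (1 - y) <= 1 + y + 2 * y ^ 2]. *)
Lemma expR_le_add_sqr y : expR y <= y + expR (2 * y ^+ 2).
Proof.
have e2 := expR_ge1Dx (2 * y ^+ 2).
have [yh|yh] := leP (1 / 2) y.
  rewrite -[leLHS]add0r lerD//; first lra.
  by rewrite ler_expR; nra.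
have y1 : 0 < 1 - y by lra.
have h : expR y * (1 - y) <= 1.
  have := expR_ge1Dx (- y); rewrite -(ler_pM2l (expR_gt0 y)) -expRD subrr expR0; lra.
have : expR y <= 1 + y + 2 * y ^+ 2; last lra.
rewrite -(ler_pM2r y1); apply: le_trans h _.
have : 0 <= y ^+ 2 * (1 - 2 * y) by rewrite mulr_ge0 ?sqr_ge0//; lra.
nra.
Qed.

Lemma expR_convex q y : 0 <= q -> q <= 1 -> expR (q * y) <= 1 - q + q * expR y.
Proof.
move=> q0 q1.
have h1 := expR_ge1Dx (y - q * y); have h2 := expR_ge1Dx (- (q * y)).
have e0 := expR_ge0 (q * y).
have -> : expR y = expR (q * y) * expR (y - q * y) by rewrite -expRD addrC subrK.
have e1 : 1 = expR (q * y) * expR (- (q * y)) :> R by rewrite -expRD subrr expR0.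
have k1 := ler_wpM2l e0 h1; have k2 := ler_wpM2l e0 h2.
have q10 : 0 <= 1 - q by lra.
have := ler_wpM2l q0 k1; have := ler_wpM2l q10 k2; rewrite -e1; nra.
Qed.

(** Weights of total at most 1 are completed by placing the missing mass at 0, where [exp] is 1. The
    proof uses the tangent of [exp] at the weighted mean. *)
Lemma expR_jensen (I : Type) (s : seq I) (p y : I -> R) : (forall i, 0 <= p i) ->
  \sum_(i <- s) p i <= 1 ->
  expR (\sum_(i <- s) p i * y i) <= 1 - \sum_(i <- s) p i + \sum_(i <- s) p i * expR (y i).
Proof.
move=> p0 p1; set m := \sum_(i <- s) p i * y i; set q := \sum_(i <- s) p i.
have e0 := expR_ge0 m.
have h1 : expR m * (1 - m) <= 1.
  have := ler_wpM2l e0 (expR_ge1Dx (- m)); rewrite -expRD subrr expR0; exact.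
have h2 : \sum_(i <- s) p i * (expR m * (1 + y i - m)) <= \sum_(i <- s) p i * expR (y i).
  apply: ler_sum => i _; rewrite ler_wpM2l//.
  have -> : expR (y i) = expR m * expR (y i - m) by rewrite -expRD addrC subrK.
  by rewrite ler_wpM2l// -addrA; exact: expR_ge1Dx.
have h3 : \sum_(i <- s) p i * (expR m * (1 + y i - m)) = expR m * (q * (1 - m) + m).
  have -> : q * (1 - m) + m = \sum_(i <- s) (p i * (1 - m) + p i * y i).
    by rewrite big_split /= -mulr_suml.
  by rewrite mulr_sumr; apply: eq_bigr => i _; ring.
rewrite h3 in h2; have q1 : 0 <= 1 - q by rewrite subr_ge0.
have := ler_wpM2l q1 h1; lra.
Qed.

Context d (T : measurableType d) (P : probability T R).

(** With [q = 2 * (s * rho * sigma) ^ 2] and [y = W ^ 2 / sigma ^ 2] there are two regimes. If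
    [q <= 1], the linear term vanishes in the mean and [exp (q * y)] lies below its chord, which
    gives [1 + q * (e - 1) <= 1 + 2 * q]. If [q > 1], the arithmetic-geometric inequality gives
    [s * Z <= q / 4 + y / 2], and the constant factor that this costs is absorbed by [q > 1]. *)
Lemma has_mean_sub_gaussian (Z W : T -> R) (rho sigma s eW : R) :
  0 < sigma -> 0 <= rho -> (forall w, 0 <= W w) ->
  has_mean P Z 0 -> (forall w, `|Z w| <= rho * W w) ->
  has_mean P (fun w => expR (W w ^+ 2 / sigma ^+ 2)) eW -> eW <= expR 1 ->
  exists2 m, m <= expR (4 * (s * rho * sigma) ^+ 2) & has_mean P (fun w => expR (s * Z w)) m.
Proof.
move=> sg0 rho0 W0 hZ ZW hW eWe.
have mexp : measurable_fun setT (fun w => expR (s * Z w)).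
  apply: measurableT_comp => //; apply: measurable_funM => //.
  exact: has_mean_measurable hZ.
pose q := 2 * (s * rho * sigma) ^+ 2; pose y w := W w ^+ 2 / sigma ^+ 2.
have q0 : 0 <= q by rewrite mulr_ge0// sqr_ge0.
have s20 : 0 < sigma ^+ 2 by rewrite exprn_gt0.
have Z2 w : (s * Z w) ^+ 2 <= q / 2 * y w.
  have -> : q / 2 * y w = s ^+ 2 * (rho * W w) ^+ 2 by rewrite /q /y; field; rewrite gt_eqF.
  rewrite exprMn ler_wpM2l ?sqr_ge0// -real_normK ?num_real//.
  by rewrite ler_sqr ?nnegrE// mulr_ge0.
have e3 := expR1_le3.
have -> : 4 * (s * rho * sigma) ^+ 2 = 2 * q by rewrite /q; ring.
have [q1|q1] := leP q 1.
- have hg := has_meanD (has_meanZ s hZ) (has_meanD (has_mean_cst P (1 - q)) (has_meanZ q hW)).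
  have [] := has_mean_dominated_le mexp _ _ hg.
  + by move=> w; exact: expR_ge0.
  + move=> w /=; apply: le_trans (expR_le_add_sqr _) _; rewrite lerD2l.
    apply: le_trans (expR_convex _ q0 q1); rewrite ler_expR -/(y w).
    by have := Z2 w; lra.
  move=> m hm hmean; exists m => //; apply: le_trans hm _.
  apply: le_trans (expR_ge1Dx _); rewrite mulr0 add0r.
  by have := ler_wpM2l q0 eWe; have := ler_wpM2l q0 e3; lra.
- pose c := expR (q / 4).
  have hg := has_meanZ c (has_meanD (has_mean_cst P (1 - 1 / 2)) (has_meanZ (1 / 2) hW)).
  have [] := has_mean_dominated_le mexp _ _ hg.
  + by move=> w; exact: expR_ge0.
  + move=> w /=; apply: (@le_trans _ _ (c * expR (1 / 2 * y w))); last first.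
      by rewrite ler_wpM2l ?expR_ge0//; apply: expR_convex; lra.
    rewrite -expRD ler_expR; have := Z2 w; set a := s * Z w => ha.
    have y0 : 0 <= y w by rewrite divr_ge0 ?sqr_ge0.
    rewrite -[leLHS](mulr1 _) -(expr1n _ 2).
    have aw : a ^+ 2 <= ((q / 4 + 1 / 2 * y w)) ^+ 2.
      by apply: le_trans ha _; have := sqr_ge0 (q / 4 - 1 / 2 * y w); nra.
    have b0 : 0 <= q / 4 + 1 / 2 * y w by lra.
    rewrite expr1n mulr1; apply: le_trans (ler_norm a) _.
    by rewrite -(ler_pXn2r (n := 2))// ?nnegrE// real_normK ?num_real.
  move=> m hm hmean; exists m => //; apply: le_trans hm _.
  apply: (@le_trans _ _ (c * expR 1)).
    rewrite ler_wpM2l ?expR_ge0//; have := expR_ge1Dx (1 : R); lra.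
  rewrite -expRD ler_expR; lra.
Qed.

End exponential_moments.

(** * The oracle at a fixed feasible point *)

Section oracle.
Context (R : realType) (n : nat) (pb : problem R n) (d d' : measure_display)
  (Omega : measurableType d) (P : probability Omega R) (Xi : measurableType d').
Variables (H : 'rV[R]_n -> Xi -> 'rV[R]_n) (x0 : 'rV[R]_n).
Hypotheses (Xx0 : dom pb x0) (mH : oracle_measurable pb H).
Local Notation X := (dom pb).
Local Notation bV := (borel_rV R n).
Local Notation nd := (dual_norm (nrm pb)).

(* H is only measurable on the feasible set; composing it with this retraction
   makes it measurable everywhere without changing it at the search points. *)
Definition feasible_retract (u : 'rV[R]_n) : 'rV[R]_n := if u \in X then u else x0.
Local Notation r := feasible_retract.

Lemma feasible_retract_dom u : X (r u).
Proof. by rewrite /r; case: ifPn => // /set_mem. Qed.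

Lemma feasible_retract_id u : X u -> r u = u.
Proof. by move=> Xu; rewrite /r mem_set. Qed.

Lemma measurable_feasible_retract : measurable_fun setT (r : bV -> bV).
Proof.
apply: measurable_fun_ifT => //.
apply: (measurable_fun_bool true); rewrite setTI.
have -> : (fun u : bV => u \in X) @^-1` [set true] = X.
  by apply/seteqP; split=> u /=; [move=> /set_mem|move=> Xu; apply/mem_set].
exact: (@borel_rV_closed R n X (@dom_closed R n pb)).
Qed.

Lemma measurable_oracle d1 (T : measurableType d1) (Y : T -> bV) (Z : T -> Xi) :
  measurable_fun setT Y -> measurable_fun setT Z -> (forall w, X (Y w)) ->
  measurable_fun setT (fun w => H (Y w) (Z w) : bV).
Proof.
move=> mY mZ XY.
apply: (@measurable_comp _ _ _ T (bV * Xi)%type bV (X `*` setT) (fun q : bV * Xi => H q.1 q.2 :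
  bV) setT (fun w => (Y w, Z w))).
- by apply: measurableX => //; exact: (@borel_rV_closed R n X (@dom_closed R n pb)).
- by move=> _ [w _ <-]; split=> //=.
- exact: mH.
- exact: measurable_fun_pair.
Qed.

Section one_sample.
Variables (xi : {RV P >-> Xi}).
Hypothesis unb : oracle_unbiased pb P H xi.

(* No measurability of h' is assumed: it comes from h'(u) = E[H(u, xi)]. *)
Lemma measurable_sub_h : measurable_fun setT (fun u : bV => sub_h pb (r u) : bV).
Proof.
apply: measurable_fun_rV => i.
apply/measurable_EFinP.
pose f (q : bV * Omega) := H (r q.1) (xi q.2) ord0 i.
have mf : measurable_fun setT f.
  apply: (measurable_fun_rVP (Y := fun q : bV * Omega => H (r q.1) (xi q.2) : bV)).
  apply: measurable_oracle => [||q]; last exact: feasible_retract_dom.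
  - by apply: measurableT_comp => //; exact: measurable_feasible_retract.
  - exact: measurableT_comp.
have mfE : measurable_fun setT (EFin \o f) by exact/measurable_EFinP.
(* Measurability of a parametric integral is available for nonnegative integrands, so the two parts
   are treated separately. *)
have -> : EFin \o (fun u : bV => sub_h pb (r u) ord0 i) =
   (fun u => (\int[P]_w (EFin \o f)^\+ (u, w) - \int[P]_w (EFin \o f)^\- (u, w))%E).
  apply/funext => u /=; have := unb (feasible_retract_dom u) i.
  rewrite unlock => h; rewrite -h integralE.
  by congr (_ - _)%E; apply: eq_integral => w _; rewrite ?funeposE ?funenegE.
apply: emeasurable_funB.
- apply: (measurable_fun_fubini_tonelli_F (m2 := P)) => //.
  exact: measurable_funepos.
- apply: (measurable_fun_fubini_tonelli_F (m2 := P)) => //.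
  exact: measurable_funeneg.
Qed.

Lemma measurable_oracle_error d1 (T : measurableType d1) (Y : T -> bV) (Z : T -> Xi) :
  measurable_fun setT Y -> measurable_fun setT Z -> (forall w, X (Y w)) ->
  measurable_fun setT (fun w => oracle_error pb H (Y w) (Z w) : bV).
Proof.
move=> mY mZ XY.
have -> : (fun w => oracle_error pb H (Y w) (Z w) : bV) =
  (fun w => 1 *: (H (Y w) (Z w)) + (-1) *: sub_h pb (r (Y w)) : bV).
  by apply/funext => w; rewrite scale1r scaleN1r feasible_retract_id.
apply: (measurable_fun_lincomb (n := n)); first exact: measurable_oracle.
exact: (measurableT_comp measurable_sub_h mY).
Qed.

Lemma measurable_dual_error d1 (T : measurableType d1) (Y : T -> bV) (Z : T -> Xi) :
  measurable_fun setT Y -> measurable_fun setT Z -> (forall w, X (Y w)) ->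
  measurable_fun setT (fun w => nd (oracle_error pb H (Y w) (Z w))).
Proof.
move=> mY mZ XY; apply: (@measurableT_comp _ _ _ _ _ _ (nd : bV -> R)).
  exact: continuous_borel (dual_norm_continuous (nrmP pb)).
exact: measurable_oracle_error.
Qed.

Lemma has_mean_oracle_error u v : X u ->
  has_mean P (fun w => dotp (oracle_error pb H u (xi w)) v) 0.
Proof.
move=> Xu.
have h i : has_mean P (fun w => v ord0 i * (H u (xi w) ord0 i + - sub_h pb u ord0 i)) 0.
  rewrite -(mulr0 (v ord0 i)) -(subrr (sub_h pb u ord0 i)).
  apply: has_meanZ; apply: has_meanD; last exact: has_mean_cst.
  apply: has_mean_of_integral; last by have := unb Xu i; rewrite unlock.
  apply: (measurable_fun_rVP (Y := fun w => H u (xi w) : bV)).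
  exact: measurable_oracle.
have := has_mean_sum (index_enum 'I_n) h; rewrite big1//.
congr has_mean; apply/funext => w; apply: eq_bigr => i _.
by rewrite /oracle_error !mxE mulrC.
Qed.

Lemma has_mean_oracle_variance sigma u : oracle_variance pb P H sigma xi -> X u ->
  exists2 m, m <= sigma ^+ 2 & has_mean P (fun w => nd (oracle_error pb H u (xi w)) ^+ 2) m.
Proof.
move=> hv Xu; apply: has_mean_of_integral_le.
- by apply: measurable_funX; exact: measurable_dual_error.
- by move=> w; exact: sqr_ge0.
- by have := hv u Xu; rewrite unlock.
Qed.

Lemma has_mean_oracle_light_tail sigma u : oracle_light_tail pb P H sigma xi -> X u ->
  exists2 m, m <= expR 1 &
    has_mean P (fun w => expR (nd (oracle_error pb H u (xi w)) ^+ 2 / sigma ^+ 2)) m.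
Proof.
move=> hv Xu; apply: has_mean_of_integral_le.
- apply: measurableT_comp => //; apply: measurable_funM => //.
  by apply: measurable_funX; exact: measurable_dual_error.
- by move=> w; exact: expR_ge0.
- by have := hv u Xu; rewrite unlock.
Qed.

End one_sample.
End oracle.

(** * Error terms along a run *)

Section history.
Context (R : realType) (n : nat) (d d' : measure_display)
  (Omega : measurableType d) (P : probability Omega R) (Xi : measurableType d').
Variables (S : schedule R) (N : nat).
Variables (xi : nat -> nat -> {RV P >-> Xi}) (u : nat -> nat -> {RV P >-> borel_rV R n}).

(** The generators of [history], named so that the generated sigma-algebra becomes a measurable type
    and dependence on the past is ordinary measurability from [Hist k t]. *)
Definition history_gen (k t : nat) : set (set Omega) :=
  [set A | exists k' t', is_call S N k' t' /\
        (((before k' t' k t \/ (k', t') = (k, t)) /\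
          preimage_set_system setT (u k' t') measurable A)
         \/ (before k' t' k t /\
             preimage_set_system setT (xi k' t') measurable A))].

Local Notation Hist k t := (g_sigma_algebraType (history_gen k t)).

Lemma measurable_history_point k t k' t' : is_call S N k' t' ->
  before k' t' k t \/ (k', t') = (k, t) ->
  measurable_fun setT (u k' t' : Hist k t -> borel_rV R n).
Proof.
move=> c b _ A mA; apply: sub_sigma_algebra; exists k', t'; split=> //.
by left; split=> //; exists A.
Qed.

Lemma measurable_history_sample k t k' t' : is_call S N k' t' ->
  before k' t' k t -> measurable_fun setT (xi k' t' : Hist k t -> Xi).
Proof.
move=> c b _ A mA; apply: sub_sigma_algebra; exists k', t'; split=> //.
by right; split=> //; exists A.
Qed.

Lemma history_measurable k t (A : set Omega) :
  measurable (A : set (Hist k t)) -> measurable A.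
Proof.
apply: smallest_sub; first exact: sigma_algebra_measurable.
move=> B [k' [t' [_ [[_ [C mC <-]]|[_ [C mC <-]]]]]]; rewrite setTI; exact: measurable_funPTI.
Qed.

(** Freshness concerns events of the history, and preimages under a history-measurable [Y] are such
    events. [Y] may thus combine many earlier points and samples. *)
Lemma fresh_indep k t d1 (T1 : measurableType d1) (Y : Omega -> T1) :
  fresh_samples P S N (fun k t => xi k t : Omega -> Xi) (fun k t => u k t : Omega -> borel_rV R
    n) ->
  is_call S N k t -> measurable_fun setT (Y : Hist k t -> T1) ->
  exists Y' : {RV P >-> T1}, (Y' : Omega -> T1) = Y /\
    forall A B, measurable A -> measurable B ->
      P (Y' @^-1` A `&` xi k t @^-1` B) = (P (Y' @^-1` A) * P (xi k t @^-1` B))%E.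
Proof.
move=> fr ck mY.
have mY' : measurable_fun setT Y.
  by move=> _ A mA; apply: (@history_measurable k t); exact: mY.
pose Ym := isMeasurableFun.Build _ _ _ _ _ mY'.
pose Y' : {RV P >-> T1} := HB.pack Y Ym.
exists Y'; split=> // A B mA mB.
apply: fr => //.
have := mY measurableT A mA; rewrite setTI; exact.
Qed.

End history.

Section calls.
Variables (R : realType) (S : schedule R).

(** A single list in the order of the calls, so that the martingale argument is an induction on the
    last call. *)
Fixpoint calls (N : nat) : seq (nat * nat) :=
  if N is N'.+1 then calls N' ++ [seq (N, t) | t <- iota 0 (T_ S N)] else [::].

Lemma calls_is_call N j : j \in calls N -> is_call S N j.1 j.2.
Proof.
elim: N => [//|N IH] /=; rewrite mem_cat => /orP[/IH|].
  by case/and3P=> a b c; rewrite /is_call a c (leqW b).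
by case/mapP => t; rewrite mem_iota add0n => /andP[_ tT] ->; rewrite /is_call /= leqnn.
Qed.

Lemma calls_pairwise N : pairwise (fun i j => before i.1 i.2 j.1 j.2) (calls N).
Proof.
elim: N => [//|N IH] /=; rewrite pairwise_cat IH /=; apply/andP; split.
  apply/allrelP => i j /calls_is_call /and3P[_ iN _] /mapP[t _ ->] /=.
  by rewrite /before /= ltnS iN.
rewrite pairwise_map; have := iota_ltn_sorted 0 (T_ S N.+1).
rewrite sorted_pairwise; last exact: ltn_trans.
by apply: sub_pairwise => a b /= ab; rewrite /before /= eqxx ab orbT.
Qed.

Lemma sum_calls N (F : nat -> nat -> R) :
  \sum_(j <- calls N) F j.1 j.2 = \sum_(k < N) \sum_(t < T_ S k.+1) F k.+1 t.
Proof.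
elim: N => [|N IH]; first by rewrite big_nil big_ord0.
rewrite big_cat big_ord_recr /= IH; congr (_ + _).
by rewrite big_map -(big_mkord xpredT (fun t => F N.+1 t)) /index_iota subn0.
Qed.

End calls.

Section run_errors.
Context (R : realType) (n : nat) (pb : problem R n) (d d' : measure_display)
  (Omega : measurableType d) (P : probability Omega R) (Xi : measurableType d').
Variables (H : 'rV[R]_n -> Xi -> 'rV[R]_n) (S : schedule R) (N : nat) (xs : 'rV[R]_n).
Variables (xi : nat -> nat -> {RV P >-> Xi}) (u : nat -> nat -> {RV P >-> borel_rV R n}).
Variables (rho sigma : R).
Local Notation X := (dom pb).
Local Notation bV := (borel_rV R n).
Local Notation nd := (dual_norm (nrm pb)).
Hypotheses (Xxs : X xs) (mH : oracle_measurable pb H).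
Hypothesis unb : forall k t, is_call S N k t -> oracle_unbiased pb P H (xi k t).
Hypothesis fr : fresh_samples P S N (fun k t => xi k t : Omega -> Xi)
       (fun k t => u k t : Omega -> borel_rV R n).
Hypothesis Xu : forall k t, is_call S N k t -> forall w, X (u k t w).
Hypothesis rho0 : 0 <= rho.
Hypothesis nrm_rho : forall x, X x -> nrm pb (xs - x) <= rho.

Definition call_error k t w := oracle_error pb H (u k t w) (xi k t w).
Definition call_bias k t w := dotp (call_error k t w) (xs - u k t w).
Definition call_norm k t w := nd (call_error k t w).

Local Notation r := (feasible_retract pb xs).

Let measurable_bias d1 (T : measurableType d1) (Y : T -> bV) (Z : T -> Xi) k t :
  is_call S N k t ->
  measurable_fun setT Y -> measurable_fun setT Z -> (forall w, X (Y w)) ->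
  measurable_fun setT (fun w => dotp (oracle_error pb H (Y w) (Z w)) (xs - Y w)).
Proof.
move=> ck mY mZ XY; apply: (measurable_fun_dotp (n := n)).
  exact: (measurable_oracle_error Xxs mH (unb ck)).
have -> : (fun w => xs - Y w : bV) = (fun w => 1 *: xs + (-1) *: Y w : bV).
  by apply/funext => w; rewrite scale1r scaleN1r.
by apply: measurable_fun_lincomb.
Qed.

(** The search point belongs to the history, so a bound uniform over feasible points survives its
    randomness. *)
Lemma fresh_point_mean k t (F : 'rV[R]_n -> Xi -> R) (c : R) : is_call S N k t ->
  measurable_fun setT (fun q : bV * Xi => F (r q.1) q.2) ->
  (forall x z, X x -> 0 <= F x z) ->
  (forall x, X x -> exists2 m, m <= c & has_mean P (fun w => F x (xi k t w)) m) ->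
  exists2 m, m <= c & has_mean P (fun w => F (u k t w) (xi k t w)) m.
Proof.
move=> ck mF F0 hF.
have mY := @measurable_history_point _ _ _ _ _ P _ S N xi u k t k t ck (or_intror erefl).
have [Y [EY indep]] := fresh_indep fr ck mY.
have [||w||m hm hmean] := @fresh_mean _ _ _ _ _ _ _ P Y (xi k t) (fun q => F (r q.1) q.2) (fun=>
  c) c indep.
- exact: mF.
- by move=> x; apply: F0; exact: feasible_retract_dom.
- exact: (hF (r (Y w)) (feasible_retract_dom Xxs (Y w))).
- exact: has_mean_cst.
exists m => //; move: hmean; rewrite EY; congr has_mean.
by apply/funext => w /=; rewrite feasible_retract_id//; exact: Xu.
Qed.

Lemma dotp_bias_le x e : X x -> `|dotp e (xs - x)| <= rho * nd e.
Proof.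
by move=> Xx; rewrite mulrC; apply: dual_norm_bound (nrm_rho Xx); exact: nrmP.
Qed.

Lemma measurable_retract_error k t : is_call S N k t ->
  measurable_fun setT (fun q : bV * Xi => nd (oracle_error pb H (r q.1) q.2)).
Proof.
move=> ck; apply: (measurable_dual_error Xxs mH (unb ck)) => //.
  by apply: measurableT_comp => //; exact: measurable_feasible_retract.
by move=> q; exact: feasible_retract_dom.
Qed.

Lemma measurable_retract_bias k t : is_call S N k t ->
  measurable_fun setT (fun q : bV * Xi => dotp (oracle_error pb H (r q.1) q.2) (xs - r q.1)).
Proof.
move=> ck; apply: (measurable_bias ck) => //.
  by apply: measurableT_comp => //; exact: measurable_feasible_retract.
by move=> q; exact: feasible_retract_dom.
Qed.

(* The constant K below makes the integrand nonnegative, so that Tonelli applies. *)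
Lemma call_mean k t a : is_call S N k t -> oracle_variance pb P H sigma (xi k t) ->
  exists2 m, m <= sigma ^+ 2 &
    has_mean P (fun w => a * call_bias k t w + call_norm k t w ^+ 2) m.
Proof.
move=> ck hv; pose K := (a * rho) ^+ 2 / 4.
pose F x z := a * dotp (oracle_error pb H x z) (xs - x) + nd (oracle_error pb H x z) ^+ 2 + K.
have [|||m hm hmean] := @fresh_point_mean k t F (sigma ^+ 2 + K) ck.
- apply: measurable_funD => //; apply: measurable_funD.
    by apply: measurable_funM => //; exact: (measurable_retract_bias ck).
  by apply: measurable_funX; exact: (measurable_retract_error ck).
- move=> x z Xx; rewrite /F /K; set e := oracle_error _ _ _ _.
  have := dotp_bias_le e Xx; set b := dotp _ _; set y := nd e => hb.
  have hb2 : `|a * b| <= `|a| * rho * y.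
    by rewrite normrM -mulrA ler_wpM2l.
  have hab : - (`|a| * rho * y) <= a * b by move: hb2; rewrite ler_norml => /andP[].
  have -> : (a * rho) ^+ 2 = (`|a| * rho) ^+ 2 by rewrite !exprMn real_normK ?num_real.
  have := sqr_ge0 (`|a| * rho / 2 - y); nra.
- move=> x Xx; have [m hm hmean] := has_mean_oracle_variance Xxs mH (unb ck) hv Xx.
  exists (a * 0 + m + K); first lra.
  apply: has_meanD; last exact: has_mean_cst.
  apply: has_meanD => //; apply: has_meanZ.
  exact: (has_mean_oracle_error mH (unb ck) (xs - x) Xx).
exists (m - K); first lra.
have := has_meanD hmean (has_mean_cst P (- K)).
by congr has_mean; apply/funext => w /=; rewrite /F addrK.
Qed.

Lemma call_light_tail k t : is_call S N k t -> oracle_light_tail pb P H sigma (xi k t) ->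
  exists2 m, m <= expR 1 & has_mean P (fun w => expR (call_norm k t w ^+ 2 / sigma ^+ 2)) m.
Proof.
move=> ck hv.
apply: (@fresh_point_mean k t (fun x z => expR (nd (oracle_error pb H x z) ^+ 2 / sigma ^+ 2)) _
  ck).
- apply: measurableT_comp => //; apply: measurable_funM => //.
  by apply: measurable_funX; exact: (measurable_retract_error ck).
- by move=> x z _; exact: expR_ge0.
- by move=> x Xx; exact: (has_mean_oracle_light_tail Xxs mH (unb ck)).
Qed.

(* Conditioning on the history of the last call peels off one sub-Gaussian factor. *)
Lemma martingale_exp_moment (s : seq (nat * nat)) (c : nat -> nat -> R) :
  0 < sigma ->
  (forall j, j \in s -> is_call S N j.1 j.2) ->
  (forall j, j \in s -> oracle_light_tail pb P H sigma (xi j.1 j.2)) ->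
  pairwise (fun i j => before i.1 i.2 j.1 j.2) s ->
  exists2 m, m <= expR (\sum_(j <- s) 4 * (c j.1 j.2 * rho * sigma) ^+ 2) &
    has_mean P (fun w => expR (\sum_(j <- s) c j.1 j.2 * call_bias j.1 j.2 w)) m.
Proof.
move=> sg0; elim/last_ind: s => [_ _ _|s [k t] IH cs ls].
  exists 1; first by rewrite big_nil expR0.
  by under eq_fun do rewrite big_nil expR0; exact: has_mean_cst.
rewrite pairwise_rcons => /andP[/allP bs ps].
have ck : is_call S N k t by apply: (cs (k, t)); rewrite mem_rcons mem_head.
have lk : oracle_light_tail pb P H sigma (xi k t) by apply: (ls (k, t)); rewrite mem_rcons mem_head.
have cs' j : j \in s -> is_call S N j.1 j.2 by move=> js; apply: cs; rewrite mem_rcons inE js orbT.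
have [|m0 hm0 hmean0] := IH cs' _ ps; first by move=> j js; apply: ls; rewrite mem_rcons inE js
  orbT.
pose past w := expR (\sum_(j <- s) c j.1 j.2 * call_bias j.1 j.2 w).
set Hist := g_sigma_algebraType (history_gen S N xi u k t).
have mpast : measurable_fun setT (past : Hist -> R).
  apply: measurableT_comp => //.
  (* [measurable_sum] asks for measurability at every index, but only calls in [s] are known to
     precede the current one. The guard makes the other terms constant. *)
  have -> : (fun w : Hist => \sum_(j <- s) c j.1 j.2 * call_bias j.1 j.2 w) =
    (fun w => \sum_(j <- s) (if j \in s then c j.1 j.2 * call_bias j.1 j.2 w else 0)).
    by apply/funext => w; apply: eq_big_seq => j ->.
  apply: measurable_sum => j; have [js|_] := boolP (j \in s); last exact: measurable_cst.
  apply: measurable_funM => //.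
  apply: (@measurable_bias _ Hist _ _ _ _ (cs' j js)).
  - by apply: measurable_history_point; [exact: cs'|left; exact: bs].
  - by apply: measurable_history_sample; [exact: cs'|exact: bs].
  - by move=> w; apply: Xu; exact: cs'.
(* The new sample must be independent of the past factor and the current point jointly. *)
have mY : measurable_fun setT ((fun w => (past w, u k t w)) : Hist -> R * bV).
  apply: measurable_fun_pair => //.
  by apply: measurable_history_point => //; right.
have [Y [EY indep]] := fresh_indep fr ck mY.
(* The past factor is positive; the absolute value makes [F] nonnegative on the whole product
   space. *)
pose F (q : (R * bV) * Xi) := `|q.1.1| *
  expR (c k t * dotp (oracle_error pb H (r q.1.2) q.2) (xs - r q.1.2)).
pose K := expR (4 * (c k t * rho * sigma) ^+ 2).
have [|q|w||m hm hmean] := @fresh_mean _ _ _ _ _ _ _ P Y (xi k t) F (fun q => K * `|q.1|) (K *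
  m0) indep.
- apply: measurable_funM.
    by apply: measurableT_comp => //; apply: measurableT_comp.
  apply: measurableT_comp => //; apply: measurable_funM => //.
  apply: (measurableT_comp (measurable_retract_bias ck) (g := fun q : (R * bV) * Xi => (q.1.2,
    q.2))).
  by apply: measurable_fun_pair => //; apply: measurableT_comp.
- by rewrite mulr_ge0// expR_ge0.
- set x := r (Y w).2; have Xx : X x by exact: feasible_retract_dom.
  have [eW heW hmW] := has_mean_oracle_light_tail Xxs mH (unb ck) lk Xx.
  have := has_mean_sub_gaussian (c k t) sg0 rho0 _ (has_mean_oracle_error mH (unb ck) (xs - x)
    Xx) _ hmW heW.
  move=> /(_ _)[||m hm hmean].
  + by move=> w'; apply: dual_norm_ge0; exact: nrmP.
  + by move=> w'; exact: dotp_bias_le.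
  exists (`|(Y w).1| * m); first by rewrite mulrC ler_wpM2r.
  exact: (has_meanZ `|(Y w).1| hmean).
- rewrite EY; apply: has_meanZ; have := hmean0; congr has_mean.
  by apply/funext => w; rewrite ger0_norm// expR_ge0.
exists m; last first.
  move: hmean; rewrite EY; congr has_mean; apply/funext => w.
  rewrite /F /= feasible_retract_id; last exact: Xu.
  by rewrite ger0_norm ?expR_ge0// -expRD -cats1 big_cat big_seq1.
rewrite -cats1 big_cat big_seq1 expRD; apply: le_trans hm _.
by rewrite mulrC ler_wpM2r// expR_ge0.
Qed.

End run_errors.

(** * Convergence from a certificate *)

Section weights.
Variables (R : realType) (n : nat) (pb : problem R n) (prx : prox_function pb).
Variables (S : schedule R) (G : nat -> R).

Definition bias_weight (k t : nat) : R := G k * gamma_ S k / inner_weight S k * t.+2%:R.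

(** The factor 2 comes from [(M + y) ^ 2 <= 2 * M ^ 2 + 2 * y ^ 2]. *)
Definition norm_weight (k t : nat) : R :=
  2 * bias_weight k t / (nu prx * beta_ S k * t.+1%:R).

End weights.

(* G k stands for 1 / Gamma_k.  A bounds the telescoped Bregman terms; K bounds
   the mean of the squared error norms together with the contribution of M, and
   the standard deviation of the martingale. *)
Record certificate (R : realType) (n : nat) (pb : problem R n) (prx : prox_function pb)
    (DX sigma : R) (S : schedule R) (N : nat) (G : nat -> R) (A K : R) : Prop := Certificate {
  cert_gamma : forall k, (0 < k <= N)%N -> 0 <= gamma_ S k <= 1;
  cert_beta : forall k, (0 < k <= N)%N -> 0 < beta_ S k;
  cert_T : forall k, (0 < k <= N)%N -> (0 < T_ S k)%N;
  cert_L : forall k, (0 < k <= N)%N -> Lf pb * gamma_ S k <= nu prx * beta_ S k;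
  cert_G0 : G 0%N = 0;
  cert_G : forall k, (k < N)%N -> 0 <= G k.+1 /\ G k.+1 * (1 - gamma_ S k.+1) = G k;
  cert_GN : 0 < G N;
  cert_K : 0 < K;
  cert_A : forall V : nat -> R, (forall k, (k <= N)%N -> 0 <= V k <= DX) ->
    \sum_(k < N) G k.+1 * gamma_ S k.+1 / inner_weight S k.+1 *
      (beta_ S k.+1 * ((T_ S k.+1).+1%:R * (T_ S k.+1).+2%:R / 2) * (V k - V k.+1)) <= A;
  cert_norm : \sum_(k < N) \sum_(t < T_ S k.+1)
      norm_weight prx S G k.+1 t * (Mh pb ^+ 2 + sigma ^+ 2) <= K;
  cert_bias : 8 * DX / nu prx * sigma ^+ 2 *
      \sum_(k < N) \sum_(t < T_ S k.+1) bias_weight S G k.+1 t ^+ 2 <= K ^+ 2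
}.

Section master.
Context (R : realType) (n : nat) (pb : problem R n) (prx : prox_function pb)
  (DX sigma : R) (S : schedule R) (N : nat) (G : nat -> R) (A K : R).
Hypothesis DX_bound : forall x y, dom pb x -> dom pb y -> bregman prx x y <= DX.
Hypothesis cert : certificate prx DX sigma S N G A K.
Context (d d' : measure_display) (Omega : measurableType d) (P : probability Omega R)
  (Xi : measurableType d') (H : 'rV[R]_n -> Xi -> 'rV[R]_n) (x0 : 'rV[R]_n)
  (xi : nat -> nat -> {RV P >-> Xi}) (u : nat -> nat -> {RV P >-> borel_rV R n}).
Hypotheses (Xx0 : dom pb x0) (mH : oracle_measurable pb H).
Hypothesis unb : forall k t, is_call S N k t -> oracle_unbiased pb P H (xi k t).
Hypothesis var : forall k t, is_call S N k t -> oracle_variance pb P H sigma (xi k t).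
Hypothesis run : stochastic_sgs_run prx H S N x0 xi u.
Variable xs : 'rV[R]_n.
Hypothesis xs_min : is_argmin (dom pb) (Psi pb) xs.

Local Notation X := (dom pb).
Local Notation c := (bias_weight S G).
Local Notation b := (norm_weight prx S G).
Local Notation xbar := (fun w => sgs_bar S x0 (fun k t => u k t w) N).
Local Notation zeta := (call_bias pb H xs xi u).
Local Notation dlt := (call_norm pb H xi u).
Local Notation gap := (fun w => Psi pb (xbar w) - Psi pb xs).

Let Xxs : X xs. Proof. by case: xs_min. Qed.
Let run_w w := run.1 w.

Lemma master_call_dom k t : is_call S N k t -> forall w, X (u k t w).
Proof. by move=> ck w; apply: (sgs_call_dom Xx0 (cert_gamma cert) (run_w w)). Qed.

Lemma bias_weight_ge0 k t : (k < N)%N -> 0 <= c k.+1 t.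
Proof.
move=> kN; have kk : (0 < k.+1 <= N)%N by [].
have [G0 _] := cert_G cert kN; have /andP[g0 _] := cert_gamma cert kk.
rewrite /bias_weight !mulr_ge0// invr_ge0.
by apply: ltW; apply: inner_weight_gt0 kk; exact: cert_T cert.
Qed.

Lemma norm_weight_ge0 k t : (k < N)%N -> 0 <= b k.+1 t.
Proof.
move=> kN; have kk : (0 < k.+1 <= N)%N by [].
have c0 := bias_weight_ge0 t kN.
have b0 := ltW (cert_beta cert kk); have n0 := ltW (nu_gt0 prx).
by rewrite /norm_weight; apply: divr_ge0; [exact: mulr_ge0|apply: mulr_ge0 => //; exact: mulr_ge0].
Qed.

Lemma call_norm_weight_ge0 j : j \in calls S N -> 0 <= b j.1 j.2.
Proof.
by move=> /calls_is_call; case: j => [[|k] t] //= /and3P[_ kN _]; exact: norm_weight_ge0.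
Qed.

Lemma sgs_pathwise w : G N * gap w <=
  A + \sum_(j <- calls S N) b j.1 j.2 * Mh pb ^+ 2
    + \sum_(j <- calls S N) (c j.1 j.2 * zeta j.1 j.2 w + b j.1 j.2 * dlt j.1 j.2 w ^+ 2).
Proof.
have h := sgs_sum Xx0 Xxs (cert_gamma cert) (cert_beta cert) (cert_T cert) (cert_L cert) (run_w w)
  (cert_G0 cert) (cert_G cert) (leqnn N).
apply: le_trans h _.
(* These distances depend on the sample path, which is why [cert_A] ranges over all sequences with
   values in [[0, DX]]. *)
pose V k := bregman prx (sgs_center S x0 (fun k t => u k t w) k) xs.
have VDX k : (k <= N)%N -> 0 <= V k <= DX.
  move=> kN; have [Xc _] := sgs_dom Xx0 (cert_gamma cert) (run_w w) kN.
  by rewrite DX_bound// bregman_ge0.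
rewrite -addrA; apply: le_trans (lerD (cert_A cert VDX) (lexx _)).
rewrite -big_split /= (sum_calls S N (fun k t => b k t * Mh pb ^+ 2 + (c k t * zeta k t w + b k t
  * dlt k t w ^+ 2))).
rewrite -big_split /=; apply: ler_sum => k _.
rewrite /outer_error mulrDr lerD2l mulr_sumr; apply: ler_sum => t _.
have c0 := bias_weight_ge0 t (ltn_ord k).
rewrite mulrA -/(c k.+1 t) /step_error -/(call_error pb H xi u k.+1 t w).
rewrite -/(zeta k.+1 t w) -/(dlt k.+1 t w) mulrDr addrCA lerD2l.
have kk : (0 < k.+1 <= N)%N by rewrite ltn_ord.
have den0 : 0 <= (nu prx * beta_ S k.+1 * t.+1%:R)^-1.
  have b0 := ltW (cert_beta cert kk); have n0 := ltW (nu_gt0 prx).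
  by rewrite invr_ge0; apply: mulr_ge0 => //; exact: mulr_ge0.
rewrite /norm_weight.
set D := (_ * _ * _)^-1 in den0 *; set y := dlt _ _ _.
have h2 : (Mh pb + y) ^+ 2 <= 2 * Mh pb ^+ 2 + 2 * y ^+ 2.
  by have := sqr_ge0 (Mh pb - y); nra.
have := ler_wpM2l (mulr_ge0 c0 den0) h2; lra.
Qed.

Lemma sum_norm_weight_le (s2 : R) : 0 <= s2 -> s2 <= Mh pb ^+ 2 + sigma ^+ 2 ->
  \sum_(j <- calls S N) b j.1 j.2 * s2 <= K.
Proof.
move=> s20 s2le; apply: le_trans (cert_norm cert).
rewrite (sum_calls S N (fun k t => b k t * s2)).
apply: ler_sum => k _; apply: ler_sum => t _.
by rewrite ler_wpM2l// norm_weight_ge0.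
Qed.

Lemma measurable_xbar : measurable_fun setT (xbar : Omega -> borel_rV R n).
Proof.
have mc k : measurable_fun setT (fun w => sgs_center S x0 (fun k t => u k t w) k : borel_rV R n).
  by case: k.
have ma (y : Omega -> borel_rV R n) k t : measurable_fun setT y ->
    measurable_fun setT (fun w => sps_avg (y w) (fun t => u k t w) t : borel_rV R n).
  by move=> my; elim: t => [//|t IH] /=; apply: measurable_fun_lincomb.
elim: (N) => [//|k IH] /=; apply: measurable_fun_lincomb => //.
exact: ma.
Qed.

Lemma xbar_dom w : X (xbar w).
Proof. by have [] := sgs_dom Xx0 (cert_gamma cert) (run_w w) (leqnn N). Qed.

Lemma measurable_Psi : measurable_fun (X : set (borel_rV R n)) (Psi pb).
Proof.
have L0 : 0 <= Lf pb / 2 by rewrite divr_ge0// ltW// Lf_gt0.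
apply: measurable_funD; last exact: chi_measurable.
apply: measurable_funD; apply: within_continuous_borel; try exact: dom_closed.
- apply: (within_continuous_gradient (nrmP pb) L0 (g := grad_f pb)) => x y Xx Xy.
  rewrite (convex_gradient_le (nrmP pb) (@dom_convex _ _ pb) (convex_functionP (@f_convex _ _
    pb)) Xx Xy (grad_fP Xx)) /=.
  apply: le_trans (f_smooth Xy Xx) _; rewrite lerD2l ler_wpM2l// lerDr.
  by rewrite nrm_ge0//; exact: nrmP.
- apply: (within_continuous_gradient (nrmP pb) (ltW (Mh_gt0 pb)) (g := sub_h pb)) => x y Xx Xy.
  rewrite (sub_hP Xx Xy) /=.
  apply: le_trans (h_lipschitz Xy Xx) _; rewrite lerD2l ler_wpM2l ?(ltW (Mh_gt0 pb))// lerDl.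
  exact: sqr_ge0.
Qed.

Lemma measurable_gap : measurable_fun setT gap.
Proof.
apply: measurable_funB => //.
apply: (@measurable_comp _ _ _ Omega (borel_rV R n) R X (Psi pb) setT xbar).
- exact: (@borel_rV_closed R n X (@dom_closed R n pb)).
- by move=> _ [w _ <-]; exact: xbar_dom.
- exact: measurable_Psi.
- exact: measurable_xbar.
Qed.

Lemma gap_ge0 w : 0 <= gap w.
Proof. by rewrite subr_ge0; case: xs_min => _; apply; exact: xbar_dom. Qed.

(** A radius of the domain around [xs], read off from [nu / 2 * |xs - x| ^ 2 <= V x xs <= DX]. *)
Let rho := Num.sqrt (2 * DX / nu prx).

Let DX0 : 0 <= DX.
Proof. by apply: le_trans (DX_bound Xxs Xxs); exact: bregman_ge0. Qed.

Lemma nrm_le_rho x : X x -> nrm pb (xs - x) <= rho.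
Proof.
move=> Xx; rewrite -(ger0_norm (nrm_ge0 (nrmP pb) (xs - x))) -sqrtr_sqr ler_sqrt; last first.
  by rewrite divr_ge0 ?mulr_ge0// ltW// nu_gt0.
rewrite ler_pdivlMr ?nu_gt0//.
have := le_trans (bregman_ge prx Xx Xxs) (DX_bound Xx Xxs); lra.
Qed.

(** Integrability of the gap is part of the claim: it is nonnegative, and the pathwise bound
    dominates it by an integrable function. *)
Lemma master_expectation :
  exists2 m, m <= A + K & has_mean P (fun w => G N * gap w) m.
Proof.
have hj (j : nat * nat) : exists m, j \in calls S N -> 
   m <= b j.1 j.2 * sigma ^+ 2 /\ has_mean P (fun w => c j.1 j.2 * zeta j.1 j.2 w + b j.1 j.2 *
     dlt j.1 j.2 w ^+ 2) m.
  have [js|] := boolP (j \in calls S N); last by exists 0.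
  have ck := calls_is_call js; have b0 := call_norm_weight_ge0 js.
  have kk : (0 < j.1 <= N)%N by case/and3P: ck => -> ->.
  (* The coefficient of the bias is the ratio of the bias weight to the norm weight; multiplying by
     the norm weight restores both terms. *)
  have [m hm hmean] := @call_mean _ _ _ _ _ _ P _ H S N xs xi u rho sigma Xxs mH unb run.2
    master_call_dom nrm_le_rho j.1 j.2 (nu prx * beta_ S j.1 * j.2.+1%:R / 2) ck (var ck).
  exists (b j.1 j.2 * m) => _; split; first by rewrite ler_wpM2l.
  have := has_meanZ (b j.1 j.2) hmean; congr has_mean; apply/funext => w.
  rewrite mulrDr; congr (_ + _); rewrite mulrA; congr (_ * _).
  rewrite /norm_weight; field; rewrite ?pnatr_eq0 ?gt_eqF ?nu_gt0//.
  exact: (cert_beta cert kk).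
have [m hm] := choice hj.
have hs : has_mean P (fun w => \sum_(j <- calls S N) (if j \in calls S N then c j.1 j.2 * zeta
  j.1 j.2 w + b j.1 j.2 * dlt j.1 j.2 w ^+ 2 else 0))
   (\sum_(j <- calls S N) (if j \in calls S N then m j else 0)).
  apply: has_mean_sum => j; have [js|_] := boolP (j \in calls S N); last exact: has_mean_cst.
  by case: (hm j js).
pose B := A + \sum_(j <- calls S N) b j.1 j.2 * Mh pb ^+ 2.
have hB := has_meanD (has_mean_cst P B) hs.
have [|w|w|m' hm' hmean'] := @has_mean_dominated_le _ _ _ P (fun w => G N * gap w) _ _ _ _ _ hB.
- by apply: measurable_funM => //; exact: measurable_gap.
- by apply: mulr_ge0; [exact: ltW (cert_GN cert)|exact: gap_ge0].
- apply: le_trans (sgs_pathwise w) _; rewrite lerD2l.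
  rewrite big_seq [leRHS]big_seq; apply: ler_sum => j ->; exact: lexx.
exists m' => //; apply: le_trans hm' _; rewrite /B -addrA lerD2l.
apply: le_trans (sum_norm_weight_le (s2 := Mh pb ^+ 2 + sigma ^+ 2) _ (lexx _)); last first.
  by rewrite addr_ge0 ?sqr_ge0.
under [leRHS]eq_bigr do rewrite mulrDr.
rewrite [leRHS]big_split /= lerD2l big_seq [leRHS]big_seq.
by apply: ler_sum => j js; rewrite js; case: (hm j js).
Qed.

Section light_tail.
Hypothesis sigma0 : 0 < sigma.
Hypothesis light : forall k t, is_call S N k t -> oracle_light_tail pb P H sigma (xi k t).

(** The Jensen weights are [b_j * sigma ^ 2 / K], of total at most 1 by [cert_norm]; each
    exponential has mean at most [e], and so has the missing mass. *)
Lemma norm_exp_moment : exists2 m, m <= expR 1 &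
  has_mean P (fun w => expR (\sum_(j <- calls S N) b j.1 j.2 / K * dlt j.1 j.2 w ^+ 2)) m.
Proof.
have K0 := cert_K cert; have s20 : 0 < sigma ^+ 2 by rewrite exprn_gt0.
pose p j := if j \in calls S N then b j.1 j.2 * sigma ^+ 2 / K else 0.
have p0 j : 0 <= p j.
  rewrite /p; case: ifPn => // js.
  by rewrite divr_ge0 ?(ltW K0)// mulr_ge0 ?(ltW s20)// call_norm_weight_ge0.
have psum : \sum_(j <- calls S N) p j <= 1.
  have -> : \sum_(j <- calls S N) p j = (\sum_(j <- calls S N) b j.1 j.2 * sigma ^+ 2) / K.
    by rewrite mulr_suml big_seq [RHS]big_seq; apply: eq_bigr => j js; rewrite /p js.
  rewrite ler_pdivrMr// mul1r sum_norm_weight_le ?(ltW s20)//.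
  by rewrite lerDr sqr_ge0.
have hj (j : nat * nat) : exists m, j \in calls S N -> 
   m <= expR 1 /\ has_mean P (fun w => expR (dlt j.1 j.2 w ^+ 2 / sigma ^+ 2)) m.
  have [js|] := boolP (j \in calls S N); last by exists 0.
  have ck := calls_is_call js.
  have [m hm hmean] := @call_light_tail _ _ _ _ _ _ P _ H S N xs xi u sigma Xxs mH unb run.2
    master_call_dom j.1 j.2 ck (light ck).
  by exists m.
have [m hm] := choice hj.
have hs : has_mean P (fun w => \sum_(j <- calls S N) p j * (if j \in calls S N then expR (dlt j.1
  j.2 w ^+ 2 / sigma ^+ 2) else 0))
   (\sum_(j <- calls S N) p j * (if j \in calls S N then m j else 0)).
  apply: has_mean_sum => j; apply: has_meanZ.
  have [js|_] := boolP (j \in calls S N); last exact: has_mean_cst.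
  by case: (hm j js).
have hB := has_meanD (has_mean_cst P (1 - \sum_(j <- calls S N) p j)) hs.
have sE w : \sum_(j <- calls S N) b j.1 j.2 / K * dlt j.1 j.2 w ^+ 2 =
    \sum_(j <- calls S N) p j * (dlt j.1 j.2 w ^+ 2 / sigma ^+ 2).
  rewrite big_seq [RHS]big_seq; apply: eq_bigr => j js; rewrite /p js; field.
  by rewrite !gt_eqF.
have [|w|w|m' hm' hmean'] := @has_mean_dominated_le _ _ _ P
  (fun w => expR (\sum_(j <- calls S N) b j.1 j.2 / K * dlt j.1 j.2 w ^+ 2)) _ _ _ _ _ hB.
- apply: measurableT_comp => //.
  have -> : (fun w => \sum_(j <- calls S N) b j.1 j.2 / K * dlt j.1 j.2 w ^+ 2) =
    (fun w => \sum_(j <- calls S N) if j \in calls S N then b j.1 j.2 / K * dlt j.1 j.2 w ^+ 2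
      else 0).
    by apply/funext => w; rewrite big_seq [RHS]big_seq; apply: eq_bigr => j ->.
  apply: measurable_sum => j; have [js|_] := boolP (j \in calls S N); last exact: measurable_cst.
  apply: measurable_funM => //; apply: measurable_funX.
  have ck := calls_is_call js.
  by apply: (measurable_dual_error Xxs mH (unb ck)) => // w; exact: master_call_dom.
- exact: expR_ge0.
- rewrite sE; apply: le_trans (expR_jensen _ p0 psum) _; rewrite lerD2l.
  by rewrite big_seq [leRHS]big_seq; apply: ler_sum => j ->.
exists m' => //; apply: le_trans hm' _.
have : \sum_(j <- calls S N) p j * (if j \in calls S N then m j else 0) <= \sum_(j <- calls S N)
  p j * expR 1.
  rewrite big_seq [leRHS]big_seq; apply: ler_sum => j js; rewrite js ler_wpM2l//.
  by case: (hm j js).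
rewrite -mulr_suml; set q := \sum_(j <- _) p j in psum *.
have e1 : 1 <= expR 1 :> R by have := expR_ge1Dx (1 : R); lra.
have : 0 <= (1 - q) * (expR 1 - 1) by rewrite mulr_ge0 ?subr_ge0.
lra.
Qed.

(** The 8 in [cert_bias] is the 4 of the sub-Gaussian bound times the 2 of [rho ^ 2 = 2 * DX / nu],
    so the exponent is at most 1. *)
Lemma bias_exp_moment : exists2 m, m <= expR 1 &
  has_mean P (fun w => expR (\sum_(j <- calls S N) c j.1 j.2 / K * zeta j.1 j.2 w)) m.
Proof.
have K0 := cert_K cert.
have [||m hm hmean] := @martingale_exp_moment _ _ _ _ _ _ P _ H S N xs xi u rho sigma Xxs mH unb
  run.2
    master_call_dom (sqrtr_ge0 _) nrm_le_rho (calls S N) (fun k t => c k t / K) sigma0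
      (@calls_is_call _ S N).
- by move=> j /calls_is_call/light.
- exact: calls_pairwise.
exists m => //; apply: le_trans hm _; rewrite ler_expR.
rewrite (sum_calls S N (fun k t => 4 * (c k t / K * rho * sigma) ^+ 2)).
have rho2 : rho ^+ 2 = 2 * DX / nu prx.
  by rewrite sqr_sqrtr// divr_ge0 ?mulr_ge0// ltW// nu_gt0.
have := cert_bias cert; rewrite -[leRHS]mul1r -ler_pdivrMr ?exprn_gt0//.
apply: le_trans; rewrite le_eqVlt; apply/orP; left; apply/eqP.
rewrite mulrAC mulr_sumr; apply: eq_bigr => k _; rewrite mulr_sumr; apply: eq_bigr => t _.
move: (bias_weight S G k.+1 t) => e; rewrite !exprMn rho2; field.
by rewrite !gt_eqF ?nu_gt0.
Qed.

(** The [K] beside [A] pays for the terms in [M ^ 2]. On the event the half-sum of [Y1] and [Y2] is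
    therefore at least [1 + lam], and its exponential is at most the average of [expR Y1] and
    [expR Y2], which needs no independence. That average has mean at most [e], and the 1 in
    [1 + lam] cancels it. *)
Lemma master_tail (lam : R) :
  (P [set w | (A + K + 2 * K * (1 + lam) < G N * gap w)%R] <= (expR (- lam))%:E)%E.
Proof.
have K0 := cert_K cert.
have [m1 hm1 hmean1] := norm_exp_moment; have [m2 hm2 hmean2] := bias_exp_moment.
pose Y1 w := \sum_(j <- calls S N) b j.1 j.2 / K * dlt j.1 j.2 w ^+ 2.
pose Y2 w := \sum_(j <- calls S N) c j.1 j.2 / K * zeta j.1 j.2 w.
have hE : has_mean P (fun w => 1 / 2 * (expR (Y1 w) + expR (Y2 w))) (1 / 2 * (m1 + m2)).
  by apply: has_meanZ; exact: has_meanD.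
set ev := [set w | _].
have mev : measurable ev.
  rewrite -[ev]setTI; have -> : ev = (fun w => G N * gap w) @^-1` `]A + K + 2 * K * (1 + lam),
    +oo[%classic.
    by apply/seteqP; split=> w /=; rewrite in_itv /= andbT.
  have mg : measurable_fun setT (fun w => G N * gap w).
    by apply: measurable_funM => //; exact: measurable_gap.
  by apply: mg => //; exact: measurable_itv.
have fpos w : 0 <= 1 / 2 * (expR (Y1 w) + expR (Y2 w)).
  by rewrite mulr_ge0// addr_ge0// expR_ge0.
have fbig w : ev w -> expR (1 + lam) <= 1 / 2 * (expR (Y1 w) + expR (Y2 w)).
  rewrite /ev /= => hw; have sM : \sum_(j <- calls S N) b j.1 j.2 * Mh pb ^+ 2 <= K.
    by apply: sum_norm_weight_le; rewrite ?sqr_ge0// lerDl sqr_ge0.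
  have YE : \sum_(j <- calls S N) (c j.1 j.2 * zeta j.1 j.2 w + b j.1 j.2 * dlt j.1 j.2 w ^+ 2) =
    K * (Y2 w + Y1 w).
    rewrite /Y1 /Y2 -big_split mulr_sumr /=; apply: eq_bigr => j _; field.
    by rewrite gt_eqF.
  have := sgs_pathwise w; rewrite YE => hp.
  have hY : 1 + lam <= (Y1 w + Y2 w) / 2.
    rewrite -(ler_pM2l K0); move: hw hp sM; lra.
  apply: (@le_trans _ _ (expR ((Y1 w + Y2 w) / 2))); first by rewrite ler_expR.
  have -> : (Y1 w + Y2 w) / 2 = Y1 w / 2 + Y2 w / 2 by rewrite mulrDl.
  have e1 : expR (Y1 w) = expR (Y1 w / 2) ^+ 2 by rewrite -expRM_natl; congr expR; field.
  have e2 : expR (Y2 w) = expR (Y2 w / 2) ^+ 2 by rewrite -expRM_natl; congr expR; field.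
  rewrite expRD e1 e2; have := sqr_ge0 (expR (Y1 w / 2) - expR (Y2 w / 2)); lra.
have Pfin : P ev \is a fin_num by exact: fin_num_measure.
have := markov_has_mean hE fpos mev fbig.
rewrite -(fineK Pfin) -EFinM !lee_fin expRN expRD => h.
have ep := expR_gt0 lam; have e1 := expR_gt0 (1 : R).
rewrite -[leRHS]mul1r ler_pdivlMr// -(ler_pM2l e1); lra.
Qed.

End light_tail.

End master.

Section certified.
Variables (R : realType) (n : nat) (pb : problem R n) (prx : prox_function pb).
Variables (DX sigma : R) (S : schedule R) (N : nat) (G : nat -> R) (A K : R).
Hypothesis DX_bound : forall x y, dom pb x -> dom pb y -> bregman prx x y <= DX.
Hypothesis cert : certificate prx DX sigma S N G A K.

Lemma certificate_expectation eps : A + K <= G N * eps ->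
  finds_stochastic_solution prx sigma S N eps.
Proof.
move=> hAK d d' Omega P Xi H x0 xi u Xx0 mH unb var run.
have [xs xs_min] := optimum_exists pb.
split.
  split; first exact: measurable_xbar.
  by move=> w; exact: (xbar_dom cert Xx0 run).
have [m hm hmean] := master_expectation DX_bound cert Xx0 mH unb var run xs_min.
have G0 := cert_GN cert.
have [_ hI] := has_meanZ (G N)^-1 hmean.
rewrite unlock (Psi_opt_argmin xs_min).
have GN0 : G N != 0 by rewrite gt_eqF.
under eq_integral do rewrite -[X in X%:E](mulKf GN0).
rewrite hI lee_fin mulrC ler_pdivrMr// mulrC.
exact: le_trans hm hAK.
Qed.

(** The tail bound is not strict but the required probability bound is, hence the strict
    [expR (- lam) < Lam]. *)
Lemma certificate_probability eps Lam lam : 0 < sigma ->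
  A + K + 2 * K * (1 + lam) <= G N * eps -> expR (- lam) < Lam ->
  finds_stochastic_prob_solution prx sigma S N eps Lam.
Proof.
move=> sg0 hAK hlam d d' Omega P Xi H x0 xi u Xx0 mH unb var light run.
have [xs xs_min] := optimum_exists pb.
split.
  split; first exact: measurable_xbar.
  by move=> w; exact: (xbar_dom cert Xx0 run).
have G0 := cert_GN cert.
have ht := master_tail DX_bound cert Xx0 mH unb run xs_min sg0 light lam.
rewrite (Psi_opt_argmin xs_min).
have mg := measurable_gap cert Xx0 run xs.
set gap := (fun w => _ - _) in mg.
have mgood : measurable [set w | gap w <= eps].
  rewrite -[X in measurable X]setTI.
  have -> : [set w | gap w <= eps] = gap @^-1` `]-oo, eps]%classic.
    by apply/seteqP; split=> w /=; rewrite in_itv.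
  by apply: mg => //; exact: measurable_itv.
have mev : measurable [set w | A + K + 2 * K * (1 + lam) < G N * gap w].
  rewrite -[X in measurable X]setTI.
  have -> : [set w | A + K + 2 * K * (1 + lam) < G N * gap w] =
     (fun w => G N * gap w) @^-1` `]A + K + 2 * K * (1 + lam), +oo[%classic.
    by apply/seteqP; split=> w /=; rewrite in_itv /= andbT.
  have mGg : measurable_fun setT (fun w => G N * gap w) by exact: measurable_funM.
  by apply: mGg => //; exact: measurable_itv.
have hsub : (P (~` [set w | (gap w <= eps)%R]) <= (expR (- lam))%:E)%E.
  apply: le_trans ht; apply: le_measure; rewrite ?inE//; first exact: measurableC.
  move=> w /= /negP; rewrite -ltNge => h; apply: le_lt_trans hAK _.
  by rewrite ltr_pM2l.
move: hsub; rewrite probability_setC//.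
have Pfin : P [set w | gap w <= eps] \is a fin_num by exact: fin_num_measure.
rewrite -[X in (_ < X)%E](fineK Pfin) -[X in (_ - X)%E](fineK Pfin) -EFinB lee_fin lte_fin; lra.
Qed.

End certified.

Section ceil_nat.
Variable R : realType.
Implicit Types x y : R.

Lemma ceil_nat_ge x : 0 < x -> x <= (ceil_nat x)%:R.
Proof.
move=> x0; have c0 : 0 <= Num.ceil x by rewrite ceil_ge0; lra.
rewrite /ceil_nat -[_%:R]/((absz (Num.ceil x))%:Z%:~R) gez0_abs//; exact: ceil_ge.
Qed.

Lemma ceil_nat_lt x : 0 < x -> (ceil_nat x)%:R < x + 1.
Proof.
move=> x0; have c0 : 0 <= Num.ceil x by rewrite ceil_ge0; lra.
rewrite /ceil_nat -[_%:R]/((absz (Num.ceil x))%:Z%:~R) gez0_abs//.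
by have := ceilB1_lt x; rewrite rmorphB /=; lra.
Qed.

Lemma ceil_nat_gt0 x : 0 < x -> (0 < ceil_nat x)%N.
Proof. by move=> x0; rewrite -(ltr0n R); exact: lt_le_trans (ceil_nat_ge x0). Qed.

Lemma ceil_nat_le x y : 0 < x -> x <= y -> (ceil_nat x <= ceil_nat y)%N.
Proof.
move=> x0 xy; have y0 := lt_le_trans x0 xy.
rewrite -ltnS -(ltr_nat R) -natr1.
by apply: lt_le_trans (ceil_nat_lt x0) _; rewrite lerD2r (le_trans xy)// ceil_nat_ge.
Qed.

End ceil_nat.

(** * Sums of the weights over one inner loop *)

Section weight_sums.
Variables (R : realType) (n : nat) (pb : problem R n) (prx : prox_function pb).
Variables (S : schedule R) (G : nat -> R) (k : nat).
Hypotheses (T0 : (0 < T_ S k)%N) (beta0 : 0 < beta_ S k) (W0 : 0 <= G k * gamma_ S k).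
Local Notation T := (T_ S k).
Local Notation W := (G k * gamma_ S k).

Let Tr : 1 <= T%:R :> R. Proof. by rewrite ler1n. Qed.

Let wE : inner_weight S k = T%:R * (T%:R + 3) / 2.
Proof. by rewrite /inner_weight natrD. Qed.

Let w0 : 0 < inner_weight S k.
Proof. by have T1 := Tr; rewrite wE divr_gt0// mulr_gt0//; lra. Qed.

(** The ratio [t.+2 / t.+1] is at most 2, so all [T] terms obey the same bound. *)
Lemma sum_norm_weight : \sum_(t < T) norm_weight prx S G k t <= 8 * W / (nu prx * beta_ S k * T%:R).
Proof.
have T1 := Tr; have nb0 : 0 < nu prx * beta_ S k by rewrite mulr_gt0// nu_gt0.
apply: (@le_trans _ _ (\sum_(t < T) 4 * W / (nu prx * beta_ S k * inner_weight S k))).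
  apply: ler_sum => t _; rewrite /norm_weight /bias_weight.
  have t1 : 0 < t.+1%:R :> R by rewrite ltr0n.
  have t2 : t.+2%:R = t.+1%:R + 1 :> R by rewrite natr1.
  have t11 : 1 <= t.+1%:R :> R by rewrite ler1n.
  have -> : 2 * (W / inner_weight S k * t.+2%:R) / (nu prx * beta_ S k * t.+1%:R) =
     4 * W / (nu prx * beta_ S k * inner_weight S k) * (t.+2%:R / (2 * t.+1%:R)).
    move: (inner_weight S k) w0 => w w_0; field.
    by rewrite !gt_eqF// nu_gt0.
  apply: ler_piMr; last first.
    rewrite ler_pdivrMr ?mulr_gt0// t2; lra.
  apply: divr_ge0; first exact: mulr_ge0.
  by apply: mulr_ge0; exact: ltW.
rewrite sumr_const card_ord -[_ *+ T]mulr_natr.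
have -> : 4 * W / (nu prx * beta_ S k * inner_weight S k) * T%:R =
  8 * W / (nu prx * beta_ S k * (T%:R + 3)).
  rewrite wE; field; rewrite !gt_eqF ?nu_gt0//; lra.
apply: ler_wpM2l; first exact: mulr_ge0.
have Tp : 0 < T%:R :> R by lra.
have Tp3 : 0 < T%:R + 3 :> R by lra.
rewrite lef_pV2 ?posrE; try exact: mulr_gt0.
by apply: ler_wpM2l; [exact: ltW|lra].
Qed.

(** One factor [t.+2] is bounded by [T + 1]; the other sums to the inner weight. *)
Lemma sum_bias_weight_sqr : \sum_(t < T) bias_weight S G k t ^+ 2 <= 2 * W ^+ 2 / T%:R.
Proof.
have T1 := Tr; have sumt : \sum_(t < T) t.+2%:R = inner_weight S k.
  rewrite /inner_weight; elim: T => [|m IH]; first by rewrite big_ord0 !mul0r.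
  by rewrite big_ord_recr /= IH !natrD -!natr1; field.
apply: (@le_trans _ _ (\sum_(t < T) (W / inner_weight S k) ^+ 2 * (T%:R + 1) * t.+2%:R)).
  apply: ler_sum => t _; rewrite /bias_weight exprMn -[leRHS]mulrA.
  apply: ler_wpM2l; first exact: sqr_ge0.
  by rewrite [leLHS]expr2; apply: ler_wpM2r => //; rewrite natr1 ler_nat ltnS.
rewrite -mulr_sumr sumt.
have -> : (W / inner_weight S k) ^+ 2 * (T%:R + 1) * inner_weight S k = 2 * W ^+ 2 * ((T%:R + 1)
  / (T%:R * (T%:R + 3))).
  rewrite wE; field; rewrite !gt_eqF//; lra.
apply: ler_wpM2l; first by rewrite mulr_ge0 ?sqr_ge0.
have Tp : 0 < T%:R :> R by lra.
have Tp3 : 0 < T%:R + 3 :> R by lra.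
by rewrite ler_pdivrMr ?mulr_gt0// mulrA mulVf ?mul1r ?gt_eqF//; lra.
Qed.

End weight_sums.

(** * The two parameter choices *)

Lemma abel_nonincreasing (R : realFieldType) (a V : nat -> R) (D : R) (N : nat) :
  (forall k, 0 <= a k) -> (forall k, a k.+1 <= a k) ->
  (forall k, (k <= N)%N -> 0 <= V k <= D) ->
  \sum_(k < N) a k * (V k - V k.+1) <= a 0%N * D.
Proof.
move=> a0 am hV.
suff h m : (m <= N)%N -> \sum_(k < m) a k * (V k - V k.+1) + a m * V m <= a 0%N * D.
  have := h N (leqnn N); have /andP[VN _] := hV N (leqnn N).
  by have := mulr_ge0 (a0 N) VN; lra.
elim: m => [_|m IH mN].
  by rewrite big_ord0 add0r ler_wpM2l//; case/andP: (hV 0%N (leq0n N)).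
rewrite big_ord_recr /=; have := IH (ltnW mN); have /andP[Vm _] := hV m.+1 mN.
by have := ler_wpM2r Vm (am m); lra.
Qed.

(** Here summation by parts leaves the last coefficient instead of the first. For the second
    parameter choice it grows like [N], which is offset by a [G N] of order [N ^ 3]. *)
Lemma abel_nondecreasing (R : realFieldType) (a V : nat -> R) (D : R) (N : nat) :
  (forall k, 0 <= a k) -> (forall k, a k <= a k.+1) ->
  (forall k, (k <= N.+1)%N -> 0 <= V k <= D) ->
  \sum_(k < N.+1) a k * (V k - V k.+1) <= a N * D.
Proof.
move=> a0 am hV.
suff h m : (m <= N)%N -> \sum_(k < m.+1) a k * (V k - V k.+1) <= a m * (D - V m.+1).
  have := h N (leqnn N); have /andP[VN _] := hV N.+1 (leqnn _).
  by have := mulr_ge0 (a0 N) VN; lra.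
elim: m => [_|m IH mN].
  by rewrite big_ord1 ler_wpM2l// lerD2r; case/andP: (hV 0%N (leq0n _)).
rewrite big_ord_recr /=; have := IH (ltnW mN); have /andP[_ Vm] := hV m.+1 (leqW mN).
have Dm : 0 <= D - V m.+1 by rewrite subr_ge0.
by have := ler_wpM2r Dm (am m); lra.
Qed.

Lemma natrS1 (R : pzRingType) m : m.+1%:R = m%:R + 1 :> R.
Proof. by rewrite natr1. Qed.

Lemma natrS2 (R : pzRingType) m : m.+2%:R = m%:R + 2 :> R.
Proof. by rewrite -addn2 natrD. Qed.

Section schedules.
Variables (R : realType) (n : nat) (pb : problem R n) (prx : prox_function pb).
Variables (DX sigma : R).
Hypotheses (DX0 : 0 < DX) (sigma0 : 0 <= sigma).
Local Notation L := (Lf pb).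
Local Notation M := (Mh pb).
Local Notation nu := (nu prx).
Local Notation s := (M ^+ 2 + sigma ^+ 2).
Local Notation D := (L * DX / nu).

Lemma noise_level_gt0 : 0 < s.
Proof. by rewrite ltr_wpDr ?sqr_ge0// exprn_gt0// Mh_gt0. Qed.

Lemma variance_ratio : sigma ^+ 2 / s <= 1.
Proof. by rewrite ler_pdivrMr ?noise_level_gt0// mul1r lerDr sqr_ge0. Qed.

Lemma scale_gt0 : 0 < D.
Proof. by rewrite divr_gt0 ?mulr_gt0 ?Lf_gt0 ?nu_gt0. Qed.

Section fixed_limit.
Variable N : nat.
Hypothesis N0 : (0 < N)%N.
Local Notation S1 := (schedule_N L M nu DX sigma N).

Let batch k : R := N%:R * s * k%:R ^+ 2 / (3 * DX / (4 * nu) * L ^+ 2).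

Let batch_gt0 k : 0 < batch k.+1.
Proof.
have := Lf_gt0 pb; have := nu_gt0 prx; have := noise_level_gt0 => s0 n0 L0.
have Nr : 0 < N%:R :> R by rewrite ltr0n.
have k0 : 0 < k.+1%:R ^+ 2 :> R by rewrite exprn_gt0// ltr0n.
have Dt : 0 < 3 * DX / (4 * nu) by rewrite divr_gt0// mulr_gt0.
apply: divr_gt0; last by apply: mulr_gt0 => //; rewrite exprn_gt0.
by apply: mulr_gt0 => //; exact: mulr_gt0.
Qed.

(** The norm condition holds with [3 * D]; the bias condition asks for [K ^ 2 >= 12 * D ^ 2], hence
    [K = 4 * D]. *)
Lemma certificate_schedule_N :
  certificate prx DX sigma S1 N (fun k => k%:R * k.+1%:R / 2) (3 * D) (4 * D).
Proof.
have L0 := Lf_gt0 pb; have n0 := nu_gt0 prx; have s0 := noise_level_gt0; have D0 := scale_gt0.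
have Nr : 0 < N%:R :> R by rewrite ltr0n.
have T0 k : (0 < k)%N -> (0 < T_ S1 k)%N.
  by case: k => // k _; apply: ceil_nat_gt0; exact: batch_gt0.
have b0 k : (0 < k)%N -> 0 < beta_ S1 k.
  by move=> k0; rewrite /= divr_gt0 ?mulr_gt0 ?ltr0n.
have WE k : (fun k => k%:R * k.+1%:R / 2) k.+1 * gamma_ S1 k.+1 = k.+1%:R :> R.
  by rewrite /=; field; rewrite -?natr1; have := ler0n R k; lra.
have Tge k : batch k.+1 <= (T_ S1 k.+1)%:R by apply: ceil_nat_ge; exact: batch_gt0.
have TI k : (T_ S1 k.+1)%:R^-1 <= (batch k.+1)^-1.
  by rewrite lef_pV2 ?posrE ?ltr0n ?T0//; exact: batch_gt0.
split.
- move=> k /andP[k0 _]; rewrite /= divr_ge0//= ler_pdivrMr ?ltr0n// mul1r.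
  by rewrite ler_nat.
- by move=> k /andP[k0 _]; exact: b0.
- by move=> k /andP[k0 _]; exact: T0.
- move=> [//|k] _ /=.
  have -> : nu * (2 * L / (nu * k.+1%:R)) = 2 * L / k.+1%:R.
    by field; rewrite !gt_eqF// ltr0n.
  rewrite mulrA [L * 2]mulrC ler_wpM2l ?mulr_ge0 ?(ltW L0)//.
  by rewrite lef_pV2 ?posrE ?ltr0n// ler_nat.
- by rewrite !mul0r.
- move=> k _; split; first by rewrite divr_ge0// mulr_ge0.
  rewrite /= -!natr1; have := ler0n R k; move: (k%:R) => x x0; field; lra.
- by rewrite divr_gt0// mulr_gt0 ?ltr0n.
- by rewrite mulr_gt0.
- move=> V hV.
  (* The outer weight times [beta] is the constant [2 * L / nu], and
     [(T + 1) * (T + 2) / (T * (T + 3))] is [1 + 2 / (T * (T + 3))]. This decreases as [T_k] grows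
     and is at most 3/2, whence [A = 3 * D]. *)
  pose a k := 2 * L / nu * (1 + 2 / ((T_ S1 k.+1)%:R * ((T_ S1 k.+1)%:R + 3))).
  have Tp k : 1 <= (T_ S1 k.+1)%:R :> R by rewrite ler1n T0.
  have aE k : (fun k => k%:R * k.+1%:R / 2) k.+1 * gamma_ S1 k.+1 / inner_weight S1 k.+1 *
      (beta_ S1 k.+1 * ((T_ S1 k.+1).+1%:R * (T_ S1 k.+1).+2%:R / 2) * (V k - V k.+1)) =
      a k * (V k - V k.+1).
    rewrite WE /a /inner_weight natrD (natrS2 _ (T_ S1 k.+1)) (natrS1 _ (T_ S1 k.+1)) mulrA;
      congr (_ * _).
    have := Tp k; rewrite /beta_ /schedule_N -/S1.
    have : 0 < k.+1%:R :> R by rewrite ltr0n.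
    move: ((T_ S1 k.+1)%:R) (k.+1%:R) => t x x0 t1. field.
    by rewrite !gt_eqF//; lra.
  have c0 : 0 <= 2 * L / nu by rewrite divr_ge0 ?mulr_ge0// ltW.
  have den k : 0 < (T_ S1 k.+1)%:R * ((T_ S1 k.+1)%:R + 3) :> R.
    by have := Tp k => h; rewrite mulr_gt0//; lra.
  under eq_bigr do rewrite aE.
  have h : \sum_(k < N) a k * (V k - V k.+1) <= a 0%N * DX.
    apply: abel_nonincreasing => // k; rewrite /a.
      by rewrite mulr_ge0// addr_ge0// divr_ge0// ltW.
    have Tm : (T_ S1 k.+1 <= T_ S1 k.+2)%N.
      apply: ceil_nat_le; first exact: batch_gt0.
      apply: ler_wpM2r.
        by rewrite invr_ge0 mulr_ge0 ?sqr_ge0// divr_ge0 ?mulr_ge0 ?ltW.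
      apply: ler_wpM2l; first by rewrite mulr_ge0 ?ltW.
      by rewrite ler_sqr ?nnegrE// ler_nat.
    have Tm' : (T_ S1 k.+1)%:R <= (T_ S1 k.+2)%:R :> R by rewrite ler_nat.
    apply: ler_wpM2l => //; rewrite lerD2l; apply: ler_wpM2l => //.
    rewrite lef_pV2 ?posrE//; have := Tp k; move: Tm'.
    by move: ((T_ S1 k.+1)%:R) ((T_ S1 k.+2)%:R) => t t' h1 h2; nra.
  apply: le_trans h _.
  have -> : 3 * D = 2 * L / nu * (1 + 2 / (1 * (1 + 3))) * DX by field; rewrite gt_eqF.
  apply: ler_wpM2r; first exact: ltW.
  apply: ler_wpM2l => //; rewrite lerD2l; apply: ler_wpM2l => //.
  have d0 := den 0%N; have d4 : 0 < 1 * (1 + 3) :> R by lra.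
  rewrite lef_pV2 ?posrE//.
  by have := Tp 0%N; move: ((T_ S1 1)%:R) => t t1; nra.
- have step (k : 'I_N) : \sum_(t < T_ S1 k.+1) norm_weight prx S1 (fun k => k%:R * k.+1%:R / 2)
  k.+1 t * s <= 3 * D / N%:R.
    have h := @sum_norm_weight _ _ _ prx S1 (fun k => k%:R * k.+1%:R / 2) k.+1 (T0 _ (ltn0Sn k))
      (b0 _ (ltn0Sn k)).
    rewrite WE in h.
    have kp : 0 < k.+1%:R :> R by rewrite ltr0n.
    rewrite -mulr_suml; apply: le_trans (ler_wpM2r (ltW s0) (h (ltW kp))) _.
    have -> : 8 * k.+1%:R / (nu * beta_ S1 k.+1 * (T_ S1 k.+1)%:R) * s =
       4 * k.+1%:R ^+ 2 * s / L * (T_ S1 k.+1)%:R^-1.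
      rewrite /beta_ /schedule_N -/S1; have : 0 < (T_ S1 k.+1)%:R :> R by rewrite ltr0n T0.
      move: ((T_ S1 k.+1)%:R) (k.+1%:R) kp s => t x x0 s' t0; field.
      by rewrite !gt_eqF.
    apply: le_trans (ler_wpM2l _ (TI k)) _.
      by rewrite divr_ge0 ?mulr_ge0 ?sqr_ge0// ltW.
    rewrite /batch; move: (k.+1%:R) kp s0 => x x0; move: s => s' s0'.
    rewrite le_eqVlt; apply/orP; left; apply/eqP; field.
    by rewrite !gt_eqF.
  apply: (@le_trans _ _ (\sum_(k < N) 3 * D / N%:R)); first by apply: ler_sum => k _; exact: step.
  rewrite sumr_const card_ord -[_ *+ N]mulr_natr divfK ?gt_eqF//; lra.
- have step (k : 'I_N) : \sum_(t < T_ S1 k.+1) bias_weight S1 (fun k => k%:R * k.+1%:R / 2) k.+1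
  t ^+ 2 <=
     3 / 2 * DX * L ^+ 2 / (nu * s * N%:R).
    have := @sum_bias_weight_sqr _ S1 (fun k => k%:R * k.+1%:R / 2) k.+1 (T0 _ (ltn0Sn k)).
    rewrite WE => h; apply: le_trans h _.
    have kp : 0 < k.+1%:R :> R by rewrite ltr0n.
    apply: le_trans (ler_wpM2l _ (TI k)) _; first by rewrite mulr_ge0// sqr_ge0.
    rewrite /batch; move: (k.+1%:R) kp s0 => x x0; move: s => s' s0'.
    rewrite le_eqVlt; apply/orP; left; apply/eqP; field.
    by rewrite !gt_eqF.
  apply: (@le_trans _ _ (8 * DX / nu * sigma ^+ 2 * \sum_(k < N) 3 / 2 * DX * L ^+ 2 / (nu * s *
    N%:R))).
    apply: ler_wpM2l; first by rewrite mulr_ge0 ?sqr_ge0// divr_ge0 ?mulr_ge0 ?ltW.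
    by apply: ler_sum => k _; exact: step.
  rewrite sumr_const card_ord -[_ *+ N]mulr_natr.
  have -> : 8 * DX / nu * sigma ^+ 2 * (3 / 2 * DX * L ^+ 2 / (nu * s * N%:R) * N%:R) =
      12 * D ^+ 2 * (sigma ^+ 2 / s).
    by move: s s0 => s' s0'; field; rewrite !gt_eqF.
  have := ler_wpM2l (sqr_ge0 D) variance_ratio; rewrite mulr1 => h.
  by have := sqr_ge0 D; rewrite exprMn; lra.
Qed.

Lemma subgrad_evals_schedule_N :
  (subgrad_evals S1 N)%:R <= N%:R + 4 / 3 * s * N%:R ^+ 4 * nu / (DX * L ^+ 2) :> R.
Proof.
have L0 := Lf_gt0 pb; have n0 := nu_gt0 prx; have s0 := noise_level_gt0.
have Nr : 0 < N%:R :> R by rewrite ltr0n.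
rewrite /subgrad_evals natr_sum.
apply: (@le_trans _ _ (\sum_(1 <= k < N.+1) (1 + 4 / 3 * s * N%:R ^+ 3 * nu / (DX * L ^+ 2)))).
  rewrite big_nat_cond [leRHS]big_nat_cond; apply: ler_sum => -[//|k] /andP[/andP[_ kN] _].
  apply: ltW; apply: lt_le_trans (ceil_nat_lt (batch_gt0 k)) _.
  rewrite addrC lerD2l /batch.
  have -> : 4 / 3 * s * N%:R ^+ 3 * nu / (DX * L ^+ 2) = N%:R * s * N%:R ^+ 2 / (3 * DX / (4 *
    nu) * L ^+ 2).
    by move: s => s'; field; rewrite !gt_eqF.
  apply: ler_wpM2r.
    by rewrite invr_ge0 mulr_ge0 ?sqr_ge0// divr_ge0 ?mulr_ge0 ?ltW.
  apply: ler_wpM2l; first by rewrite mulr_ge0 ?ltW.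
  by rewrite ler_sqr ?nnegrE// ler_nat.
rewrite sumr_const_nat subSS subn0 -[_ *+ N]mulr_natr le_eqVlt; apply/orP; left; apply/eqP.
by move: s => s'; field; rewrite !gt_eqF.
Qed.

End fixed_limit.
End schedules.

Lemma prod_pE (R : realType) t : prod_p R t = 2 / (t.+1%:R * t.+2%:R).
Proof.
elim: t => [|t IH] /=; first by rewrite mul1r divff.
rewrite IH /step_p (natrS1 _ t.+2) (natrS2 _ t) (natrS1 _ t).
have := ler0n R t; move: (t%:R) => x x0; field; lra.
Qed.

(** * The parameter choice independent of the iteration limit *)

Section bounded_schedule.
Variables (R : realType) (n : nat) (pb : problem R n) (prx : prox_function pb).
Variables (DX sigma : R).
Hypotheses (DX0 : 0 < DX).
Local Notation L := (Lf pb).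
Local Notation M := (Mh pb).
Local Notation nu := (nu prx).
Local Notation s := (M ^+ 2 + sigma ^+ 2).
Local Notation D := (L * DX / nu).
Local Notation S2 := (schedule_bounded L M nu DX sigma).

Let batch k : R := s * k.+1%:R ^+ 3 / (81 * DX / (32 * nu) * L ^+ 2).

Let batch_gt0 k : 0 < batch k.
Proof.
have := Lf_gt0 pb; have := nu_gt0 prx; have := noise_level_gt0 pb sigma => s0 n0 L0.
have k0 : 0 < k.+1%:R ^+ 3 :> R by rewrite exprn_gt0// ltr0n.
have Dt : 0 < 81 * DX / (32 * nu) by rewrite divr_gt0// mulr_gt0.
apply: divr_gt0; last by apply: mulr_gt0 => //; rewrite exprn_gt0.
exact: mulr_gt0.
Qed.

Let T_ge1 k : 1 <= (T_ S2 k)%:R :> R.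
Proof. by rewrite ler1n; apply: ceil_nat_gt0; exact: batch_gt0. Qed.

(** As [T_k >= 1], [P_(T_k) <= P_1 = 1/3], so [beta_k] keeps at least 2/3 of its leading factor. *)
Let beta_bounds k : 0 < beta_ S2 k /\ 3 * L / k.+1%:R <= nu * beta_ S2 k.
Proof.
have L0 := Lf_gt0 pb; have n0 := nu_gt0 prx.
have kp : 0 < k.+1%:R :> R by rewrite ltr0n.
have -> : beta_ S2 k = 9 * L * (1 - prod_p R (T_ S2 k)) / (2 * nu * k.+1%:R) by [].
have p13 : prod_p R (T_ S2 k) <= 1 / 3.
  rewrite prod_pE (natrS2 _ (T_ S2 k)) (natrS1 _ (T_ S2 k)).
  have := T_ge1 k; move: ((T_ S2 k)%:R) => t t1.
  by rewrite ler_pdivrMr; [nra|apply: mulr_gt0; lra].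
have k1 : 0 < k.+1%:R^-1 :> R by rewrite invr_gt0.
split.
  by apply: divr_gt0; rewrite mulr_gt0 ?mulr_gt0//; lra.
have -> : nu * (9 * L * (1 - prod_p R (T_ S2 k)) / (2 * nu * k.+1%:R)) =
   9 / 2 * L * (1 - prod_p R (T_ S2 k)) / k.+1%:R.
  by move: (prod_p R (T_ S2 k)) (k.+1%:R) kp {k1 p13} => p x x0; field; rewrite !gt_eqF.
apply: ler_wpM2r; first exact: ltW.
by have := ler_wpM2l (ltW L0) p13; lra.
Qed.

Section fixed_limit.
Variable N : nat.
Hypothesis N0 : (0 < N)%N.
Local Notation G := (fun k : nat => k%:R * k.+1%:R * k.+2%:R / 6 : R).

(** The computed constants are 9/4 for [A], 27/8 for the norms and 81/8 for the square of the bias;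
    they are rounded up to those of the first choice, times [N]. *)
Lemma certificate_schedule_bounded :
  certificate prx DX sigma S2 N G (3 * N%:R * D) (4 * N%:R * D).
Proof.
have L0 := Lf_gt0 pb; have n0 := nu_gt0 prx; have s0 := noise_level_gt0 pb sigma; have D0 :=
  scale_gt0 prx DX0.
have Nr : 0 < N%:R :> R by rewrite ltr0n.
have T0 k : (0 < T_ S2 k)%N by apply: ceil_nat_gt0; exact: batch_gt0.
have b0 k : 0 < beta_ S2 k by case: (beta_bounds k).
have kp k : 0 < k.+1%:R :> R by rewrite ltr0n.
have WE k : G k.+1 * gamma_ S2 k.+1 = k.+1%:R * k.+2%:R / 2.
  rewrite /= (natrS2 _ k.+1) (_ : (k.+1 + 2)%:R = k.+1%:R + 2) ?natrD// (natrS1 _ k.+1).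
  by have := kp k; move: (k.+1%:R) => x x0; field; lra.
have W0 k : 0 <= G k.+1 * gamma_ S2 k.+1 by rewrite WE divr_ge0// mulr_ge0.
have TI k : (T_ S2 k)%:R^-1 <= (batch k)^-1.
  rewrite lef_pV2 ?posrE ?ltr0n ?T0 ?batch_gt0//.
  by apply: ceil_nat_ge; exact: batch_gt0.
split.
- move=> k /andP[k0 _]; rewrite /= divr_ge0//= ler_pdivrMr ?ltr0n ?addn2// mul1r.
  by rewrite ler_nat !ltnS.
- by [].
- by [].
- move=> [//|k] _; have [_] := beta_bounds k.+1; apply: le_trans.
  rewrite /= mulrA [L * 3]mulrC ler_wpM2l ?mulr_ge0 ?(ltW L0)//.
  by rewrite lef_pV2 ?posrE ?ltr0n// ler_nat addn2 ltnS.
- by rewrite !mul0r.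
- move=> k _; split; first by rewrite divr_ge0// !mulr_ge0.
  rewrite /= (natrS2 _ k.+1) (_ : (k.+1 + 2)%:R = k.+1%:R + 2) ?natrD// (natrS1 _ k.+1) (natrS1 _
    k).
  have := ler0n R k; move: (k%:R) => x x0; field; lra.
- by rewrite divr_gt0// !mulr_gt0 ?ltr0n.
- by apply: mulr_gt0 => //; exact: mulr_gt0.
- case: (N) N0 => // N' _ V hV.
  (* The factor [1 - P_T = T * (T + 3) / ((T + 1) * (T + 2))] in [beta] cancels the dependence on
     [T_k], so these coefficients are monotone whatever the batch sizes. *)
  pose a k := 9 / 4 * L / nu * k.+1%:R.
  have aE k : G k.+1 * gamma_ S2 k.+1 / inner_weight S2 k.+1 *
      (beta_ S2 k.+1 * ((T_ S2 k.+1).+1%:R * (T_ S2 k.+1).+2%:R / 2) * (V k - V k.+1)) =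
      a k * (V k - V k.+1).
    rewrite WE /a /inner_weight natrD.
    have -> : beta_ S2 k.+1 = 9 * L * (1 - prod_p R (T_ S2 k.+1)) / (2 * nu * k.+2%:R) by [].
    rewrite prod_pE (natrS2 _ (T_ S2 k.+1)) (natrS1 _ (T_ S2 k.+1)) mulrA; congr (_ * _).
    have := kp k.+1; have := T_ge1 k.+1.
    move: ((T_ S2 k.+1)%:R) (k.+2%:R) => t x t1 x0; field.
    by rewrite !gt_eqF//; lra.
  have c0 : 0 <= 9 / 4 * L / nu by rewrite divr_ge0 ?mulr_ge0// ltW.
  under eq_bigr do rewrite aE.
  have h : \sum_(k < N'.+1) a k * (V k - V k.+1) <= a N' * DX.
    apply: abel_nondecreasing => // k; rewrite /a; first exact: mulr_ge0.
    by apply: ler_wpM2l => //; rewrite ler_nat.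
  apply: le_trans h _; rewrite /a.
  have := mulr_gt0 D0 (kp N'); have -> : 9 / 4 * L / nu * N'.+1%:R * DX = 9 / 4 * (D * N'.+1%:R)
    by ring.
  lra.
- have step (k : 'I_N) : \sum_(t < T_ S2 k.+1) norm_weight prx S2 G k.+1 t * s <= 27 / 8 * D.
    have h := @sum_norm_weight _ _ _ prx S2 G k.+1 (T0 _) (b0 _) (W0 k).
    rewrite WE in h; rewrite -mulr_suml; apply: le_trans (ler_wpM2r (ltW s0) h) _.
    have [_ hb] := beta_bounds k.+1.
    have kp2 := kp k.+1; have kp1 := kp k.
    have l0 : 0 < 3 * L / k.+2%:R by rewrite divr_gt0// mulr_gt0.
    have nb0 := lt_le_trans l0 hb.
    have ib : (nu * beta_ S2 k.+1)^-1 <= k.+2%:R / (3 * L).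
      by rewrite -[leRHS]invrK lef_pV2 ?posrE ?invr_gt0// ?invf_div// divr_gt0// mulr_gt0.
    have w0 : 0 <= 8 * (k.+1%:R * k.+2%:R / 2) * s :> R.
      by rewrite mulr_ge0 ?(ltW s0)// mulr_ge0// divr_ge0// mulr_ge0.
    have -> : 8 * (k.+1%:R * k.+2%:R / 2) / (nu * beta_ S2 k.+1 * (T_ S2 k.+1)%:R) * s =
       8 * (k.+1%:R * k.+2%:R / 2) * s * ((nu * beta_ S2 k.+1)^-1 * (T_ S2 k.+1)%:R^-1).
      by rewrite invfM; ring.
    have ibT : (nu * beta_ S2 k.+1)^-1 * (T_ S2 k.+1)%:R^-1 <= k.+2%:R / (3 * L) * (batch k.+1)^-1.
      by apply: ler_pM => //; rewrite ?invr_ge0 ?(ltW nb0)//.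
    apply: le_trans (ler_wpM2l w0 ibT) _.
    have -> : 8 * (k.+1%:R * k.+2%:R / 2) * s * (k.+2%:R / (3 * L) * (batch k.+1)^-1) =
       27 / 8 * D * (k.+1%:R / k.+2%:R).
      rewrite /batch; move: (k.+1%:R) (k.+2%:R) kp1 kp2 s0 => y x y0 x0; move: s => s' s0'.
      by field; rewrite !gt_eqF.
    rewrite ler_piMr//; first by rewrite mulr_ge0// ltW.
    by rewrite ler_pdivrMr// mul1r ler_nat.
  apply: (@le_trans _ _ (\sum_(k < N) 27 / 8 * D)); first by apply: ler_sum => k _; exact: step.
  rewrite sumr_const card_ord -[_ *+ N]mulr_natr.
  by have := mulr_gt0 D0 Nr; lra.
- have step (k : 'I_N) : \sum_(t < T_ S2 k.+1) bias_weight S2 G k.+1 t ^+ 2 <=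
     81 / 64 * DX * L ^+ 2 / (nu * s) * N%:R.
    have := @sum_bias_weight_sqr _ S2 G k.+1 (T0 _).
    rewrite WE => h; apply: le_trans h _.
    have kp2 := kp k.+1; have kp1 := kp k.
    apply: le_trans (ler_wpM2l _ (TI k.+1)) _; first by rewrite mulr_ge0// sqr_ge0.
    have -> : 2 * (k.+1%:R * k.+2%:R / 2) ^+ 2 * (batch k.+1)^-1 =
      81 / 64 * DX * L ^+ 2 / (nu * s) * (k.+1%:R * (k.+1%:R / k.+2%:R)).
      rewrite /batch; move: (k.+1%:R) (k.+2%:R) kp1 kp2 s0 => y x y0 x0; move: s => s' s0'.
      by field; rewrite !gt_eqF.
    apply: ler_wpM2l.
      apply: divr_ge0; last by rewrite mulr_ge0// ltW.
      by rewrite mulr_ge0 ?sqr_ge0// mulr_ge0// ltW.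
    apply: (@le_trans _ _ (k.+1%:R * 1)); last by rewrite mulr1 ler_nat.
    by apply: ler_wpM2l => //; rewrite ler_pdivrMr// mul1r ler_nat.
  apply: (@le_trans _ _ (8 * DX / nu * sigma ^+ 2 * \sum_(k < N) 81 / 64 * DX * L ^+ 2 / (nu * s)
    * N%:R)).
    apply: ler_wpM2l; first by rewrite mulr_ge0 ?sqr_ge0// divr_ge0 ?mulr_ge0 ?ltW.
    by apply: ler_sum => k _; exact: step.
  rewrite sumr_const card_ord -[_ *+ N]mulr_natr.
  have -> : 8 * DX / nu * sigma ^+ 2 * (81 / 64 * DX * L ^+ 2 / (nu * s) * N%:R * N%:R) =
      81 / 8 * (N%:R * D) ^+ 2 * (sigma ^+ 2 / s).
    by move: s s0 => s' s0'; field; rewrite !gt_eqF.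
  have := ler_wpM2l (sqr_ge0 (N%:R * D)) (variance_ratio pb sigma); rewrite mulr1 => h.
  have -> : (4 * N%:R * D) ^+ 2 = 16 * (N%:R * D) ^+ 2 by ring.
  by have := sqr_ge0 (N%:R * D); lra.
Qed.

(** Every [k + 1] is bounded by [2 * N], whose cube turns 32/81 into 256/81. *)
Lemma subgrad_evals_schedule_bounded :
  (subgrad_evals S2 N)%:R <= N%:R + 256 / 81 * s * N%:R ^+ 4 * nu / (DX * L ^+ 2) :> R.
Proof.
have L0 := Lf_gt0 pb; have n0 := nu_gt0 prx; have s0 := noise_level_gt0 pb sigma.
have Nr : 1 <= N%:R :> R by rewrite ler1n.
rewrite /subgrad_evals natr_sum.
apply: (@le_trans _ _ (\sum_(1 <= k < N.+1) (1 + 256 / 81 * s * N%:R ^+ 3 * nu / (DX * L ^+ 2)))).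
  rewrite big_nat_cond [leRHS]big_nat_cond; apply: ler_sum => k /andP[/andP[_ kN] _].
  apply: ltW; apply: lt_le_trans (ceil_nat_lt (batch_gt0 k)) _.
  rewrite addrC lerD2l /batch.
  have -> : 256 / 81 * s * N%:R ^+ 3 * nu / (DX * L ^+ 2) = s * (2 * N%:R) ^+ 3 / (81 * DX / (32
    * nu) * L ^+ 2).
    by move: s => s'; field; rewrite !gt_eqF.
  apply: ler_wpM2r.
    by rewrite invr_ge0 mulr_ge0 ?sqr_ge0// divr_ge0 ?mulr_ge0 ?ltW.
  apply: ler_wpM2l; first exact: ltW.
  rewrite ler_pXn2r ?nnegrE ?mulr_ge0//.
  have : k.+1%:R <= N.+1%:R :> R by rewrite ler_nat.
  by rewrite (natrS1 _ N); lra.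
rewrite sumr_const_nat subSS subn0 -[_ *+ N]mulr_natr le_eqVlt; apply/orP; left; apply/eqP.
by move: s => s'; field; rewrite !gt_eqF.
Qed.

End fixed_limit.
End bounded_schedule.

(** * Complexity bounds *)

Section complexity.
Variables (R : realType) (n : nat) (pb : problem R n) (prx : prox_function pb).
Variables (DX sigma : R).
Hypothesis DX0 : 0 < DX.
Hypothesis DX_bound : forall x y, dom pb x -> dom pb y -> bregman prx x y <= DX.
Local Notation L := (Lf pb).
Local Notation M := (Mh pb).
Local Notation nu := (nu prx).
Local Notation s := (M ^+ 2 + sigma ^+ 2).
Local Notation D := (L * DX / nu).
(** Chosen to exceed [256 / 81 * 15 ^ 4 = 160000], the coefficient of the noise term, where
    [N <= 15 * sqrt (...)]. *)
Local Notation C := (60 ^+ 3 : R).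

(** [r N] is the factor by which the certificates differ, 1 or [N]. It cancels between [A], [K] and
    [G N]. *)
Variables (S : nat -> schedule R) (r : nat -> R) (G : nat -> nat -> R).
Hypothesis S_cert : forall N, (0 < N)%N ->
  certificate prx DX sigma (S N) N (G N) (3 * r N * D) (4 * r N * D).
Hypothesis r_gt0 : forall N, (0 < N)%N -> 0 < r N.
Hypothesis G_ge : forall N, (0 < N)%N -> r N * N%:R ^+ 2 / 6 <= G N N.
Hypothesis S_evals : forall N, (0 < N)%N ->
  (subgrad_evals (S N) N)%:R <= N%:R + 256 / 81 * s * N%:R ^+ 4 * nu / (DX * L ^+ 2) :> R.

(* N is ceil (14 sqrt (...)); the certificates ask for N^2 eps >= 6 (15 + 8 lambda) D,
   where lambda = 2 m, and 6 (15 + 16 m) <= 14 ^ 2 m as m >= 1. *)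
Lemma iteration_limit (eps m : R) : 0 < eps -> eps <= D -> 1 <= m ->
  exists N : nat, [/\ (0 < N)%N,
    N%:R <= 15 * Num.sqrt (L * DX / (nu * eps) * m),
    196 * m * D <= N%:R ^+ 2 * eps &
    (subgrad_evals (S N) N)%:R <= C * (s * DX / (nu * eps ^+ 2) * m ^+ 2
       + Num.sqrt (L * DX / (nu * eps) * m))].
Proof.
move=> e0 eD m1; set x := L * DX / (nu * eps); set q := Num.sqrt _.
have L0 := Lf_gt0 pb; have n0 := nu_gt0 prx; have s0 := noise_level_gt0 pb sigma.
have D0 := scale_gt0 prx DX0.
have m0 : 0 < m by lra.
have xE : x * eps = D by rewrite /x; field; rewrite !gt_eqF.
(* This is the purpose of the threshold [D] on [eps]: it gives [q >= 1], so rounding up [14 * q]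
   stays within [15 * q]. *)
have x1 : 1 <= x by rewrite -(ler_pM2r e0) xE mul1r.
have xm1 : 1 <= x * m by rewrite -[1]mulr1 ler_pM.
have q2 : q ^+ 2 = x * m by rewrite sqr_sqrtr//; lra.
have q1 : 1 <= q by rewrite -[1]sqrtr1 ler_sqrt//; lra.
have q14 : 0 < 14 * q by lra.
pose N := ceil_nat (14 * q); exists N.
have N0 : (0 < N)%N := ceil_nat_gt0 q14.
have Nge : 14 * q <= N%:R := ceil_nat_ge q14.
have Nle : N%:R <= 15 * q by have := ceil_nat_lt q14; rewrite -/N; lra.
have Nr : 0 <= N%:R :> R by [].
split=> //.
- have h : (14 * q) ^+ 2 <= N%:R ^+ 2 by rewrite ler_sqr ?nnegrE//; lra.
  have := ler_wpM2r (ltW e0) h; rewrite exprMn q2 -xE; lra.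
- apply: le_trans (S_evals N0) _.
  have N4 : N%:R ^+ 4 <= (15 * q) ^+ 4 by rewrite ler_pXn2r ?nnegrE//; lra.
  have c0 : 0 <= nu / (DX * L ^+ 2) by rewrite divr_ge0 ?mulr_ge0 ?sqr_ge0// ltW.
  have q4 : (15 * q) ^+ 4 = 15 ^+ 4 * (x * m) ^+ 2 by rewrite exprMn -q2 -exprM.
  have h : s * N%:R ^+ 4 * (nu / (DX * L ^+ 2)) <= 15 ^+ 4 * (s * DX / (nu * eps ^+ 2) * m ^+ 2).
    apply: (@le_trans _ _ (s * (15 ^+ 4 * (x * m) ^+ 2) * (nu / (DX * L ^+ 2)))).
      by apply: ler_wpM2r => //; apply: ler_wpM2l; [exact: ltW|rewrite -q4].
    rewrite /x le_eqVlt; apply/orP; left; apply/eqP.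
    by move: s => s'; field; rewrite !gt_eqF.
  have X0 : 0 <= s * DX / (nu * eps ^+ 2) * m ^+ 2.
    by rewrite mulr_ge0 ?sqr_ge0// divr_ge0 ?mulr_ge0 ?sqr_ge0// ltW.
  have -> : 256 / 81 * s * N%:R ^+ 4 * nu / (DX * L ^+ 2) = 256 / 81 * (s * N%:R ^+ 4 * (nu / (DX
    * L ^+ 2))).
    by rewrite !mulrA.
  move: h X0; set X := s * DX / _ * _; set Y := s * _ * (nu / _) => h X0; lra.
Qed.

Lemma expectation_complexity_certified : expectation_complexity C prx DX sigma S.
Proof.
have D0 := scale_gt0 prx DX0; exists D => // eps e0 eD.
have [N [N0 Nle Nge Nsub]] := iteration_limit e0 eD (lexx 1).
rewrite expr1n !mulr1 in Nle Nge Nsub; exists N; split=> //.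
  by apply: le_trans Nle _; rewrite ler_wpM2r ?sqrtr_ge0//; lra.
apply: (certificate_expectation DX_bound (S_cert N0)).
apply: le_trans (ler_wpM2r (ltW e0) (G_ge N0)).
have := ler_wpM2l (ltW (r_gt0 N0)) Nge.
by have := mulr_gt0 (r_gt0 N0) D0; lra.
Qed.

Lemma probability_complexity_certified : 0 < sigma ->
  probability_complexity C prx DX sigma S.
Proof.
move=> sg0; have D0 := scale_gt0 prx DX0; exists D => // eps e0 eD Lam Lam0 Lam1.
set l := ln (1 / Lam); set m := Num.max 1 l.
have lE : l = - ln Lam by rewrite /l div1r lnV.
have l0 : 0 < l by rewrite lE oppr_gt0 ln_lt0// Lam0.
have m1 : 1 <= m by rewrite le_max lexx.
have lm : l <= m by rewrite le_max lexx orbT.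
have m2 : m ^+ 2 <= Num.max 1 (l ^+ 2).
  rewrite /m; case: (leP 1 l) => h; first by rewrite le_max lexx orbT.
  by rewrite expr1n le_max lexx.
have [N [N0 Nle Nge Nsub]] := iteration_limit e0 eD m1.
exists N; split=> //.
- by apply: le_trans Nle _; rewrite ler_wpM2r ?sqrtr_ge0//; lra.
- apply: le_trans Nsub _; apply: ler_wpM2l; first by rewrite exprn_ge0.
  rewrite lerD2r; apply: ler_wpM2l => //.
  have s0 := noise_level_gt0 pb sigma; have n0 := nu_gt0 prx.
  by rewrite divr_ge0 ?mulr_ge0 ?sqr_ge0// ltW.
(* The factor 2 makes the inequality strict: [2 * m > m >= ln (1 / Lam)]. *)
- apply: (certificate_probability DX_bound (S_cert N0) (lam := 2 * m) sg0).
    apply: le_trans (ler_wpM2r (ltW e0) (G_ge N0)).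
    have := ler_wpM2l (ltW (r_gt0 N0)) Nge.
    have rD := mulr_gt0 (r_gt0 N0) D0.
    by have := ler_wpM2l (ltW rD) m1; lra.
  by rewrite -[ltRHS](lnK (_ : Lam \in Num.pos))// ltr_expR; lra.
Qed.

End complexity.

Theorem corollary4 (R : realType) :
  exists2 C : R, 0 < C &
  forall (n : nat) (pb : problem R n) (prx : prox_function pb) (DX sigma : R),
    0 < DX ->
    (forall x y, dom pb x -> dom pb y -> bregman prx x y <= DX) ->
    0 <= sigma ->
    let S1 := schedule_N (Lf pb) (Mh pb) (nu prx) DX sigma in
    let S2 := fun _ : nat =>
      schedule_bounded (Lf pb) (Mh pb) (nu prx) DX sigma in
    [/\ expectation_complexity C prx DX sigma S1,
        0 < sigma -> probability_complexity C prx DX sigma S1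
      & bounded_set (dom pb) ->
          expectation_complexity C prx DX sigma S2 /\
          (0 < sigma -> probability_complexity C prx DX sigma S2)].
Proof.
exists (60 ^+ 3); first by rewrite exprn_gt0.
move=> n pb prx DX sigma DX0 DXb sg0 S1 S2.
have L0 := Lf_gt0 pb; have n0 := nu_gt0 prx; have s0 := noise_level_gt0 pb sigma.
pose G1 (_ k : nat) : R := k%:R * k.+1%:R / 2.
pose G2 (_ k : nat) : R := k%:R * k.+1%:R * k.+2%:R / 6.
have cert1 N : (0 < N)%N -> certificate prx DX sigma (S1 N) N (G1 N)
    (3 * 1 * (Lf pb * DX / nu prx)) (4 * 1 * (Lf pb * DX / nu prx)).
  by move=> N0; rewrite !mulr1; exact: (certificate_schedule_N prx sigma DX0 N0).
have ge1 N : (0 < N)%N -> 1 * N%:R ^+ 2 / 6 <= G1 N N.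
  rewrite -(ler1n R) /G1 (natrS1 _ N); move: (N%:R) => x x1; nra.
have ge2 N : (0 < N)%N -> N%:R * N%:R ^+ 2 / 6 <= G2 N N.
  rewrite -(ler1n R) /G2 (natrS1 _ N) (natrS2 _ N); move: (N%:R) => x x1.
  by have := mulr_ge0 (_ : 0 <= x) (sqr_ge0 x); nra.
have ev1 N : (0 < N)%N -> (subgrad_evals (S1 N) N)%:R <= N%:R +
    256 / 81 * (Mh pb ^+ 2 + sigma ^+ 2) * N%:R ^+ 4 * nu prx / (DX * Lf pb ^+ 2) :> R.
  move=> N0; apply: le_trans (subgrad_evals_schedule_N prx sigma DX0 N0) _.
  have Z0 : 0 <= (Mh pb ^+ 2 + sigma ^+ 2) * N%:R ^+ 4 * nu prx / (DX * Lf pb ^+ 2).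
    apply: divr_ge0; last by rewrite mulr_ge0 ?sqr_ge0// ltW.
    by apply: mulr_ge0; [apply: mulr_ge0; [exact: ltW|exact: exprn_ge0]|exact: ltW].
  by rewrite lerD2l; move: Z0; lra.
split.
- exact: (expectation_complexity_certified (r := fun=> 1) DX0 DXb cert1 _ ge1 ev1).
- exact: (probability_complexity_certified (r := fun=> 1) DX0 DXb cert1 _ ge1 ev1).
- move=> _.
  have cert2 N := @certificate_schedule_bounded _ _ _ prx DX sigma DX0 N.
  have ev2 N (N0 : (0 < N)%N) := @subgrad_evals_schedule_bounded _ _ _ prx DX sigma DX0 N N0.
  split.
  + apply: (expectation_complexity_certified (r := fun N => N%:R) (G := G2) DX0 DXb cert2 _ ge2
    ev2).
    by move=> N; rewrite ltr0n.
  + apply: (probability_complexity_certified (r := fun N => N%:R) (G := G2) DX0 DXb cert2 _ ge2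
    ev2).
    by move=> N; rewrite ltr0n.
Qed.
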